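(* Let $d\ge1$, $0<\rho<1$, $s>0$, and $0<p,q<1$. Let $\Lambda,M\subset\mathbb{R}^d$ be $\rho$-separated. Then the vector space $$\{f\in\mathcal{S}_s^{p,q}(\mathbb{R}^d): f|_\Lambda=0\text{ and }(-\Delta)^sf|_M=0\}$$ is infinite-dimensional. In particular, $(\Lambda,M)$ is a non-uniqueness pair for $(-\Delta)^s$ in $\mathcal{S}_s^{p,q}(\mathbb{R}^d)$, i.e. there is a nonzero $f\in\mathcal{S}_s^{p,q}(\mathbb{R}^d)$ with $f|_\Lambda=0$ and $(-\Delta)^sf|_M=0$.
   Context: A set in $\mathbb{R}^d$ is discrete if it has no accumulation point in $\mathbb{R}^d$. A discrete set $\Gamma\subset\mathbb{R}^d$ is $\rho$-separated if there exist $A,B>0$ such that $\operatorname{dist}(\gamma,\Gamma\setminus\{\gamma\})\ge Ae^{-B|\gamma|^\rho}$ for all $\gamma\in\Gamma$ (the distance to the empty set being $+\infty$). The Fourier transform is $\widehat f(\xi)=\int_{\mathbb{R}^d}f(x)e^{-2\pi i\xi\cdot x}\,dx$. For $s>0$ and $f$ in the Schwartz space $\mathcal{S}(\mathbb{R}^d)$ (complex-valued functions), $(-\Delta)^sf$ is the smooth function defined by $\widehat{(-\Delta)^sf}(\xi)=|\xi|^{2s}\widehat f(\xi)$. For $s>0$ and $0<p,q<\infty$, $\mathcal{S}_s^{p,q}(\mathbb{R}^d)$ is the space of all $f\in\mathcal{S}(\mathbb{R}^d)$ such that $(-\Delta)^sf\in\mathcal{S}(\mathbb{R}^d)$ and there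 exists $c=c_f>0$ with $$\sup_{x\in\mathbb{R}^d}|f(x)|e^{c|x|^p}+\sup_{x\in\mathbb{R}^d}|(-\Delta)^sf(x)|e^{c|x|^q}<\infty.$$ *)

(* Defs.v *)
From HB Require Import structures.
From mathcomp Require Import all_boot all_order all_algebra.
From mathcomp Require Import complex.
From mathcomp Require Import all_classical all_reals all_analysis.

Set Implicit Arguments.
Unset Strict Implicit.
Unset Printing Implicit Defensive.

Import Order.TTheory GRing.Theory Num.Theory.
Import numFieldNormedType.Exports.

Local Open Scope classical_set_scope.
Local Open Scope ring_scope.
Local Open Scope complex_scope.

(** Not [Num.Re] and [Num.Im], whose values are complex numbers. *)
Local Notation Re := (@complex.Re _).
Local Notation Im := (@complex.Im _).

(** R^d is ['rV[R]_d].  The norm that the library puts on ['rV[R]_d] is the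
    sup norm: it is used here only for its topology, and |x| is [enorm x]. *)

Section euclidean.
Context {R : realType} {d : nat}.
Implicit Types (x y : 'rV[R]_d) (G : set 'rV[R]_d).

Definition dotv x y : R := \sum_(i < d) x ord0 i * y ord0 i.

Definition enorm x : R := Num.sqrt (dotv x x).

Definition edistset x G : \bar R := ereal_inf [set (enorm (x - y))%:E | y in G].

Definition discrete_subset G : Prop := limit_point G = set0.

Definition rho_separated (rho : R) G : Prop :=
  discrete_subset G /\
  exists A B : R, [/\ 0 < A, 0 < B & forall x, G x ->
    ((A * expR (- B * enorm x `^ rho))%:E <= edistset x (G `\ x))%E].

End euclidean.

(** Lebesgue measure on R^n, as the n-fold product of Lebesgue measure on R,
    carried by n-tuples. *)

Section lebesgue_tuple.
Context {R : realType}.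
Local Notation T := (measurableTypeR R).

Definition consp n (z : T * n.-tuple T) : n.+1.-tuple T :=
  [the n.+1.-tuple T of z.1 :: z.2].

Lemma measurable_consp n : measurable_fun setT (@consp n).
Proof. exact: (measurable_cons measurable_fst measurable_snd). Qed.

Section succ.
Context {n : nat} (mu : {sigma_finite_measure set (n.-tuple T) -> \bar R}).

Definition lebesgue_cons : set (n.+1.-tuple T) -> \bar R :=
  pushforward ((@lebesgue_measure R) \x mu)%E (@consp n).

Let lebesgue_cons0 : lebesgue_cons set0 = 0%E.
Proof. by rewrite /lebesgue_cons /pushforward preimage_set0 measure0. Qed.

Let lebesgue_cons_ge0 A : (0 <= lebesgue_cons A)%E.
Proof. by rewrite /lebesgue_cons /pushforward measure_ge0. Qed.

Let lebesgue_cons_sigma_additive : semi_sigma_additive lebesgue_cons.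
Proof.
move=> F mF tF mUF; rewrite /lebesgue_cons /pushforward preimage_bigcup.
have mP k : measurable (@consp n @^-1` F k).
  by rewrite -[X in measurable X]setTI; exact: measurable_consp.
apply: measure_semi_sigma_additive => //.
- apply/trivIsetP => /= i j _ _ ij; rewrite -preimage_setI.
  by move/trivIsetP : tF => /(_ _ _ _ _ ij) ->//; rewrite preimage_set0.
- by apply: bigcup_measurable => k _; exact: mP.
Qed.

HB.instance Definition _ := isMeasure.Build _ _ _ lebesgue_cons
  lebesgue_cons0 lebesgue_cons_ge0 lebesgue_cons_sigma_additive.

Let lebesgue_cons_sigma_finite : sigma_finite setT lebesgue_cons.
Proof.
have /sigma_finiteP[F [FT ndF Foo]] := sigma_finiteT (@lebesgue_measure R).
have /sigma_finiteP[G [GT ndG Goo]] := sigma_finiteT mu.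
pose u (t : n.+1.-tuple T) : T * n.-tuple T :=
  (thead t, [tuple of behead t]).
have uK : cancel (@consp n) u.
  by move=> [a t]; congr pair; apply/val_inj.
have mu_ : measurable_fun setT u.
  apply: measurable_fun_pair; first exact: measurable_tnth.
  exact: measurable_behead.
exists (fun k => u @^-1` (F k `*` G k)).
  rewrite -preimage_bigcup; apply/esym; rewrite -subTset => t _ /=.
  have [i _ Fi] : (\bigcup_i F i) (u t).1 by rewrite -FT.
  have [j _ Gj] : (\bigcup_i G i) (u t).2 by rewrite -GT.
  exists (maxn i j) => //; split.
    by move: Fi; exact/subsetPset/ndF/leq_maxl.
  by move: Gj; exact/subsetPset/ndG/leq_maxr.
move=> k; have [mF Fk] := Foo k; have [mG Gk] := Goo k; split.
  by rewrite -[X in measurable X]setTI; apply: mu_ => //; exact: measurableX.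
rewrite /lebesgue_cons /pushforward -comp_preimage.
rewrite (_ : u \o _ = id) ?preimage_id; last exact/funext.
by rewrite product_measure1E// lte_mul_pinfty// ge0_fin_numE.
Qed.

HB.instance Definition _ := Measure_isSigmaFinite.Build _ _ _ lebesgue_cons
  lebesgue_cons_sigma_finite.

End succ.

Fixpoint lebesgue_tuple n : {sigma_finite_measure set (n.-tuple T) -> \bar R} :=
  match n with
  | 0 => \d_([tuple] : 0.-tuple T)
  | m.+1 => lebesgue_cons (lebesgue_tuple m)
  end.

Definition rowt n (t : n.-tuple T) : 'rV[R]_n := \row_(i < n) tnth t i.

End lebesgue_tuple.

Section complex_integral.
Context {R : realType} {d : nat}.
Implicit Type f : 'rV[R]_d -> R[i].

Definition integrableRd f : Prop :=
  (lebesgue_tuple d).-integrable setT (fun t => (Re (f (rowt t)))%:E) /\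
  (lebesgue_tuple d).-integrable setT (fun t => (Im (f (rowt t)))%:E).

Definition integralRd f : R[i] :=
  (\int[lebesgue_tuple d]_t Re (f (rowt t))) +i*
  (\int[lebesgue_tuple d]_t Im (f (rowt t))).

Definition expi (t : R) : R[i] := cos t +i* sin t.

Definition fourier f (xi : 'rV[R]_d) : R[i] :=
  integralRd (fun x => f x * expi (- (2 * pi * dotv xi x))).

End complex_integral.

Section schwartz.
Context {R : realType} {d : nat}.

Definition basisv (i : 'I_d) : 'rV[R]_d := delta_mx ord0 i.

(** The mixed partial derivative along the word [l] of coordinate indices.
    For smooth functions it depends only on the multiset of letters of [l],
    so words play the role of multi-indices. *)
Definition partials (l : seq 'I_d) (u : 'rV[R]_d -> R) : 'rV[R]_d -> R :=
  foldr (fun i v => 'D_(basisv i) v) u l.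

(** [derive] is a total operator, hence the explicit derivability clause. *)
Definition smoothR (u : 'rV[R]_d -> R) : Prop :=
  forall l : seq 'I_d, continuous (partials l u) /\
    forall (i : 'I_d) x, derivable (partials l u) x (basisv i).

Implicit Type f : 'rV[R]_d -> R[i].

Definition smooth f : Prop := smoothR (Re \o f) /\ smoothR (Im \o f).

Definition cpartials (l : seq 'I_d) f (x : 'rV[R]_d) : R[i] :=
  partials l (Re \o f) x +i* partials l (Im \o f) x.

Definition cmod (z : R[i]) : R := Re `|z|.

Definition monomial (a : 'I_d -> nat) (x : 'rV[R]_d) : R :=
  \prod_(i < d) x ord0 i ^+ a i.

Definition schwartz f : Prop :=
  smooth f /\
  forall (a : 'I_d -> nat) (l : seq 'I_d), exists C : R, forall x,
    cmod ((monomial a x)%:C * cpartials l f x) <= C.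

End schwartz.

Section fractional_laplacian.
Context {R : realType} {d : nat}.
Implicit Types (f g : 'rV[R]_d -> R[i]) (L M : set 'rV[R]_d).

(** [is_fraclap s f g] reads "g = (-Delta)^s f".  For f Schwartz and s > 0
    such a g exists (it is smooth and O(|x|^(-d-2s)), hence integrable) and is
    unique by injectivity of the Fourier transform, so this is the graph of a
    function on the Schwartz space. *)
Definition is_fraclap (s : R) f g : Prop :=
  [/\ smooth g, integrableRd g &
    forall xi, fourier g xi = (enorm xi `^ (2 * s))%:C * fourier f xi].

Definition weighted_sup (c p : R) f : \bar R :=
  ereal_sup (range (fun x => (cmod (f x) * expR (c * enorm x `^ p))%:E)).

(** f is in S_s^{p,q}, with g = (-Delta)^s f. *)
Definition in_Sspq (s p q : R) f g : Prop :=
  [/\ schwartz f, is_fraclap s f g, schwartz g &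
    exists2 c : R, 0 < c &
      (weighted_sup c p f + weighted_sup c q g < +oo)%E].

Definition Sspq (s p q : R) : set ('rV[R]_d -> R[i]) :=
  [set f | exists g, in_Sspq s p q f g].

Definition vanishes_on f L : Prop := forall x, L x -> f x = 0.

Definition Sspq_vanishing (s p q : R) L M : set ('rV[R]_d -> R[i]) :=
  [set f | Sspq s p q f /\ vanishes_on f L /\
    exists2 g, is_fraclap s f g & vanishes_on g M].

Definition nonuniqueness_pair (s p q : R) L M : Prop :=
  exists f, [/\ Sspq s p q f, f <> (fun=> 0), vanishes_on f L &
    exists2 g, is_fraclap s f g & vanishes_on g M].

End fractional_laplacian.

Section dimension.
Context {K : fieldType} {X : Type}.

Definition is_subspace (V : set (X -> K)) : Prop :=
  V (fun=> 0) /\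
  forall (a : K) u v, V u -> V v -> V (fun x => a * u x + v x).

Definition finitely_spanned (V : set (X -> K)) : Prop :=
  exists (n : nat) (e : 'I_n -> X -> K),
    (forall i, V (e i)) /\
    forall v, V v -> exists a : 'I_n -> K, forall x, v x = \sum_(i < n) a i * e i x.

Definition infinite_dimensional_space (V : set (X -> K)) : Prop :=
  is_subspace V /\ ~ finitely_spanned V.

End dimension.

(* Main.v *)
Require Import Defs.
From HB Require Import structures.
From mathcomp Require Import all_boot all_order all_algebra.
From mathcomp Require Import complex.
From mathcomp Require Import all_classical all_reals all_analysis.
From mathcomp Require Import measurable_realfun ring lra zify.

Set Implicit Arguments.
Unset Strict Implicit.
Unset Printing Implicit Defensive.

Import Order.TTheory GRing.Theory Num.Theory.
Import numFieldNormedType.Exports.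

Local Open Scope classical_set_scope.
Local Open Scope ring_scope.
Local Open Scope complex_scope.

(** Idea.  On the line, [w ^ beta exp (- w ^ tau)], [0 < tau < 1], is holomorphic
    in a half-plane, so its restriction to the vertical line [Re w = const] decays
    like [exp (- c |x| ^ tau)] and has a Fourier transform supported on a half-line.
    Multiply it by a wave, let the heat flow act during a time [u ^ 2], tensorise
    over the coordinates, and integrate against [|u| ^ k du]: the Fourier transform
    becomes [|xi| ^ (- k - 1)] times a factor that does not depend on [k].  The
    values [k = 2 s] and [k = 0] therefore give, up to a constant, a pair [(P, Q)]
    with [Q = (- Delta) ^ s P], both decaying like [exp (- c |x| ^ tau)]; a scaling
    parameter [dl] near [0] makes both nonzero at the origin.

    With [rho < theta < tau], put a copy of the pair, rescaled by
    [k exp (- K |z| ^ rho)], at every point [z] of [L] and of [M].  Prescribing [f]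
    on [L] and [(- Delta) ^ s f] on [M] becomes an infinite linear system which is,
    in a weighted sup norm, a small perturbation of the identity, hence solvable by
    a Neumann series.  Adding finitely many points to [L] and prescribing arbitrary
    values there yields arbitrarily many independent elements. *)

(** The symbol [|xi| ^ (2 s)] is singular at the origin, which in general limits the decay of
    [(- Delta) ^ s f] to a power of [|x|]; the building blocks escape because their spectrum stays
    away from [0]. Exponential decay is incompatible with a spectral gap, since it makes the Fourier
    transform real analytic; stretched exponentials with [tau < 1] are compatible with it, and this
    is where [p, q < 1] enters. The wave [exp (i x)] moves the half-line to [[1, +oo)], so the heat
    flow decays like a Gaussian in [u] and the integral in [u] keeps the decay in [x]. The power of
    [|xi|] comes from the integral of [|u| ^ k exp (- u ^ 2 r ^ 2)], proportional to
    [r ^ (- k - 1)]. For [dl] tending to [0] the holomorphic factor becomes a constant and the flow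
    at the origin an explicit positive Gaussian. A node may be as close as [exp (- B |z| ^ rho)] to
    the next one. A scale smaller by a further factor [exp (- D |z| ^ rho)] makes the interactions
    summable, because separated sets have only exponentially many points in [|z| ^ rho]. The
    amplitudes cost factors [exp (K |z| ^ rho)], which data of size [exp (- |z| ^ theta)] can
    afford. *)

Section complex_calculus.
Context {R : realType}.
Implicit Types (a b c z : R[i]) (x r : R).
Local Notation Re := (@complex.Re R).
Local Notation Im := (@complex.Im R).

(** * Complex exponential and derivatives of complex functions of a real variable *)

Lemma ReM a b : Re (a * b) = Re a * Re b - Im a * Im b.
Proof. by case: a; case: b. Qed.

Lemma ImM a b : Im (a * b) = Re a * Im b + Im a * Re b.
Proof. by case: a; case: b. Qed.

Lemma ReD a b : Re (a + b) = Re a + Re b.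
Proof. by case: a; case: b. Qed.

Lemma ImD a b : Im (a + b) = Im a + Im b.
Proof. by case: a; case: b. Qed.

Lemma complex_eq a b : Re a = Re b -> Im a = Im b -> a = b.
Proof. by case: a; case: b => /= ? ? ? ? -> ->. Qed.

(** Testing against [1] and [- 'i] recovers both coordinates; complex identities between integrals
    or derivatives thus reduce to real ones. *)
Lemma eq_ReM a b : (forall c, Re (c * a) = Re (c * b)) -> a = b.
Proof.
move=> h; apply: complex_eq; first by have := h 1; rewrite !mul1r.
by have := h (0 -i* 1); rewrite !ReM /= !mul0r !sub0r !mulN1r !opprK.
Qed.

Lemma cmodE z : cmod z = Num.sqrt (Re z ^+ 2 + Im z ^+ 2).
Proof. by case: z. Qed.

Lemma normC_cmod z : `|z| = (cmod z)%:C.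
Proof. by case: z. Qed.

Lemma cmodM a b : cmod (a * b) = cmod a * cmod b.
Proof. by rewrite /cmod normrM !normC_cmod ReM /= mulr0 subr0. Qed.

Lemma cmod_ge0 z : 0 <= cmod z.
Proof. by rewrite cmodE sqrtr_ge0. Qed.

Lemma ler_cmodD a b : cmod (a + b) <= cmod a + cmod b.
Proof.
by have := ler_normD a b; rewrite !normC_cmod -rmorphD lecR.
Qed.

Lemma Re_le_cmod z : `|Re z| <= cmod z.
Proof. by rewrite cmodE -sqrtr_sqr ler_wsqrtr// lerDl sqr_ge0. Qed.

Lemma Im_le_cmod z : `|Im z| <= cmod z.
Proof. by rewrite cmodE -sqrtr_sqr ler_wsqrtr// lerDr sqr_ge0. Qed.

Lemma cmodR x : cmod x%:C = `|x|.
Proof. by rewrite cmodE /= expr0n addr0 sqrtr_sqr. Qed.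

Lemma cmodN z : cmod (- z) = cmod z.
Proof. by rewrite /cmod normrN. Qed.

Lemma cmod_i : cmod ('i : R[i]) = 1.
Proof. by rewrite cmodE /= expr0n expr1n add0r sqrtr1. Qed.

Lemma mulii : 'i * 'i = -1 :> R[i].
Proof. by apply: complex_eq => /=; ring. Qed.

Lemma cmod_le_ReIm z : cmod z <= `|Re z| + `|Im z|.
Proof.
rewrite cmodE -[leRHS]ger0_norm ?addr_ge0// -sqrtr_sqr ler_wsqrtr//.
rewrite -(real_normK (num_real (Re z))) -(real_normK (num_real (Im z))).
by have := normr_ge0 (Re z); have := normr_ge0 (Im z); nra.
Qed.

Lemma cmod_prod (I : Type) (s : seq I) (F : I -> R[i]) :
  cmod (\prod_(i <- s) F i) = \prod_(i <- s) cmod (F i).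
Proof.
elim/big_ind2 : _ => //; first by rewrite (cmodR 1) normr1.
by move=> a x b y <- <-; exact: cmodM.
Qed.

Definition cexp z : R[i] := (expR (Re z) * cos (Im z)) +i* (expR (Re z) * sin (Im z)).

Lemma cexpD a b : cexp (a + b) = cexp a * cexp b.
Proof.
by apply: complex_eq;
  rewrite ?ReM ?ImM /= ReD ImD expRD ?cosD ?sinD; ring.
Qed.

Lemma cmod_cexp z : cmod (cexp z) = expR (Re z).
Proof.
rewrite cmodE /= !exprMn -mulrDr cos2Dsin2 mulr1 sqrtr_sqr ger0_norm ?expR_ge0//.
Qed.

Lemma cexp0 : cexp 0 = 1.
Proof. by apply: complex_eq; rewrite /= expR0 ?cos0 ?sin0 mul1r. Qed.

Lemma cexpR x : cexp x%:C = (expR x)%:C.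
Proof. by rewrite /cexp /= cos0 sin0 mulr1 mulr0. Qed.

Lemma expiE x : expi x = cexp (0 +i* x).
Proof. by rewrite /expi /cexp /= expR0 !mul1r. Qed.

Lemma expiD x r : expi (x + r) = expi x * expi r.
Proof. by rewrite !expiE -cexpD; congr cexp; apply: complex_eq; rewrite /= ?addr0. Qed.

Lemma expi0 : expi 0 = 1 :> R[i].
Proof. by rewrite expiE cexp0. Qed.

Lemma expi_sum (I : Type) (s : seq I) (F : I -> R) :
  expi (\sum_(i <- s) F i) = \prod_(i <- s) expi (F i).
Proof. by elim/big_rec2 : _ => [|i y1 y2 _ <-]; rewrite ?expi0 ?expiD. Qed.

Lemma cmod_expi x : cmod (expi x) = 1.
Proof. by rewrite expiE cmod_cexp expR0. Qed.

(** Testing against all complex [c] encodes the derivatives of the real and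
    imaginary parts at once. *)
Definition cder (F : R -> R[i]) x (l : R[i]) :=
  forall c, is_derive x (1 : R) (fun y => Re (c * F y)) (Re (c * l)).

Lemma cder_cst a x : cder (fun=> a) x 0.
Proof. by move=> c; rewrite mulr0 /=; exact: is_derive_cst. Qed.

Lemma cderD F G x l m : cder F x l -> cder G x m ->
  cder (fun y => F y + G y) x (l + m).
Proof.
move=> hF hG c; rewrite (_ : (fun y => _) =
  (fun y => Re (c * F y)) + (fun y => Re (c * G y))); last first.
  by apply/funext => y; rewrite mulrDr ReD.
rewrite mulrDr ReD; exact: is_deriveD.
Qed.

Lemma cderMl a F x l : cder F x l -> cder (fun y => a * F y) x (a * l).
Proof.
move=> hF c; rewrite (_ : (fun y => _) = (fun y => Re ((c * a) * F y))).
  by rewrite mulrA; exact: hF.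
by apply/funext => y; rewrite mulrA.
Qed.

Lemma cder_Re F x l : cder F x l -> is_derive x (1 : R) (fun y => Re (F y)) (Re l).
Proof. by move=> /(_ 1); under eq_fun do rewrite mul1r; rewrite mul1r. Qed.

Lemma cder_Im F x l : cder F x l -> is_derive x (1 : R) (fun y => Im (F y)) (Im l).
Proof.
move=> /(_ (0 -i* 1)) h.
rewrite (_ : (fun y => Im _) = (fun y => Re ((0 -i* 1) * F y))).
  by rewrite (_ : Im l = Re ((0 -i* 1) * l))// ReM /=; ring.
by apply/funext => y; rewrite ReM /=; ring.
Qed.

Lemma cder_ReIm F x l : is_derive x (1 : R) (fun y => Re (F y)) (Re l) ->
  is_derive x (1 : R) (fun y => Im (F y)) (Im l) -> cder F x l.
Proof.
move=> h1 h2 c; rewrite (_ : (fun y => _) =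
  (Re c \*: (fun y => Re (F y))) - (Im c \*: (fun y => Im (F y)))).
  by rewrite ReM; apply: is_deriveB.
by apply/funext => y; rewrite ReM.
Qed.

Lemma cder_cexp F x l : cder F x l -> cder (fun y => cexp (F y)) x (l * cexp (F x)).
Proof.
move=> hF; have h1 := cder_Re hF; have h2 := cder_Im hF.
have he : is_derive x (1 : R) (fun y => expR (Re (F y))) (expR (Re (F x)) * Re l).
  exact: (@is_derive1_comp _ expR (fun y => Re (F y))).
have hc : is_derive x (1 : R) (fun y => cos (Im (F y))) (- sin (Im (F x)) * Im l).
  exact: (@is_derive1_comp _ cos (fun y => Im (F y))).
have hs : is_derive x (1 : R) (fun y => sin (Im (F y))) (cos (Im (F x)) * Im l).
  exact: (@is_derive1_comp _ sin (fun y => Im (F y))).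
apply: cder_ReIm.
- apply: (is_derive_eq (is_deriveM he hc)).
  by rewrite ReM /= /GRing.scale /=; ring.
- apply: (is_derive_eq (is_deriveM he hs)).
  by rewrite ImM /= /GRing.scale /=; ring.
Qed.

Lemma cder_comp F (g : R -> R) x l r : cder F (g x) l -> is_derive x (1 : R) g r ->
  cder (fun y => F (g y)) x (r%:C * l).
Proof.
move=> hF hg c.
apply: (is_derive_eq (@is_derive1_comp _ (fun y => Re (c * F y)) g _ _ _ (hF c) hg)).
by rewrite !ReM !ImM /=; ring.
Qed.

Lemma cderM F G x l m : cder F x l -> cder G x m ->
  cder (fun y => F y * G y) x (F x * m + l * G x).
Proof.
move=> hF hG.
have [f1 f2 g1 g2] := And4 (cder_Re hF) (cder_Im hF) (cder_Re hG) (cder_Im hG).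
apply: cder_ReIm.
- rewrite (_ : (fun y => _) =
    (fun y => Re (F y)) * (fun y => Re (G y)) - (fun y => Im (F y)) * (fun y => Im (G y))).
    apply: (is_derive_eq (is_deriveB (is_deriveM f1 g1) (is_deriveM f2 g2))).
    by rewrite ReD !ReM /GRing.scale /=; ring.
  by apply/funext => y; rewrite ReM.
- rewrite (_ : (fun y => _) =
    (fun y => Re (F y)) * (fun y => Im (G y)) + (fun y => Im (F y)) * (fun y => Re (G y))).
    apply: (is_derive_eq (is_deriveD (is_deriveM f1 g2) (is_deriveM f2 g1))).
    by rewrite ImD !ImM /GRing.scale /=; ring.
  by apply/funext => y; rewrite ImM.
Qed.

Lemma is_derive_expi x : cder (fun y => expi y) x ('i * expi x).
Proof.
apply: cder_ReIm => /=.
  by apply: is_derive_eq; rewrite ?mul0r ?mul1r ?sub0r.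
by apply: is_derive_eq; rewrite ?mul0r ?mul1r ?add0r.
Qed.

End complex_calculus.

(** * The functions [w ^ beta exp (- w ^ tau)] in a half-plane *)

Section subordinator.
Context {R : realType}.
Implicit Types (a b c x t : R).
Local Notation Re := (@complex.Re R).
Local Notation Im := (@complex.Im R).

Lemma sin_atan x : sin (atan x) = x / Num.sqrt (1 + x ^+ 2).
Proof.
have := atanK x; rewrite /tan => /(congr1 (fun y => y * cos (atan x))).
rewrite -mulrA mulVf ?mulr1; first by rewrite cos_atan.
by rewrite cos_atan invr_eq0 gt_eqF// sqrtr_gt0 ltr_pwDl// sqr_ge0.
Qed.

(** The principal logarithm of [a - i b], for [a > 0]. *)
Definition clog a b : R[i] := (ln (a ^+ 2 + b ^+ 2) / 2) -i* atan (b / a).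

Lemma sqr_norm_gt0 a b : 0 < a -> 0 < a ^+ 2 + b ^+ 2.
Proof. by move=> a0; rewrite ltr_pwDl ?sqr_ge0// exprn_gt0. Qed.

Lemma sqrt_ratio a b : 0 < a ->
  Num.sqrt (1 + (b / a) ^+ 2) = Num.sqrt (a ^+ 2 + b ^+ 2) / a.
Proof.
move=> a0; have q0 := sqr_norm_gt0 b a0.
rewrite (_ : 1 + _ = (a ^+ 2 + b ^+ 2) * (a ^- 1) ^+ 2); last by field; rewrite gt_eqF.
by rewrite sqrtrM ?(ltW q0)// sqrtr_sqr expr1 ger0_norm// invr_ge0 ltW.
Qed.

(** This is [1 / w = conj w / |w| ^ 2] for [w = a - i b]. Below, [cexp (- clog a b)] plays the role
    of [1 / w], the derivative of the logarithm. *)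
Lemma cexpN_clog a b : 0 < a -> cexp (- clog a b) =
  (a / (a ^+ 2 + b ^+ 2)) +i* (b / (a ^+ 2 + b ^+ 2)).
Proof.
move=> a0; have q0 := sqr_norm_gt0 b a0; set q := a ^+ 2 + b ^+ 2 in q0 *.
have s0 : 0 < Num.sqrt q by rewrite sqrtr_gt0.
have qE : q = Num.sqrt q ^+ 2 by rewrite sqr_sqrtr// ltW.
have e1 : expR (- (ln q / 2)) = (Num.sqrt q)^-1.
  by rewrite expRN -powR12_sqrt ?(ltW q0)// /powR gt_eqF// mulrC.
apply: complex_eq; rewrite /= e1 opprK -/q ?cos_atan ?sin_atan sqrt_ratio// -/q {3}qE.
  by field; rewrite !gt_eqF.
by field; rewrite !gt_eqF.
Qed.

(** The derivative of [log w] in [b] is [- i / w], the one in [a] is [1 / w]: together these two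
    lemmas encode holomorphy. *)
Lemma cder_clogr a b : 0 < a -> cder (clog a) b (- 'i * cexp (- clog a b)).
Proof.
move=> a0; rewrite cexpN_clog//; have q0 := sqr_norm_gt0 b a0.
apply: cder_ReIm => /=.
- have h1 : is_derive b (1 : R) (fun y => a ^+ 2 + y ^+ 2) (2 * b).
    by apply: is_derive_eq; rewrite /GRing.scale /=; ring.
  have h2 := @is_derive1_comp _ (@ln R) (fun y => a ^+ 2 + y ^+ 2) b _ _ (is_derive1_ln q0) h1.
  rewrite (_ : (fun y => _) = 2^-1 \*: (@ln R \o (fun y => a ^+ 2 + y ^+ 2))).
    apply: (is_derive_eq (is_deriveZ 2^-1 h2)).
    by rewrite /GRing.scale /=; field; rewrite gt_eqF.
  by apply/funext => y /=; rewrite mulrC.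
- have h1 : is_derive b (1 : R) (fun y => y / a) (a^-1).
    rewrite (_ : (fun y => _) = a^-1 \*: id); last by apply/funext => y /=; rewrite mulrC.
    by apply: is_derive_eq; rewrite /GRing.scale /= mulr1.
  have h2 := @is_derive1_comp _ (@atan R) (fun y => y / a) b _ _ (is_derive1_atan (b / a)) h1.
  apply: (is_derive_eq (is_deriveN h2)).
  by field; rewrite !gt_eqF// addrC.
Qed.

Lemma cder_clogl a b : 0 < a -> cder (clog ^~ b) a (cexp (- clog a b)).
Proof.
move=> a0; rewrite cexpN_clog//; have q0 := sqr_norm_gt0 b a0.
apply: cder_ReIm => /=.
- have h1 : is_derive a (1 : R) (fun y => y ^+ 2 + b ^+ 2) (2 * a).
    by apply: is_derive_eq; rewrite /GRing.scale /=; ring.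
  have h2 := @is_derive1_comp _ (@ln R) (fun y => y ^+ 2 + b ^+ 2) a _ _ (is_derive1_ln q0) h1.
  rewrite (_ : (fun y => _) = 2^-1 \*: (@ln R \o (fun y => y ^+ 2 + b ^+ 2))).
    apply: (is_derive_eq (is_deriveZ 2^-1 h2)).
    by rewrite /GRing.scale /=; field; rewrite gt_eqF.
  by apply/funext => y /=; rewrite mulrC.
- have h1 : is_derive a (1 : R) (fun y => b / y) (- b * a ^- 2).
    have a1 : a != 0 by rewrite gt_eqF.
    have h := @is_deriveV R id a 1 1 a1 (is_derive_id a 1).
    apply: (is_derive_eq (is_deriveZ b h)).
    by rewrite /GRing.scale /= mulr1 mulrN mulNr.
  have h2 := @is_derive1_comp _ (@atan R) (fun y => b / y) a _ _ (is_derive1_atan (b / a)) h1.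
  apply: (is_derive_eq (is_deriveN h2)).
  by field; rewrite !gt_eqF// addrC.
Qed.

Variable tau : R.

(** [w ^ beta exp (- w ^ tau)] at [w = a - i b]. *)
Definition wexp (beta a b : R) : R[i] :=
  cexp (beta%:C * clog a b - cexp (tau%:C * clog a b)).

(** Chain rule along a curve [w = f - i g] of velocity [k]; the bracket is the complex derivative of
    [w ^ beta exp (- w ^ tau)]. One statement covers the real and the imaginary direction. *)
Lemma cder_wexp beta (f g : R -> R) x k :
  cder (fun y => clog (f y) (g y)) x (k * cexp (- clog (f x) (g x))) ->
  cder (fun y => wexp beta (f y) (g y)) x
    (k * (beta%:C * wexp (beta - 1) (f x) (g x)
          - tau%:C * wexp (beta + tau - 1) (f x) (g x))).
Proof.
move=> h; rewrite /wexp.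
have h1 := cderMl tau%:C h.
have h2 := cderMl (-1) (cder_cexp h1).
have h3 := cder_cexp (cderD (cderMl beta%:C h) h2).
move: h3; rewrite (_ : (fun y => _) = (fun y => cexp (beta%:C * clog (f y) (g y) - cexp (tau%:C * clog (f y) (g y))))).
  set L := clog (f x) (g x); set E := cexp (- (cexp (tau%:C * L))).
  congr cder; rewrite !mulN1r !rmorphB !rmorphD /= !mulrBl !mulrDl !cexpD !mul1r -/E.
  ring.
by apply/funext => y; rewrite mulN1r.
Qed.

(** Lists of pairs (coefficient, exponent) give a class closed under differentiation, so that all
    derivatives are estimated at once. *)
Definition wexps (l : seq (R * R)) a b : R[i] :=
  \sum_(p <- l) p.1%:C * wexp p.2 a b.

Definition dwexps (l : seq (R * R)) : seq (R * R) :=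
  flatten [seq [:: (p.1 * p.2, p.2 - 1); (- (p.1 * tau), p.2 + tau - 1)] | p <- l].

Definition scaless k (l : seq (R * R)) : seq (R * R) := [seq (k * p.1, p.2) | p <- l].

Definition nonpos_exps (l : seq (R * R)) := all (fun p => p.2 <= 0) l.

Lemma wexps_cat l1 l2 a b : wexps (l1 ++ l2) a b = wexps l1 a b + wexps l2 a b.
Proof. by rewrite /wexps big_cat. Qed.

Lemma wexps_scale k l a b : wexps (scaless k l) a b = k%:C * wexps l a b.
Proof.
rewrite /wexps big_map mulr_sumr; apply: eq_bigr => p _.
by rewrite rmorphM mulrA.
Qed.

Lemma cder_wexps l (f g : R -> R) x k :
  cder (fun y => clog (f y) (g y)) x (k * cexp (- clog (f x) (g x))) ->
  cder (fun y => wexps l (f y) (g y)) x (k * wexps (dwexps l) (f x) (g x)).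
Proof.
move=> h; elim: l => [|p l IH].
  rewrite /wexps /=; under eq_fun do rewrite big_nil.
  by rewrite big_nil mulr0; exact: cder_cst.
rewrite /wexps; under eq_fun do rewrite big_cons.
have := cderD (cderMl p.1%:C (cder_wexp p.2 h)) IH.
congr cder; rewrite /dwexps /= !big_cons /= -/(dwexps l) -/(wexps (dwexps l) _ _).
by rewrite rmorphN !rmorphM /=; ring.
Qed.

Hypothesis tau01 : 0 < tau < 1.

Definition decay_rate : R := cos (tau * (pi / 2)).

Lemma decay_rate_gt0 : 0 < decay_rate.
Proof.
have [t0 t1] := andP tau01; apply: cos_gt0_pihalf.
have p0 : 0 < pi / 2 :> R by rewrite divr_gt0// pi_gt0.
apply/andP; split; last by rewrite gtr_pMl.
by have := mulr_gt0 t0 p0; lra.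
Qed.

(** [Re (w ^ tau) = |w| ^ tau cos (tau arg w)], where [|w| >= |b|] and [|arg w| <= pi / 2]; since
    [tau < 1], the cosine is at least [cos (tau pi / 2) > 0]. *)
Lemma Re_cpow a b : 0 < a -> decay_rate * `|b| `^ tau <= Re (cexp (tau%:C * clog a b)).
Proof.
move=> a0; have [t0 t1] := andP tau01; have q0 := sqr_norm_gt0 b a0.
have p0 : 0 < pi / 2 :> R by rewrite divr_gt0// pi_gt0.
rewrite /cexp /clog /= !mul0r subr0 addr0 mulrN cosN mulrC.
apply: ler_pM; rewrite ?powR_ge0 ?(ltW decay_rate_gt0)//.
  have [->|b0] := eqVneq b 0; first by rewrite normr0 powR0 ?expR_ge0 ?gt_eqF.
  have nb0 : 0 < `|b| by rewrite normr_gt0.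
  rewrite /powR gt_eqF// ler_expR ler_pM2l// ler_pdivlMr// mulr_natr -lnXn//.
  by rewrite ler_ln ?posrE ?exprn_gt0// real_normK ?num_real// lerDr sqr_ge0.
have lt1 : `|tau * atan (b / a)| <= tau * (pi / 2).
  rewrite normrM (ger0_norm (ltW t0)) ler_pM2l// ler_norml.
  by rewrite (ltW (atan_gtNpi2 _)) (ltW (atan_ltpi2 _)).
have -> : cos (tau * atan (b / a)) = cos `|tau * atan (b / a)|.
  by case: ler0P => // _; rewrite cosN.
have tp : tau * (pi / 2) <= pi.
  rewrite (le_trans (y := pi / 2)) ?ler_piMl// ?(ltW p0) ?(ltW t1)//.
  by have := pi_gt0 R; lra.
rewrite /decay_rate leNgt ltr_cos ?in_itv /= ?normr_ge0 ?(le_trans lt1)// -?leNgt//.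
by rewrite mulr_ge0 ?(ltW t0) ?(ltW p0).
Qed.

Lemma cmod_wexp beta a b : 1 <= a -> beta <= 0 ->
  cmod (wexp beta a b) <= expR (- (decay_rate * `|b| `^ tau)).
Proof.
move=> a1 b0; have a0 : 0 < a by rewrite (lt_le_trans ltr01).
rewrite cmod_cexp ler_expR ReD -[leRHS]add0r lerD//.
  rewrite ReM /= mul0r subr0 mulr_le0_ge0// divr_ge0// ln_ge0//.
  by rewrite (le_trans (y := a ^+ 2)) ?lerDl ?sqr_ge0// expr_ge1 ?(ltW a0).
by rewrite (_ : Re (- _) = - Re (cexp (tau%:C * clog a b)))// lerN2 Re_cpow.
Qed.

Lemma cmod_wexps l : nonpos_exps l -> exists2 C, 0 <= C & forall a b, 1 <= a ->
  cmod (wexps l a b) <= C * expR (- (decay_rate * `|b| `^ tau)).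
Proof.
elim: l => [|p l IH] /=.
  by exists 0 => // a b a1; rewrite /wexps big_nil mul0r (cmodR 0) normr0.
move=> /andP[p0 /IH[C C0 hC]]; exists (`|p.1| + C); first by rewrite addr_ge0.
move=> a b a1; rewrite /wexps big_cons (le_trans (ler_cmodD _ _))// mulrDl lerD//.
  by rewrite cmodM cmodR ler_wpM2l// cmod_wexp.
exact: hC.
Qed.

(** The new exponents [beta - 1] and [beta + tau - 1] are nonpositive because [tau < 1]. *)
Lemma nonpos_dwexps l : nonpos_exps l -> nonpos_exps (dwexps l).
Proof.
have [t0 t1] := andP tau01.
elim: l => //= p l IH /andP[p0 /IH h]; apply/and3P; split => //=; lra.
Qed.

Lemma nonpos_scaless k l : nonpos_exps l -> nonpos_exps (scaless k l).
Proof. by rewrite /nonpos_exps all_map. Qed.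

Lemma nonpos_cat l1 l2 : nonpos_exps (l1 ++ l2) = nonpos_exps l1 && nonpos_exps l2.
Proof. exact: all_cat. Qed.

End subordinator.

(** * Affine changes of variable for Lebesgue measure on the line *)

Section affine_change.
Context {R : realType}.
Local Notation T := (measurableTypeR R).
Local Notation mu := (@lebesgue_measure R).
Variables (k b : R).
Hypothesis k0 : 0 < k.
Let phi (x : T) : T := k * x + b.

Let mphi : measurable_fun setT phi.
Proof. by apply: measurable_funD => //; exact: measurable_funM. Qed.

Let pf : {measure set T -> \bar R}.
Proof.
unshelve refine [the {measure set T -> \bar R} of pushforward mu phi]; exact: mphi.
Defined.

Let nu := mscale (NngNum (ltW k0)) pf.

(** Uniqueness of Lebesgue measure reduces the claim to half-open intervals. *)
Let nuE A : measurable A -> mu A = nu A.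
Proof.
move=> mA; apply: lebesgue_measure_unique => //= _ [[p q]] _ <-.
rewrite /nu /mscale /= /pushforward.
rewrite (_ : phi @^-1` _ = [set` `]((p - b) / k), ((q - b) / k)]]); last first.
  apply/seteqP; split=> x /=; rewrite !in_itv /= /phi => /andP[h1 h2]; apply/andP; split.
  - by rewrite ltr_pdivrMr// ltrBlDr mulrC.
  - by rewrite ler_pdivlMr// lerBrDr mulrC.
  - by rewrite mulrC -ltrBlDr -ltr_pdivrMr.
  - by rewrite mulrC -lerBrDr -ler_pdivlMr.
rewrite !lebesgue_measure_itv /= !lte_fin ltr_pM2r ?invr_gt0// ltrD2r.
case: ifPn => _; last by rewrite mule0.
rewrite -!EFinB -EFinM; congr EFin; field; exact: lt0r_neq0.
Qed.

Lemma ge0_integral_affine (f : T -> \bar R) : measurable_fun setT f -> (forall x, 0 <= f x)%E ->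
  (\int[mu]_x f x = k%:E * \int[mu]_x f (k * x + b)%R)%E.
Proof.
move=> mf f0; rewrite (eq_measure_integral nu); last by move=> A mA _; exact: nuE.
by rewrite ge0_integral_mscale//= ge0_integral_pushforward.
Qed.

Lemma integrable_affine (f : T -> R) : mu.-integrable setT (EFin \o f) ->
  mu.-integrable setT (EFin \o (fun x => f (k * x + b))).
Proof.
move=> /integrableP[mf ioo]; apply/integrableP; split.
  by apply: (measurableT_comp mf); exact: mphi.
move: ioo; rewrite (ge0_integral_affine (f := abse \o (EFin \o f)))//; last 2 first.
- exact: measurableT_comp.
- by move=> x /=.
move=> h; rewrite ltey; apply/eqP => Joo; move: h.
by rewrite [X in (_ * X)%E]Joo mulry gtr0_sg// mul1e ltxx.
Qed.

Lemma Rintegral_affine (f : T -> R) : mu.-integrable setT (EFin \o f) ->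
  \int[mu]_x f x = k * \int[mu]_x f (k * x + b).
Proof.
move=> fi; have [mf _] := integrableP _ _ _ fi.
have fi2 := integrable_affine fi.
apply: EFin_inj; rewrite EFinM /Rintegral !fineK; try exact: integrable_fin_num.
rewrite integralE (ge0_integral_affine (f := (EFin \o f)^\+)%E)//; last exact: measurable_funepos.
rewrite (ge0_integral_affine (f := (EFin \o f)^\-)%E)//; last exact: measurable_funeneg.
have fd := integrable_add_def measurableT fi2.
rewrite -[RHS]/(k%:E * \int[mu]_x (EFin \o (fun x => f (k * x + b)%R)) x)%E.
rewrite [in RHS]integralE [RHS]muleBr//.
have -> : EFin \o (fun x => f (k * x + b)) = (EFin \o f) \o phi by [].
congr (_ * _ - _ * _)%E; apply: eq_integral => x _.
  by rewrite !funeposE.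
by rewrite !funenegE.
Qed.

End affine_change.

(** * Measurability, integrability and integrals of complex functions *)

Section complex_integration.
Context {R : realType} {d : measure_display} {T : measurableType d}.
Variable mu : {measure set T -> \bar R}.
Local Notation Re := (@complex.Re R).
Local Notation Im := (@complex.Im R).
Implicit Types (f g : T -> R[i]).

Definition cmeasurable f :=
  measurable_fun setT (fun t => Re (f t)) /\ measurable_fun setT (fun t => Im (f t)).

Definition cintegrable f :=
  mu.-integrable setT (fun t => (Re (f t))%:E) /\ mu.-integrable setT (fun t => (Im (f t))%:E).

Definition cint f : R[i] := (\int[mu]_t Re (f t)) +i* (\int[mu]_t Im (f t)).

Lemma cmeasurable_cst c : cmeasurable (fun=> c).
Proof. by split; exact: measurable_cst. Qed.

Lemma cmeasurableR (u : T -> R) : measurable_fun setT u -> cmeasurable (fun t => (u t)%:C).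
Proof. by split => //; exact: measurable_cst. Qed.

Lemma cmeasurableM f g : cmeasurable f -> cmeasurable g -> cmeasurable (fun t => f t * g t).
Proof.
move=> [f1 f2] [g1 g2]; split.
  under eq_fun do rewrite ReM.
  by apply: measurable_funB; exact: measurable_funM.
under eq_fun do rewrite ImM.
by apply: measurable_funD; exact: measurable_funM.
Qed.

Lemma cmeasurableD f g : cmeasurable f -> cmeasurable g -> cmeasurable (fun t => f t + g t).
Proof.
move=> [f1 f2] [g1 g2]; split.
  by under eq_fun do rewrite ReD; exact: measurable_funD.
by under eq_fun do rewrite ImD; exact: measurable_funD.
Qed.

Lemma cmeasurable_sum (I : Type) (s : seq I) (F : I -> T -> R[i]) :
  (forall i, cmeasurable (F i)) -> cmeasurable (fun t => \sum_(i <- s) F i t).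
Proof.
move=> h; elim: s => [|i s IH].
  by under eq_fun do rewrite big_nil; exact: cmeasurable_cst.
by under eq_fun do rewrite big_cons; exact: cmeasurableD.
Qed.

Lemma cmeasurable_prod (I : Type) (s : seq I) (F : I -> T -> R[i]) :
  (forall i, cmeasurable (F i)) -> cmeasurable (fun t => \prod_(i <- s) F i t).
Proof.
move=> h; elim: s => [|i s IH].
  by under eq_fun do rewrite big_nil; exact: cmeasurable_cst.
by under eq_fun do rewrite big_cons; exact: cmeasurableM.
Qed.

Lemma cmeasurable_cexp f : cmeasurable f -> cmeasurable (fun t => cexp (f t)).
Proof.
move=> [f1 f2]; split => /=; apply: measurable_funM;
  try (by apply: measurableT_comp).
- apply: (measurableT_comp _ f2); apply: continuous_measurable_fun; exact: continuous_cos.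
- apply: (measurableT_comp _ f2); apply: continuous_measurable_fun; exact: continuous_sin.
Qed.

Lemma cmeasurable_expi (u : T -> R) : measurable_fun setT u -> cmeasurable (fun t => expi (u t)).
Proof.
move=> mu_; under [X in cmeasurable X]eq_fun do rewrite expiE.
by apply: cmeasurable_cexp; split => //=; exact: measurable_cst.
Qed.

Lemma cmeasurable_expN_sqr (u : T -> R) : measurable_fun setT u ->
  cmeasurable (fun t => (expR (- u t ^+ 2))%:C).
Proof.
move=> mu_; apply: cmeasurableR; apply: measurableT_comp => //; apply: measurableT_comp => //.
exact: measurable_funX.
Qed.

Lemma measurable_ReM c f : cmeasurable f -> measurable_fun setT (fun t => Re (c * f t)).
Proof. by move=> mf; case: (cmeasurableM (cmeasurable_cst c) mf). Qed.

Lemma dominated_integrable (u : T -> R) (g : T -> R) : measurable_fun setT u ->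
  mu.-integrable setT (EFin \o g) -> (forall t, `|u t| <= g t) ->
  mu.-integrable setT (EFin \o u).
Proof.
move=> mf gi h; apply: (le_integrable measurableT _ _ gi).
  exact/measurable_EFinP.
by move=> t _ /=; rewrite lee_fin (le_trans (h t))// ler_norm.
Qed.

Lemma dominated_cintegrable f (g : T -> R) : cmeasurable f ->
  mu.-integrable setT (EFin \o g) -> (forall t, cmod (f t) <= g t) -> cintegrable f.
Proof.
move=> [f1 f2] gi h; split.
  by apply: (dominated_integrable f1 gi) => t; rewrite (le_trans (Re_le_cmod _)).
by apply: (dominated_integrable f2 gi) => t; rewrite (le_trans (Im_le_cmod _)).
Qed.

Lemma integrable_ReM c f : cintegrable f ->
  mu.-integrable setT (EFin \o (fun t => Re (c * f t))).
Proof.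
move=> [f1 f2]; rewrite (_ : _ \o _ = (fun t => (Re c)%:E * (Re (f t))%:E - (Im c)%:E * (Im (f t))%:E)%E).
  by apply: integrableB => //; exact: integrableZl.
by apply/funext => t /=; rewrite ReM EFinB !EFinM.
Qed.

Lemma Re_cint c f : cintegrable f -> Re (c * cint f) = \int[mu]_t Re (c * f t).
Proof.
move=> [f1 f2]; rewrite ReM /=; under [RHS]eq_Rintegral do rewrite ReM.
rewrite RintegralB//; first by rewrite !RintegralZl.
  exact: (integrableZl measurableT (Re c) f1).
exact: (integrableZl measurableT (Im c) f2).
Qed.

Lemma cintegrableZ c f : cintegrable f -> cintegrable (fun t => c * f t).
Proof.
move=> fi; split; first exact: integrable_ReM.
rewrite (_ : (fun t => _) = EFin \o (fun t => Re ((0 -i* 1) * c * f t))).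
  exact: integrable_ReM.
apply/funext => t /=; congr EFin; move: (c * f t) (mulrA (0 -i* 1) c (f t)) => z <-.
by rewrite ReM /=; ring.
Qed.

Lemma cintZ c f : cintegrable f -> cint (fun t => c * f t) = c * cint f.
Proof.
move=> fi; apply: eq_ReM => c'; rewrite mulrA !Re_cint//; last exact: cintegrableZ.
by apply: eq_Rintegral => t _; rewrite mulrA.
Qed.

Lemma cintD f g : cintegrable f -> cintegrable g ->
  cint (fun t => f t + g t) = cint f + cint g.
Proof.
move=> [f1 f2] [g1 g2]; apply: complex_eq => /=.
  by under eq_Rintegral do rewrite ReD; rewrite RintegralD.
by under eq_Rintegral do rewrite ImD; rewrite RintegralD.
Qed.

Lemma eq_cint f g : f =1 g -> cint f = cint g.
Proof. by move=> /funext ->. Qed.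

Lemma cmod_cint f (g : T -> R) : cintegrable f -> mu.-integrable setT (EFin \o g) ->
  (forall t, cmod (f t) <= g t) -> cmod (cint f) <= 2 * \int[mu]_t g t.
Proof.
move=> [f1 f2] gi h.
rewrite (le_trans (cmod_le_ReIm _))// mulr2n mulrDl mul1r lerD//=.
  rewrite (le_trans (le_normr_Rintegral measurableT f1))// le_Rintegral//.
    exact: integrable_norm.
  by move=> t _; rewrite (le_trans (Re_le_cmod _)).
rewrite (le_trans (le_normr_Rintegral measurableT f2))// le_Rintegral//.
  exact: integrable_norm.
by move=> t _; rewrite (le_trans (Im_le_cmod _)).
Qed.

Lemma is_derive_under_int (F F' : R -> T -> R) (g : T -> R) (a u v : R) :
  `]u, v[%classic a ->
  (forall x, `]u, v[%classic x -> mu.-integrable setT (EFin \o F x)) ->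
  (forall x t, `]u, v[%classic x -> is_derive x (1 : R) (F^~ t) (F' x t)) ->
  mu.-integrable setT (EFin \o g) ->
  (forall x t, `]u, v[%classic x -> `|F' x t| <= g t) ->
  is_derive a (1 : R) (fun x => \int[mu]_t F x t) (\int[mu]_t F' a t).
Proof.
move=> Ia Fi dF gi Fg.
have g0 t : 0 <= g t by rewrite (le_trans _ (Fg a t Ia)).
have d1 x t : `]u, v[%classic x -> partial1of2 F x t = F' x t.
  by move=> Ix; rewrite partial1of2E; have := dF x t Ix => h; exact: derive_val.
have H1 x t : `]u, v[%classic x -> setT t -> derivable (F^~ t) x 1.
  by move=> Ix _; case: (dF x t Ix).
have H2 x t : `]u, v[%classic x -> setT t -> `|partial1of2 F x t| <= g t.
  by move=> Ix _; rewrite d1//; exact: Fg.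
apply: DeriveDef; first exact: (derivable_under_integral measurableT Ia Fi H1 g0 gi H2).
rewrite -derive1E (differentiation_under_integral measurableT Ia Fi H1 g0 gi H2).
by apply: eq_Rintegral => t _; exact: d1.
Qed.

Lemma cder_under_int (F F' : R -> T -> R[i]) (g : T -> R) (a u v : R) :
  `]u, v[%classic a ->
  (forall x, `]u, v[%classic x -> cintegrable (F x)) ->
  (forall x t, `]u, v[%classic x -> cder (F^~ t) x (F' x t)) ->
  cintegrable (F' a) ->
  mu.-integrable setT (EFin \o g) ->
  (forall x t, `]u, v[%classic x -> cmod (F' x t) <= g t) ->
  cder (fun x => cint (F x)) a (cint (F' a)).
Proof.
move=> Ia Fi dF F'i gi Fg; apply: cder_ReIm => /=.
  apply: (@is_derive_under_int (fun x t => Re (F x t)) (fun x t => Re (F' x t)) g _ _ _ Ia _ _ gi) => [x Ix|x t Ix|x t Ix].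
  - by have [] := Fi _ Ix.
  - exact/cder_Re/dF.
  - by rewrite (le_trans (Re_le_cmod _))// Fg.
apply: (@is_derive_under_int (fun x t => Im (F x t)) (fun x t => Im (F' x t)) g _ _ _ Ia _ _ gi) => [x Ix|x t Ix|x t Ix].
- by have [] := Fi _ Ix.
- exact/cder_Im/dF.
- by rewrite (le_trans (Im_le_cmod _))// Fg.
Qed.

End complex_integration.

(** * Parametric integrals and Fubini under a product bound *)

Section parametric.
Context {R : realType} {d1 d2 : measure_display}.
Context {T1 : measurableType d1} {T2 : measurableType d2}.
Variables (m1 : {sigma_finite_measure set T1 -> \bar R})
          (m2 : {sigma_finite_measure set T2 -> \bar R}).

Lemma measurable_Rintegral (f : T1 -> T2 -> R) :
  measurable_fun setT (fun z : T1 * T2 => f z.1 z.2) ->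
  measurable_fun setT (fun x => \int[m2]_y f x y).
Proof.
move=> mf; have mf' : measurable_fun setT (fun z : T1 * T2 => (f z.1 z.2)%:E).
  exact/measurable_EFinP.
rewrite /Rintegral; apply: (measurableT_comp (fine_measurable _)) => //.
under eq_fun do rewrite integralE.
apply: emeasurable_funB.
- rewrite [X in measurable_fun _ X](_ : _ = fubini_F m2 ((fun z => (f z.1 z.2)%:E)^\+)%E).
    exact (measurable_fun_fubini_tonelli_F _ (measurable_funepos mf') (fun=> funepos_ge0 _ _)).
  by apply/funext => x; apply: eq_integral => y _; rewrite /= !funeposE.
- rewrite [X in measurable_fun _ X](_ : _ = fubini_F m2 ((fun z => (f z.1 z.2)%:E)^\-)%E).
    exact (measurable_fun_fubini_tonelli_F _ (measurable_funeneg mf') (fun=> funeneg_ge0 _ _)).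
  by apply/funext => x; apply: eq_integral => y _; rewrite /= !funenegE.
Qed.

Section product_bound.
Variables (f : T1 -> T2 -> R) (g1 : T1 -> R) (g2 : T2 -> R).
Hypothesis mf : measurable_fun setT (fun z : T1 * T2 => f z.1 z.2).
Hypothesis g1i : m1.-integrable setT (EFin \o g1).
Hypothesis g2i : m2.-integrable setT (EFin \o g2).
Hypothesis fg : forall x y, `|f x y| <= g1 x * g2 y.

Lemma integrable_slice1 x : m2.-integrable setT (EFin \o f x).
Proof.
apply: (dominated_integrable (g := fun y => g1 x * g2 y)) => //.
  exact (measurable_fun_pair2 x mf).
exact: (integrableZl measurableT (g1 x) g2i).
Qed.

Lemma integrable_slice2 y : m1.-integrable setT (EFin \o f^~ y).
Proof.
apply: (dominated_integrable (g := fun x => g1 x * g2 y)) => //.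
  exact (measurable_fun_pair1 y mf).
exact: (integrableZr measurableT (g2 y) g1i).
Qed.

Lemma integrable_prod_bound : (m1 \x m2)%E.-integrable setT (fun z => (f z.1 z.2)%:E).
Proof.
have mf' : measurable_fun setT (fun z : T1 * T2 => (f z.1 z.2)%:E).
  exact/measurable_EFinP.
apply/integrable12ltyP => //=.
pose G2 := \int[m2]_y g2 y.
apply: (@le_lt_trans _ _ (\int[m1]_x (g1 x * G2)%:E)%E).
  apply: ge0_le_integral => //.
  - by move=> x _; exact: integral_ge0.
  - exact (@measurable_fun_fubini_tonelli_F _ _ T1 T2 R m2
      (fun z => `|(f z.1 z.2)%:E|%E) (measurableT_comp (abse_measurable (D:=setT)) mf')
      (fun=> abse_ge0 _)).
  - apply/measurable_EFinP; apply: measurable_funM => //.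
    by apply/measurable_EFinP; exact: (measurable_int m1).
  move=> x _; rewrite -(RintegralZl _ measurableT)// /Rintegral fineK; last first.
    by apply: integrable_fin_num => //; exact: (integrableZl measurableT (g1 x) g2i).
  apply: ge0_le_integral => //.
  - exact: (measurableT_comp (abse_measurable (D:=setT)) (measurable_int m2 (integrable_slice1 x))).
  - exact: (measurable_int m2 (integrableZl measurableT (g1 x) g2i)).
  - by move=> y _ /=; rewrite lee_fin.
have : m1.-integrable setT (fun x => (g1 x * G2)%:E).
  exact: (integrableZr measurableT G2 g1i).
by move/(integrable_fin_num measurableT); rewrite fin_numElt => /andP[].
Qed.

Lemma Rintegral_swap : \int[m1]_x \int[m2]_y f x y = \int[m2]_y \int[m1]_x f x y.
Proof.
have := Fubini integrable_prod_bound => /= h.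
rewrite /Rintegral; congr fine; transitivity (\int[m1]_x \int[m2]_y (f x y)%:E)%E.
  apply: eq_integral => x _; rewrite fineK//; apply: integrable_fin_num => //.
  exact: integrable_slice1.
rewrite h; apply: eq_integral => y _; rewrite fineK//; apply: integrable_fin_num => //.
exact: integrable_slice2.
Qed.

Lemma Rintegral_prod : \int[(m1 \x m2)%E]_z f z.1 z.2 = \int[m1]_x \int[m2]_y f x y.
Proof.
have := integral12_prod_meas1 integrable_prod_bound => /= h.
rewrite /Rintegral -h; congr fine; apply: eq_integral => x _.
rewrite /fubini_F /= fineK//; apply: integrable_fin_num => //.
exact: integrable_slice1.
Qed.

End product_bound.

End parametric.

(** * Comparison of powers, exponentials and stretched exponentials *)

Section growth_bounds.
Context {R : realType}.
Implicit Types (x y r c D : R).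
Local Notation mu := (@lebesgue_measure R).

(** Since [t ^ (r - 1)] is nonincreasing, [z ^ r / z >= (x + y) ^ r / (x + y)] for [z <= x + y];
    [key] is this inequality without division, and it is summed over [z = x] and [z = y]. *)
Lemma powR_subadd r x y : 0 < r <= 1 -> 0 <= x -> 0 <= y ->
  (x + y) `^ r <= x `^ r + y `^ r.
Proof.
move=> /andP[r0 r1] x0 y0.
have [->|xn] := eqVneq x 0; first by rewrite add0r powR0 ?gt_eqF// add0r.
have xy0 : 0 < x + y by rewrite ltr_pwDl// lt_def xn.
have key z : 0 <= z <= x + y -> z * (x + y) `^ r <= z `^ r * (x + y).
  move=> /andP[z0 zxy]; have [->|zn] := eqVneq z 0; first by rewrite mul0r mulr_ge0 ?powR_ge0// ltW.
  have zp : 0 < z by rewrite lt_def zn.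
  have E t : 0 < t -> t = t `^ r * t `^ (1 - r).
    move=> t0; have := @powRD R t r (1 - r).
    by rewrite addrC subrK powRr1 ?ltW// => <- //; rewrite gt_eqF// implybT.
  set P := (x + y) `^ r.
  have -> : z * P = z `^ r * P * z `^ (1 - r) by rewrite {1}(E z zp) mulrAC.
  have -> : z `^ r * (x + y) = z `^ r * P * (x + y) `^ (1 - r) by rewrite {1}(E _ xy0) mulrA.
  rewrite ler_wpM2l ?mulr_ge0 ?powR_ge0//.
  by rewrite ge0_ler_powR ?nnegrE ?subr_ge0// ltW.
have h1 := key x; have h2 := key y.
rewrite -(ler_pM2l xy0) mulrDl (le_trans (y := x `^ r * (x + y) + y `^ r * (x + y)))//.
  by apply: lerD; [apply: h1|apply: h2]; rewrite ?x0 ?y0 /= ?lerDl ?lerDr.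
by rewrite -mulrDl mulrC.
Qed.

Lemma expR_ge_expn (n : nat) y : 0 <= y -> (y / n.+1%:R) ^+ n.+1 <= expR y.
Proof.
move=> y0; rewrite -[X in expR X](@divfK _ n.+1%:R) ?pnatr_eq0// [_ / _ * _]mulrC expRM_natl.
rewrite lerXn2r ?nnegrE ?divr_ge0 ?expR_ge0//.
by rewrite (le_trans _ (expR_ge1Dx _))// lerDr.
Qed.

(** For [r >= 1], [r ^ m] is at most the power [n + 1] of [r ^ tau], with [m <= tau (n + 1)], and
    the exponential dominates this power. *)
Lemma expR_powR_dominates (m : nat) c tau : 0 < c -> 0 < tau ->
  exists2 C, 0 < C & forall r, 0 <= r -> r ^+ m <= C * expR (c * r `^ tau).
Proof.
move=> c0 t0.
pose n := Num.trunc (m%:R / tau).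
have nP : m%:R <= tau * n.+1%:R.
  by rewrite mulrC -ler_pdivrMr// ltW// truncnS_gt.
pose K := (n.+1%:R / c) ^+ n.+1.
have K0 : 0 < K by rewrite exprn_gt0// divr_gt0.
exists (1 + K); first by rewrite addr_gt0.
move=> r r0; have e1 : 1 <= expR (c * r `^ tau).
  by rewrite -expR0 ler_expR mulr_ge0 ?powR_ge0// ltW.
have [r1|r1] := leP r 1.
  rewrite (le_trans (exprn_ile1 m r0 r1))// (le_trans e1)// ler_peMl ?expR_ge0//.
  by rewrite lerDl ltW.
have h : r ^+ m <= (r `^ tau) ^+ n.+1.
  rewrite -(powR_mulrn m r0) -(powR_mulrn _ (powR_ge0 _ _)) -powRrM.
  by apply: ler_powR => //; exact: ltW.
rewrite (le_trans h)// mulrDl ler_wpDl ?mul1r ?expR_ge0//.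
have := expR_ge_expn n (mulr_ge0 (ltW c0) (powR_ge0 r tau)).
move=> h2; rewrite -(ler_pM2l K0) in h2; apply: le_trans h2.
rewrite /K -exprMn (_ : n.+1%:R / c * _ = r `^ tau)//.
have n0 : n.+1%:R != 0 :> R by rewrite pnatr_eq0.
by move: n0; move: (n.+1%:R : R) => q n0; field; rewrite n0 gt_eqF.
Qed.

Lemma powR_dominates D c th tau : 0 < c -> 0 < th < tau ->
  exists2 C, 0 <= C & forall r, 0 <= r -> D * r `^ th <= C + c * r `^ tau.
Proof.
move=> c0 /andP[th0 tt].
pose D' := `|D| + 1; have D0 : 0 < D' by rewrite ltr_wpDl.
have tm0 : 0 < tau - th by rewrite subr_gt0.
(* At [r0] the terms [D' r ^ th] and [c r ^ tau] coincide: below it the constant suffices, above it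
   the larger power wins. *)
pose r0 := (D' / c) `^ (tau - th)^-1.
exists (D' * r0 `^ th); first by rewrite mulr_ge0 ?powR_ge0// ltW.
move=> r rge0; apply: (@le_trans _ _ (D' * r `^ th)).
  by rewrite ler_wpM2r ?powR_ge0// /D' (le_trans (ler_norm D))// lerDl.
have [rr|rr] := leP r r0.
  rewrite ler_wpDr ?mulr_ge0 ?powR_ge0 ?(ltW c0)// ler_pM2l//.
  by rewrite ge0_ler_powR ?nnegrE ?powR_ge0// ltW.
rewrite ler_wpDl ?mulr_ge0 ?powR_ge0 ?(ltW D0)//.
have rp : 0 < r by rewrite (le_lt_trans _ rr)// powR_ge0.
have -> : r `^ tau = r `^ (tau - th) * r `^ th.
  by rewrite -powRD ?subrK//; apply/implyP => _; rewrite gt_eqF.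
rewrite mulrA ler_wpM2r ?powR_ge0// mulrC -ler_pdivrMr//.
have -> : D' / c = r0 `^ (tau - th).
  by rewrite /r0 -powRrM mulVf ?gt_eqF// powRr1// divr_ge0// ltW.
by rewrite ge0_ler_powR ?nnegrE ?powR_ge0// ltW.
Qed.

Lemma integrable_oneDsqrV : mu.-integrable setT (EFin \o (fun x => (oneDsqr x)^-1)).
Proof.
have mo : measurable_fun setT (fun x : R => (oneDsqr x)^-1).
  by apply: continuous_measurable_fun; exact: continuous_oneDsqrV.
have o0 x : 0 <= (oneDsqr x)^-1 by rewrite invr_ge0 (le_trans ler01)// oneDsqr_ge1.
apply/integrableP; split; first exact/measurable_EFinP.
under eq_integral do rewrite /= ger0_norm//.
rewrite ge0_symfun_integralT//=.
- rewrite (_ : [set x | _] = `[0, +oo[%classic); last first.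
    by apply/seteqP; split => x /=; rewrite in_itv/= andbT.
  by rewrite integral0y_oneDsqr -EFinM ltry.
- exact: continuous_oneDsqrV.
- by move=> x; rewrite /= /oneDsqr sqrrN.
Qed.

Lemma measurable_powR_norm tau : measurable_fun setT (fun x : R => `|x| `^ tau).
Proof. exact: (measurableT_comp (measurable_powR tau) (@normr_measurable R setT)). Qed.

Definition stretched c tau x : R := expR (- (c * `|x| `^ tau)).

Lemma measurable_stretched c tau : measurable_fun setT (stretched c tau).
Proof.
apply: measurableT_comp => //; apply: measurableT_comp => //.
by apply: measurable_funM => //; exact: measurable_powR_norm.
Qed.

Lemma integrable_stretched c tau : 0 < c -> 0 < tau ->
  mu.-integrable setT (EFin \o stretched c tau).
Proof.
move=> c0 t0.
have [C C0 hC] := expR_powR_dominates 2 c0 t0.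
apply: (@dominated_integrable _ _ _ mu _ (fun x => (C + 1) * (oneDsqr x)^-1)).
- exact: measurable_stretched.
- exact: (integrableZl measurableT (C + 1) integrable_oneDsqrV).
- move=> x; rewrite ger0_norm ?expR_ge0// ler_pdivlMr; last first.
    by rewrite (lt_le_trans ltr01)// oneDsqr_ge1.
  rewrite /stretched expRN mulrC ler_pdivrMr ?expR_gt0// /oneDsqr mulrDl mul1r addrC lerD//.
    by have := hC `|x| (normr_ge0 x); rewrite real_normK ?num_real.
  by rewrite -expR0 ler_expR mulr_ge0 ?powR_ge0// ltW.
Qed.

End growth_bounds.

(** * Contour shift and Fourier transforms supported on a half-line *)

Section contour_shift.
Context {R : realType}.
Implicit Types (a b c x k s t : R).
Local Notation mu := (@lebesgue_measure R).
Local Notation Re := (@complex.Re R).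
Local Notation Im := (@complex.Im R).

Lemma stretched_shift c tau x s : 0 <= c -> 0 < tau <= 1 -> `|s| <= 1 ->
  stretched c tau (x + s) <= expR c * stretched c tau x.
Proof.
move=> c0 t01 s1; have [t0 t1] := andP t01.
rewrite /stretched -expRD ler_expR -[X in X - _]mulr1 -mulrBr -mulrN ler_wpM2l//.
rewrite lerNl opprB lerBlDr.
have -> : `|x| = `|(x + s) - s| by rewrite addrK.
have h : `|x + s - s| `^ tau <= (`|x + s| + `|s|) `^ tau.
  by rewrite ge0_ler_powR ?nnegrE ?addr_ge0 ?ler_normB// ltW.
rewrite (le_trans h)// (le_trans (powR_subadd t01 _ _))// lerD2l.
apply: (@le_trans _ _ (1 `^ tau)); last by rewrite powR1.
by rewrite ge0_ler_powR ?nnegrE// ltW.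
Qed.

(** By translation invariance the integral of [u (x + s)] in [x] does not depend on [s];
    differentiating under the integral at [s = 0] gives the claim. *)
Lemma Rintegral_derive0 (u u' : R -> R) C c tau : 0 < c -> 0 < tau <= 1 ->
  (forall x, is_derive x (1 : R) u (u' x)) -> measurable_fun setT u' ->
  (forall x, `|u x| <= C * stretched c tau x) ->
  (forall x, `|u' x| <= C * stretched c tau x) ->
  \int[mu]_x u' x = 0.
Proof.
move=> c0 t01 du mu' bu bu'; have [t0 t1] := andP t01.
have cu : continuous u by move=> x; apply: differentiable_continuous; apply/derivable1_diffP; case: (du x).
have mu_ : measurable_fun setT u by exact: continuous_measurable_fun.
have Ei := integrable_stretched c0 t0.
have C0 : 0 <= C.
  have := le_trans (normr_ge0 _) (bu 0).
  by rewrite pmulr_lge0// expR_gt0.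
have ui : mu.-integrable setT (EFin \o u).
  apply: (@dominated_integrable _ _ _ mu _ (fun x => C * stretched c tau x)) => //.
  exact: (integrableZl measurableT C Ei).
pose F s x := u (x + s).
have FE s : \int[mu]_x F s x = \int[mu]_x u x.
  rewrite (Rintegral_affine s ltr01 ui) mul1r; apply: eq_Rintegral => x _.
  by rewrite /F mul1r.
have I0 : `](-1), 1[%classic (0 : R) by rewrite /= in_itv /=; lra.
have h : is_derive (0 : R) (1 : R) (fun s => \int[mu]_x F s x) (\int[mu]_x u' (x + 0)).
  apply: (@is_derive_under_int _ _ _ mu F (fun s x => u' (x + s))
    (fun x => C * expR c * stretched c tau x) 0 (-1) 1 I0).
  - move=> s _; have := integrable_affine s ltr01 ui.
    by congr (_.-integrable _ _); apply/funext => x; rewrite /= mul1r.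
  - move=> s x _.
    have h := is_deriveD (is_derive_cst x s (1 : R)) (is_derive_id s (1 : R)).
    have := @is_derive1_comp _ u (cst x + id) s _ _ (du (x + s)) h.
    by move/is_derive_eq; apply; rewrite add0r mulr1.
  - exact: (integrableZl measurableT (C * expR c) Ei).
  - move=> s x; rewrite /= in_itv /= => s1.
    rewrite (le_trans (bu' _))// -mulrA ler_wpM2l// stretched_shift// ?(ltW c0)//.
    by rewrite ler_norml; lra.
have h0 : is_derive (0 : R) (1 : R) (fun s => \int[mu]_x F s x) 0.
  have -> : (fun s => \int[mu]_x F s x) = cst (\int[mu]_x u x) by exact/funext.
  exact: is_derive_cst.
have := @derive_val _ _ _ _ _ _ _ h; rewrite (@derive_val _ _ _ _ _ _ _ h0) => ->.
by apply: eq_Rintegral => x _; rewrite addr0.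
Qed.

Lemma cint_derive0 (u u' : R -> R[i]) C c tau : 0 < c -> 0 < tau <= 1 ->
  (forall x, cder u x (u' x)) -> cmeasurable u' ->
  (forall x, cmod (u x) <= C * stretched c tau x) ->
  (forall x, cmod (u' x) <= C * stretched c tau x) ->
  cint mu u' = 0.
Proof.
move=> c0 t01 du [m1 m2] bu bu'; apply: complex_eq => /=.
- apply: (@Rintegral_derive0 (fun x => Re (u x)) _ C c tau c0 t01 _ m1).
  + by move=> x; exact/cder_Re/du.
  + by move=> x; rewrite (le_trans (Re_le_cmod _)).
  + by move=> x; rewrite (le_trans (Re_le_cmod _)).
- apply: (@Rintegral_derive0 (fun x => Im (u x)) _ C c tau c0 t01 _ m2).
  + by move=> x; exact/cder_Im/du.
  + by move=> x; rewrite (le_trans (Im_le_cmod _)).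
  + by move=> x; rewrite (le_trans (Im_le_cmod _)).
Qed.

Lemma derive0_constant (phi : R -> R) u : (forall t, u < t -> is_derive t (1 : R) phi 0) ->
  forall s t, u < s -> u < t -> phi s = phi t.
Proof.
move=> d; have key s t : u < s -> s <= t -> phi s = phi t.
  move=> us st; have [||y _ ] := @MVT_segment R phi (fun=> 0) s t st.
  - by move=> y; rewrite in_itv /= => /andP[y0 _]; apply: d; exact: lt_trans y0.
  - apply: derivable_within_continuous => y; rewrite in_itv /= => /andP[y0 _].
    by case: (d y (lt_le_trans us y0)).
  - by rewrite mul0r => /eqP; rewrite subr_eq0 => /eqP.
move=> s t us ut; have [st|ts] := leP s t; first exact: key.
by apply/esym/key => //; exact: ltW.
Qed.

(** Integrating factor: [exp (a s) F s] has zero derivative. *)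
Lemma cder_ode (F : R -> R[i]) (a a' : R -> R) u : u < 0 -> a 0 = 0 ->
  (forall s, u < s -> is_derive s (1 : R) a (a' s)) ->
  (forall s, u < s -> cder F s ((- a' s)%:C * F s)) ->
  forall s, u < s -> F s = (expR (- a s))%:C * F 0.
Proof.
move=> u0 a0 da dF s us; apply: eq_ReM => c.
pose phi t := expR (a t) * Re (c * F t).
have dphi t : u < t -> is_derive t (1 : R) phi 0.
  move=> ut; have h1 := dF t ut c.
  have h3 := @is_derive1_comp _ expR a t _ _ (is_derive_expR (a t)) (da t ut).
  apply: (is_derive_eq (is_deriveM h3 h1)).
  rewrite /GRing.scale /= rmorphN mulNr mulrN /=.
  rewrite (_ : Re (- _) = - (a' t * Re (c * F t))); last first.
    by rewrite mulrCA; case: (c * F t) => p q /=; ring.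
  by ring.
have := derive0_constant dphi us u0.
rewrite /phi a0 expR0 mul1r => h.
rewrite mulrCA (_ : Re (_%:C * _) = expR (- a s) * Re (c * F 0)); last first.
  by case: (c * F 0) => p q /=; ring.
by rewrite -h mulrA -expRD addNr expR0 mul1r.
Qed.

Lemma is_derive_mul k x : is_derive x (1 : R) (fun y => k * y) k.
Proof.
apply: (is_derive_eq (is_deriveZ k (is_derive_id x (1 : R)))).
by rewrite /GRing.scale /= mulr1.
Qed.

Lemma cder_expi_lin k x : cder (fun y => expi (k * y)) x (k%:C * ('i * expi (k * x))).
Proof.
apply: (cder_comp (is_derive_expi (k * x))).
exact: is_derive_mul.
Qed.

Lemma cmeasurable_expi_lin k : cmeasurable (fun x : measurableTypeR R => expi (k * x)).
Proof. by apply: cmeasurable_expi; exact: measurable_funM. Qed.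

Section gaussian.

Definition gauss_ft k := cint mu (fun y => (expR (- y ^+ 2))%:C * expi (- k * y)).

Lemma gauss_stretched : exists2 C, 0 <= C & forall y : R,
  expR (- y ^+ 2) <= C * stretched 1 1 y /\ `|y| * expR (- y ^+ 2) <= C * stretched 1 1 y.
Proof.
exists (expR 1); first exact: expR_ge0.
move=> y; rewrite /stretched mul1r powRr1// -expRD; have y2 : y ^+ 2 = `|y| ^+ 2 by rewrite real_normK ?num_real.
split; first by rewrite ler_expR y2; have := normr_ge0 y; nra.
rewrite (@le_trans _ _ (expR `|y| * expR (- y ^+ 2)))//.
  by rewrite ler_wpM2r ?expR_ge0// (le_trans _ (expR_ge1Dx _))// lerDr.
by rewrite -expRD ler_expR y2; have := sqr_ge0 (`|y| - 1); lra.
Qed.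

Let mg : cmeasurable (fun y : measurableTypeR R => (expR (- y ^+ 2))%:C).
Proof. exact: cmeasurable_expN_sqr. Qed.

(** Integration by parts yields the equation [g' k = - (k / 2) g k]; the value at [0] is kept as a
    constant. *)
Lemma gauss_ftE k : gauss_ft k = (expR (- (k ^+ 2 / 4)))%:C * gauss_ft 0.
Proof.
have [C C0 hC] := gauss_stretched.
have s1 : 0 < (1 : R) <= 1 by rewrite ltr01 lexx.
have Ei := integrable_stretched (ltr01 : 0 < (1:R)) (ltr01 : 0 < (1 : R)).
have CEi := integrableZl measurableT C Ei.
pose F k y := (expR (- y ^+ 2))%:C * expi (- k * y).
have bF j y : cmod (F j y) <= C * stretched 1 1 y.
  by rewrite cmodM cmodR cmod_expi mulr1 ger0_norm ?expR_ge0//; exact: (hC y).1.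
have mF j : cmeasurable (F j : measurableTypeR R -> _).
  by apply: cmeasurableM => //; exact: (cmeasurable_expi_lin (- j)).
have iF j : cintegrable mu (F j) by exact: (dominated_cintegrable (mF j) CEi).
pose G j y := - 'i * y%:C * F j y.
have my : cmeasurable (fun y : measurableTypeR R => y%:C) by exact: cmeasurableR.
have mG j : cmeasurable (G j : measurableTypeR R -> _).
  by apply: cmeasurableM => //; apply: cmeasurableM => //; exact: cmeasurable_cst.
have bG j y : cmod (G j y) <= C * stretched 1 1 y.
  rewrite !cmodM !cmodR cmod_expi mulr1 (ger0_norm (expR_ge0 _)).
  by rewrite cmodN cmod_i mul1r; exact: (hC y).2.
have iG j : cintegrable mu (G j) by exact: (dominated_cintegrable (mG j) CEi).
have GE j : cint mu (G j) = (- (j / 2))%:C * gauss_ft j.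
  (* The integrand is the derivative of [F j], because [- 2 'i * G j y = - 2 y F j y]. *)
  have h := @cint_derive0 (F j) (fun y => (- 2 * 'i) * G j y + (- j%:C * 'i) * F j y)
    ((2 + `|j|) * C) 1 1 ltr01 s1.
  have : cint mu (fun y => (- 2 * 'i) * G j y + (- j%:C * 'i) * F j y) = 0.
    apply: h.
    - move=> y; rewrite /F.
      have d1 : is_derive y (1 : R) (fun y => - y ^+ 2) (- (2 * y)).
        by apply: is_derive_eq; rewrite /GRing.scale /=; ring.
      have d2 := @is_derive1_comp _ expR (fun y => - y ^+ 2) y _ _ (is_derive_expR _) d1.
      have d3 : cder (fun y => (expR (- y ^+ 2))%:C) y (expR (- y ^+ 2) * - (2 * y))%:C.
        by apply: cder_ReIm => //=; exact: is_derive_cst.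
      have := cderM d3 (cder_expi_lin (- j) y).
      congr cder; rewrite /G /F; move: (expi _) => e.
      by apply: complex_eq; case: e => p q /=; ring.
    - apply: cmeasurableD; apply: cmeasurableM.
      + exact: (@cmeasurable_cst _ _ (measurableTypeR R)).
      + exact: mG.
      + exact: (@cmeasurable_cst _ _ (measurableTypeR R)).
      + exact: mF.
    - move=> y; rewrite (le_trans (bF j y))// ler_wpM2r ?expR_ge0// ler_peMl//.
      by have := normr_ge0 j; lra.
    - move=> y; rewrite (le_trans (ler_cmodD _ _))// (mulrDl _ _ C) (mulrDl (2 * C)) lerD//.
        rewrite cmodM -mulrA ler_pM ?cmod_ge0 ?bG//.
        by rewrite cmodE /= !(mulr0, mul0r, mulr1, subr0, addr0, add0r, oppr0) expr0n add0r sqrtr_sqr normrN ger0_norm.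
      rewrite cmodM -mulrA ler_pM ?cmod_ge0 ?bF//.
      by rewrite cmodM cmodN cmod_i mulr1 cmodR.
  rewrite cintD; [|exact: cintegrableZ|exact: cintegrableZ].
  rewrite !cintZ// -/(gauss_ft j) => /(congr1 (fun z => 'i / 2 * z)).
  rewrite mulr0 mulrDr => /eqP; rewrite addr_eq0 => /eqP.
  have two : (2 : R[i]) != 0 by rewrite pnatr_eq0.
  have -> : 'i / 2 * (- 2 * 'i * cint mu (G j)) = - ('i * 'i) * cint mu (G j) by field.
  rewrite mulii opprK mul1r => ->.
  rewrite (_ : 'i / 2 * _ = - ('i * 'i) * (j%:C / 2) * gauss_ft j); last by field.
  rewrite mulii opprK mul1r rmorphN rmorphM /= fmorphV rmorph_nat mulNr.
  by [].
have dF j : cder gauss_ft j ((- (j / 2))%:C * gauss_ft j).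
  rewrite -GE.
  have Ij : `](j - 1), (j + 1)[%classic j by rewrite /= in_itv /=; lra.
  apply: (@cder_under_int _ _ _ mu F G (fun y => C * stretched 1 1 y) j (j - 1) (j + 1) Ij) => //.
  move=> x t _; rewrite /F /G.
  have d1 : is_derive x (1 : R) (fun y => - y * t) (- t).
    by apply: is_derive_eq; rewrite /GRing.scale /=; ring.
  have := cderMl (expR (- t ^+ 2))%:C (cder_comp (g := fun y => - y * t) (is_derive_expi (- x * t)) d1).
  by congr cder; rewrite rmorphN /F; ring.
have da s : is_derive s (1 : R) (fun s => s ^+ 2 / 4) (s / 2).
  rewrite (_ : (fun s => _) = 4^-1 \*: (fun s => s ^+ 2)).
    by apply: is_derive_eq; rewrite /GRing.scale /=; field.
  by apply/funext => y /=; rewrite mulrC.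
apply: (@cder_ode gauss_ft (fun s => s ^+ 2 / 4) (fun s => s / 2) (- (`|k| + 1))).
- by rewrite oppr_lt0 ltr_wpDl.
- by rewrite expr0n mul0r.
- by move=> s _.
- by have := ler_norm (- k); rewrite normrN; lra.
Qed.

End gaussian.

Section line_integral.
Variables (tau dl : R).
Hypothesis tau01 : 0 < tau < 1.
Hypothesis dl0 : 0 < dl.
Local Notation wexps := (wexps tau).
Local Notation rate := (decay_rate tau * dl `^ tau).

Lemma rate_gt0 : 0 < rate.
Proof. by rewrite mulr_gt0 ?decay_rate_gt0// powR_gt0. Qed.

Lemma cmod_wexps_line l : nonpos_exps l -> exists2 C, 0 <= C & forall a x, 1 <= a ->
  cmod (wexps l a (dl * x)) <= C * stretched rate tau x.
Proof.
move=> /(cmod_wexps tau01)[C C0 hC]; exists C => // a x a1.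
rewrite (le_trans (hC a (dl * x) a1))// /stretched normrM (ger0_norm (ltW dl0)).
by rewrite powRM ?(ltW dl0)// mulrA.
Qed.

Lemma cder_wexps_x l a x : 0 < a ->
  cder (fun x => wexps l a (dl * x)) x (dl%:C * - 'i * wexps (dwexps tau l) a (dl * x)).
Proof.
move=> a0; apply: (@cder_wexps R tau l (fun=> a) (fun x => dl * x)).
rewrite -mulrA; apply: cder_comp; first exact: cder_clogr.
exact: is_derive_mul.
Qed.

Lemma cder_wexps_a l s b : 0 < 2 + dl * s ->
  cder (fun s => wexps l (2 + dl * s) b) s (dl%:C * wexps (dwexps tau l) (2 + dl * s) b).
Proof.
move=> a0; apply: (@cder_wexps R tau l (fun s => 2 + dl * s) (fun=> b)).
have d1 : is_derive s (1 : R) (fun s => 2 + dl * s) dl.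
  by apply: is_derive_eq; rewrite /GRing.scale /=; ring.
exact: (@cder_comp R (clog ^~ b) (fun s => 2 + dl * s) s _ _ (cder_clogl b a0) d1).
Qed.

Lemma cmeasurable_clog d (T : measurableType d) (u v : T -> R) :
  (forall z, 0 < u z) -> measurable_fun setT u -> measurable_fun setT v ->
  cmeasurable (fun z => clog (u z) (v z)).
Proof.
move=> u0 mu_ mv; split => /=.
  apply: measurable_funM => //; apply: (measurableT_comp (@measurable_ln R)).
  by apply: measurable_funD; exact: measurable_funX.
apply: measurableT_comp => //.
rewrite (_ : (fun z => _) = @atan R \o (fun z => v z * u z `^ (-1))).
  apply: measurableT_comp.
    by apply: continuous_measurable_fun; exact: continuous_atan.
  by apply: measurable_funM => //; exact: (measurableT_comp (measurable_powR (-1))).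
by apply/funext => t /=; rewrite powR_inv1// ltW.
Qed.

Lemma cmeasurable_wexps d (T : measurableType d) l (u v : T -> R) :
  (forall z, 0 < u z) -> measurable_fun setT u -> measurable_fun setT v ->
  cmeasurable (fun z => wexps l (u z) (v z)).
Proof.
move=> u0 mu_ mv; have mc := cmeasurable_clog u0 mu_ mv.
apply: cmeasurable_sum => p; apply: cmeasurableM; first exact: cmeasurable_cst.
apply: cmeasurable_cexp; apply: cmeasurableD.
  by apply: cmeasurableM => //; exact: cmeasurable_cst.
under eq_fun do rewrite -mulN1r.
apply: cmeasurableM; first exact: cmeasurable_cst.
by apply: cmeasurable_cexp; apply: cmeasurableM => //; exact: cmeasurable_cst.
Qed.

(** Here [w = 2 + dl s - i dl x = 2 - i dl (x + i s)]: the holomorphic factor is taken on the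
    horizontal line of height [s], the wave on the real axis. *)
Definition line_ft l k s := cint mu (fun x => expi (- k * x) * wexps l (2 + dl * s) (dl * x)).

Let F l k s x := expi (- k * x) * wexps l (2 + dl * s) (dl * x).

Let mF l k s : 0 < 2 + dl * s -> cmeasurable (F l k s : measurableTypeR R -> _).
Proof.
move=> a0; apply: cmeasurableM; first exact: (cmeasurable_expi_lin (- k)).
by apply: cmeasurable_wexps => //; exact: measurable_funM.
Qed.

Let bF l : nonpos_exps l -> exists2 C, 0 <= C & forall k s x, 1 <= 2 + dl * s ->
  cmod (F l k s x) <= C * stretched rate tau x.
Proof.
move=> /cmod_wexps_line[C C0 hC]; exists C => // k s x a1.
by rewrite cmodM cmod_expi mul1r hC.
Qed.

Let iE C : mu.-integrable setT (EFin \o (fun x => C * stretched rate tau x)).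
Proof.
have [t0 _] := andP tau01.
exact: (integrableZl measurableT C (integrable_stretched rate_gt0 t0)).
Qed.

Let iF l k s : nonpos_exps l -> 1 <= 2 + dl * s -> cintegrable mu (F l k s).
Proof.
move=> /bF[C C0 hC] a1; apply: (dominated_cintegrable _ (iE C)).
  by apply: mF; exact: lt_le_trans a1.
by move=> x; exact: hC.
Qed.

Lemma cintegrable_line l k s : nonpos_exps l -> 1 <= 2 + dl * s ->
  cintegrable mu (fun x => expi (- k * x) * wexps l (2 + dl * s) (dl * x)).
Proof. exact: iF. Qed.

(** By holomorphy the derivative in [x] is [- i] times the derivative in [s]. Integrating by parts
    in [x] therefore turns the derivative in [s], which is the left-hand side, into multiplication
    by [- k]. *)
Lemma line_ft_byparts l k s : nonpos_exps l -> 1 <= 2 + dl * s ->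
  dl%:C * line_ft (dwexps tau l) k s = (- k)%:C * line_ft l k s.
Proof.
move=> lp a1; have a0 : 0 < 2 + dl * s by exact: lt_le_trans a1.
have [t0 t1] := andP tau01.
have lp' := nonpos_dwexps tau01 lp.
have [C C0 hC] := bF lp; have [C' C'0 hC'] := bF lp'.
pose u' x := (- k)%:C * 'i * F l k s x + dl%:C * - 'i * F (dwexps tau l) k s x.
have : cint mu u' = 0.
  apply: (@cint_derive0 (F l k s) u' (C + (`|k| * C + dl * C')) rate tau rate_gt0).
  - by rewrite t0 ltW.
  - move=> x; have := cderM (cder_expi_lin (- k) x) (cder_wexps_x l x a0).
    by congr cder; rewrite /u' /F; ring.
  - apply: cmeasurableD; apply: cmeasurableM.
    + exact: (@cmeasurable_cst _ _ (measurableTypeR R)).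
    + exact: mF.
    + exact: (@cmeasurable_cst _ _ (measurableTypeR R)).
    + exact: mF.
  - move=> x; rewrite (le_trans (hC k s x a1))// ler_wpM2r ?expR_ge0// lerDl.
    by rewrite addr_ge0// mulr_ge0// ltW.
  - move=> x; rewrite (le_trans (ler_cmodD _ _))// 2!(mulrDl _ _ (stretched _ _ _)).
    rewrite ler_wpDl ?mulr_ge0 ?expR_ge0// lerD//.
      rewrite cmodM -mulrA ler_pM ?cmod_ge0 ?hC//.
      by rewrite cmodM cmod_i mulr1 cmodR normrN.
    rewrite cmodM -mulrA ler_pM ?cmod_ge0 ?hC'//.
    by rewrite cmodM cmodN cmod_i mulr1 cmodR ger0_norm// ltW.
rewrite cintD; [|by apply: cintegrableZ; exact: iF|by apply: cintegrableZ; exact: iF].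
rewrite !cintZ; [|exact: iF|exact: iF].
rewrite -/(line_ft _ _ _) -/(line_ft _ _ _) => /(congr1 (fun z => 'i * z)).
rewrite mulr0 mulrDr (_ : 'i * (_ * _) = ('i * 'i) * ((- k)%:C * line_ft l k s)); last by ring.
rewrite (_ : 'i * (dl%:C * _ * _) = - ('i * 'i) * (dl%:C * line_ft (dwexps tau l) k s)); last by ring.
by rewrite mulii opprK mul1r mulN1r addrC => /eqP; rewrite subr_eq0 => /eqP.
Qed.

(** The previous identity is the equation [F' s = - k F s]. It is solved on [s > - 1 / dl], where
    [2 + dl s] stays above [1]. *)
Lemma line_ft_shift l k s : nonpos_exps l -> 0 <= s ->
  line_ft l k s = (expR (- (k * s)))%:C * line_ft l k 0.
Proof.
move=> lp s0; have lp' := nonpos_dwexps tau01 lp.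
have V0 : - dl^-1 < 0 by rewrite oppr_lt0 invr_gt0.
have posd t : - dl^-1 < t -> 1 < 2 + dl * t.
  move=> h; have : dl * - dl^-1 < dl * t by rewrite ltr_pM2l.
  by rewrite mulrN divff ?gt_eqF//; lra.
apply: (@cder_ode (line_ft l k) (fun s => k * s) (fun=> k) (- dl^-1)) => //.
- by rewrite mulr0.
- by move=> t _; exact: is_derive_mul.
- move=> t ht; rewrite -line_ft_byparts// ?ltW ?posd//.
  have [C C0 hC] := bF lp'.
  rewrite /line_ft -cintZ; last by apply: iF => //; rewrite ltW ?posd.
  have It : `](- dl^-1), (t + 1)[%classic t by rewrite /= in_itv /= ht ltrDl ltr01.
  apply: (@cder_under_int _ _ _ mu (F l k) (fun s x => dl%:C * F (dwexps tau l) k s x)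
    (fun x => dl * C * stretched rate tau x) t _ _ It).
  + by move=> y; rewrite /= in_itv /= => /andP[/posd hy _]; apply: iF => //; exact: ltW.
  + move=> y x; rewrite /= in_itv /= => /andP[/posd hy _].
    have hy0 : 0 < 2 + dl * y by exact: lt_trans hy.
    have := cderMl (expi (- k * x)) (cder_wexps_a l (dl * x) hy0).
    by congr cder; rewrite /F; ring.
  + by apply: cintegrableZ; apply: iF => //; rewrite ltW ?posd.
  + exact: iE.
  + move=> y x; rewrite /= in_itv /= => /andP[/posd hy _].
    by rewrite cmodM cmodR (ger0_norm (ltW dl0)) -mulrA ler_wpM2l ?(ltW dl0)// hC// ltW.
- exact: lt_le_trans s0.
Qed.

(** The integral at height [s] is bounded uniformly in [s >= 0], while it equals [exp (- k s)] times
    its value at [0]; for [k < 0] this value has to vanish. *)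
Lemma line_ft_negative l k : nonpos_exps l -> k < 0 -> line_ft l k 0 = 0.
Proof.
move=> lp k0; have [C C0 hC] := bF lp.
pose B := 2 * \int[mu]_x (C * stretched rate tau x).
have hB s : 0 <= s -> expR (- (k * s)) * cmod (line_ft l k 0) <= B.
  move=> s0; have a1 : 1 <= 2 + dl * s by have := mulr_ge0 (ltW dl0) s0; lra.
  rewrite -[X in X * _](ger0_norm (expR_ge0 _)) -cmodR -cmodM -line_ft_shift//.
  by apply: cmod_cint; [exact: iF|exact: iE|move=> x; exact: hC].
have [c0|c0] := eqVneq (cmod (line_ft l k 0)) 0.
  by apply/eqP; rewrite -normr_eq0 normC_cmod c0.
exfalso.
have cp : 0 < cmod (line_ft l k 0) by rewrite lt_def c0 cmod_ge0.
have B0 : 0 <= B.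
  by rewrite (le_trans _ (hB 0 (lexx 0)))// mulr_ge0 ?expR_ge0// ltW.
(* For this [s], [exp (- k s) >= 1 + B / c], with [c] the modulus in the denominator, which
   contradicts [hB]. *)
pose s := (B / cmod (line_ft l k 0)) / (- k).
have s0 : 0 <= s by rewrite !divr_ge0 ?oppr_ge0 ?(ltW k0)// ltW.
have := hB s s0; rewrite -ler_pdivlMr// leNgt => /negP[].
have -> : - (k * s) = B / cmod (line_ft l k 0).
  by rewrite /s; field; rewrite c0 lt_eqF.
by apply: lt_le_trans (expR_ge1Dx _); rewrite ltrDr.
Qed.

End line_integral.

End contour_shift.

(** * Fubini for complex integrands *)

Section complex_fubini.
Context {R : realType} {d1 d2 : measure_display}.
Context {T1 : measurableType d1} {T2 : measurableType d2}.
Variables (m1 : {sigma_finite_measure set T1 -> \bar R})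
          (m2 : {sigma_finite_measure set T2 -> \bar R}).

Lemma cmeasurable_cint (f : T1 -> T2 -> R[i]) :
  cmeasurable (fun z : T1 * T2 => f z.1 z.2) -> cmeasurable (fun x => cint m2 (f x)).
Proof.
by move=> [h1 h2]; split => /=;
  [exact: (measurable_Rintegral _ h1)|exact: (measurable_Rintegral _ h2)].
Qed.

Lemma cint_swap (f : T1 -> T2 -> R[i]) (g1 : T1 -> R) (g2 : T2 -> R) :
  cmeasurable (fun z : T1 * T2 => f z.1 z.2) ->
  m1.-integrable setT (EFin \o g1) -> m2.-integrable setT (EFin \o g2) ->
  (forall x y, cmod (f x y) <= g1 x * g2 y) ->
  cint m1 (fun x => cint m2 (f x)) = cint m2 (fun y => cint m1 (f^~ y)).
Proof.
move=> [h1 h2] i1 i2 b; apply: complex_eq => /=.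
  apply: (Rintegral_swap h1 i1 i2) => x y.
  by rewrite (le_trans (Re_le_cmod _)).
apply: (Rintegral_swap h2 i1 i2) => x y.
by rewrite (le_trans (Im_le_cmod _)).
Qed.

End complex_fubini.

(** * Heat flow of a wave times a holomorphic factor *)

Section heat_kernel.
Context {R : realType}.
Implicit Types (a b c x y k s u : R).
Local Notation mu := (@lebesgue_measure R).
Local Notation Re := (@complex.Re R).
Local Notation Im := (@complex.Im R).

Lemma cintegrable_affine (f : R -> R[i]) k b : 0 < k -> cintegrable mu f ->
  cintegrable mu (fun x => f (k * x + b)).
Proof.
by move=> k0 [f1 f2]; split;
  [exact: (integrable_affine b k0 f1)|exact: (integrable_affine b k0 f2)].
Qed.

Lemma cint_affine (f : R -> R[i]) k b : 0 < k -> cintegrable mu f ->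
  cint mu f = k%:C * cint mu (fun x => f (k * x + b)).
Proof.
move=> k0 [f1 f2]; apply: complex_eq; rewrite ?ReM ?ImM /= mul0r ?subr0 ?addr0.
  exact: (Rintegral_affine b k0 f1).
exact: (Rintegral_affine b k0 f2).
Qed.

Variables (tau dl : R).
Hypothesis tau01 : 0 < tau < 1.
Local Notation wexps := (wexps tau).
Local Notation rate := (decay_rate tau * dl `^ tau).

(** Up to the factor [pi ^ (- 1 / 2)], the heat flow at time [u ^ 2] integrates
    [exp (- y ^ 2) F (x + 2 u y)] in [y]. For [F = exp (i x) w(x)], completing the square in
    [exp (- y ^ 2 + 2 i u y)] and replacing [y] by [y + i u] gives this integrand. *)
Definition hkern (l : seq (R * R)) u x y : R[i] :=
  (expR (- y ^+ 2))%:C * ((expR (- u ^+ 2))%:C *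
    (expi x * wexps l (2 + dl * (2 * u ^+ 2)) (dl * (x + 2 * u * y)))).

Lemma kernel_arg_ge1 u : 0 <= dl -> 1 <= 2 + dl * (2 * u ^+ 2).
Proof. by move=> dl_ge0; have := mulr_ge0 dl_ge0 (sqr_ge0 u); lra. Qed.

Lemma cmeasurable_hkern d (T : measurableType d) l (U X Y : T -> R) : 0 <= dl ->
  measurable_fun setT U -> measurable_fun setT X -> measurable_fun setT Y ->
  cmeasurable (fun t : T => hkern l (U t) (X t) (Y t)).
Proof.
move=> dl_ge0 mU mX mY.
apply: cmeasurableM; first exact: cmeasurable_expN_sqr.
apply: cmeasurableM; first exact: cmeasurable_expN_sqr.
apply: cmeasurableM; first exact: cmeasurable_expi.
apply: cmeasurable_wexps.
- by move=> t; exact: lt_le_trans (kernel_arg_ge1 (U t) dl_ge0).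
- apply: measurable_funD => //; apply: measurable_funM => //; apply: measurable_funM => //.
  exact: measurable_funX.
- apply: measurable_funM => //; apply: measurable_funD => //; apply: measurable_funM => //.
  exact: measurable_funM.
Qed.

Hypothesis dl0 : 0 < dl.
Let dlW : 0 <= dl. Proof. exact: ltW. Qed.

(** The solution at time [u ^ 2] of the heat equation with initial datum
    [exp (i x) w(x)]; the path of integration of the heat kernel has been moved
    to height [2 u ^ 2], where the spectral gap shows up as the factor
    [exp (- u ^ 2)]. *)
Definition hflow l u x : R[i] := cint mu (hkern l u x).

(** The cap [1 / 4] keeps the loss [hrate * |2 u y| ^ tau] below [(1 + u ^ 2 + y ^ 2) / 4], which
    the two Gaussians can pay. *)
Definition hrate : R := Num.min rate 4^-1.

Lemma hrate_gt0 : 0 < hrate.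
Proof. by rewrite lt_min rate_gt0//= invr_gt0. Qed.

(** Subadditivity moves the decay from [x + 2 u y] to [x]. Of the Gaussian in [u] three quarters
    remain, and what remains of the one in [y] is below a multiple of [exp (- |y|)]. *)
Lemma stretched_gaussian x u y :
  expR (- y ^+ 2) * expR (- u ^+ 2) * stretched rate tau (x + 2 * u * y) <=
  expR 2 * expR (- (3 / 4 * u ^+ 2)) * stretched hrate tau x * stretched 1 1 y.
Proof.
have [t0 t1] := andP tau01; have c0 := hrate_gt0.
rewrite /stretched mul1r powRr1// -!expRD ler_expR.
have h1 : hrate * `|x + 2 * u * y| `^ tau <= rate * `|x + 2 * u * y| `^ tau.
  by rewrite ler_wpM2r ?powR_ge0// /hrate ge_min lexx.
have h2 : `|x| `^ tau <= `|x + 2 * u * y| `^ tau + `|2 * u * y| `^ tau.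
  have -> : `|x| = `|(x + 2 * u * y) - 2 * u * y| by rewrite addrK.
  apply: le_trans (powR_subadd _ _ _) => //; last by rewrite t0 ltW.
  by rewrite ge0_ler_powR ?nnegrE ?addr_ge0 ?ler_normB// ltW.
have h3 : `|2 * u * y| `^ tau <= 1 + (u ^+ 2 + y ^+ 2).
  have h4 : `|2 * u * y| <= u ^+ 2 + y ^+ 2.
    by rewrite ler_norml; have := sqr_ge0 (u + y); have := sqr_ge0 (u - y); nra.
  have [le1|lt1] := leP `|2 * u * y| 1.
    apply: (@le_trans _ _ (1 `^ tau)); first by rewrite ge0_ler_powR ?nnegrE// ltW.
    by rewrite powR1 lerDl addr_ge0 ?sqr_ge0.
  rewrite (le_trans (ler1_powR (ltW lt1) (ltW t1)))// (le_trans h4)// lerDr//.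
have h5 : hrate <= 4^-1 by rewrite /hrate ge_min lexx orbT.
have h6 : hrate * `|2 * u * y| `^ tau <= 4^-1 * (1 + (u ^+ 2 + y ^+ 2)).
  by apply: ler_pM => //; rewrite ?powR_ge0// ltW.
have h7 : hrate * `|x| `^ tau <= hrate * `|x + 2 * u * y| `^ tau + hrate * `|2 * u * y| `^ tau.
  by rewrite -mulrDr ler_wpM2l// ltW.
have y2 : y ^+ 2 = `|y| ^+ 2 by rewrite real_normK ?num_real.
have := sqr_ge0 (3 * `|y| - 2); rewrite y2 in h6 *; lra.
Qed.

Lemma hkern_bound l : nonpos_exps l -> exists2 C, 0 <= C & forall u x y,
  cmod (hkern l u x y) <= C * expR (- (3 / 4 * u ^+ 2)) * stretched hrate tau x * stretched 1 1 y.
Proof.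
move=> /(cmod_wexps_line tau01 dl0)[C C0 hC]; exists (C * expR 2); first by rewrite mulr_ge0 ?expR_ge0.
move=> u x y; rewrite !cmodM !cmodR cmod_expi mul1r !(ger0_norm (expR_ge0 _)).
have := hC _ (x + 2 * u * y) (kernel_arg_ge1 u dlW).
have := stretched_gaussian x u y.
move: (stretched _ _ (x + _)) => E h1 h2; rewrite mulrA.
rewrite (@le_trans _ _ (expR (- y ^+ 2) * expR (- u ^+ 2) * (C * E)))//.
  by rewrite ler_wpM2l ?mulr_ge0 ?expR_ge0.
by rewrite mulrCA (le_trans (ler_wpM2l C0 h1))// !mulrA.
Qed.

Let i11 : mu.-integrable setT (EFin \o stretched 1 1).
Proof. exact: integrable_stretched. Qed.

Let iC C : mu.-integrable setT (EFin \o (fun y => C * stretched 1 1 y)).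
Proof. exact: (integrableZl measurableT C i11). Qed.

Lemma cintegrable_hkern l u x : nonpos_exps l -> cintegrable mu (hkern l u x).
Proof.
move=> /hkern_bound[C C0 hC].
apply: (dominated_cintegrable _ (iC (C * expR (- (3 / 4 * u ^+ 2)) * stretched hrate tau x))).
  exact: (@cmeasurable_hkern _ (measurableTypeR R) _ _ _ _ dlW).
by move=> y; exact: hC.
Qed.

Lemma hflow_bound l : nonpos_exps l -> exists2 C, 0 <= C & forall u x,
  cmod (hflow l u x) <= C * expR (- (3 / 4 * u ^+ 2)) * stretched hrate tau x.
Proof.
move=> lp; have [C C0 hC] := hkern_bound lp.
pose K := \int[mu]_y stretched 1 1 y.
have K0 : 0 <= K by apply: Rintegral_ge0 => y _; exact: expR_ge0.
exists (2 * K * C); first by rewrite !mulr_ge0.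
move=> u x; have := cmod_cint (cintegrable_hkern u x lp)
  (iC (C * expR (- (3 / 4 * u ^+ 2)) * stretched hrate tau x)) (hC u x).
rewrite RintegralZl// -/K => /le_trans; apply.
by rewrite le_eqVlt; apply/orP; left; apply/eqP; ring.
Qed.

Lemma cmeasurable_hflow d (T : measurableType d) l (U X : T -> R) :
  measurable_fun setT U -> measurable_fun setT X ->
  cmeasurable (fun t : T => hflow l (U t) (X t)).
Proof.
move=> mU mX; apply: (@cmeasurable_cint R _ _ T (measurableTypeR R) mu
  (fun t y => hkern l (U t) (X t) y)).
apply: (@cmeasurable_hkern _ (T * measurableTypeR R)%type _ _ _ _ dlW).
- exact: (measurableT_comp mU measurable_fst).
- exact: (measurableT_comp mX measurable_fst).
- exact: measurable_snd.
Qed.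

(** For [w] the holomorphic factor as a function of [dl x], the derivative of [exp (i x) w] is
    [i exp (i x) (w - dl w')]; the factor ['i] is kept outside. *)
Definition hder (l : seq (R * R)) := l ++ scaless (- dl) (dwexps tau l).

Lemma nonpos_hder l : nonpos_exps l -> nonpos_exps (hder l).
Proof.
move=> lp; rewrite nonpos_cat lp /= nonpos_scaless//; exact: nonpos_dwexps.
Qed.

Lemma cder_hkern l u x y : cder (fun x => hkern l u x y) x ('i * hkern (hder l) u x y).
Proof.
have d1 : is_derive x (1 : R) (fun x => x + 2 * u * y) 1.
  by apply: is_derive_eq; rewrite addr0.
have a0 : 0 < 2 + dl * (2 * u ^+ 2) by exact: lt_le_trans (kernel_arg_ge1 u dlW).
have d2 := @cder_comp _ (fun x => wexps l (2 + dl * (2 * u ^+ 2)) (dl * x))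
  (fun x => x + 2 * u * y) x _ _ (cder_wexps_x tau dl l (x + 2 * u * y) a0) d1.
have := cderMl (expR (- y ^+ 2))%:C (cderMl (expR (- u ^+ 2))%:C (cderM (is_derive_expi x) d2)).
congr cder; rewrite /hkern /hder wexps_cat wexps_scale rmorphN rmorph1; ring.
Qed.

Lemma cder_hflow l u x : nonpos_exps l ->
  cder (hflow l u) x ('i * hflow (hder l) u x).
Proof.
move=> lp; have lp' := nonpos_hder lp.
have [C C0 hC] := hkern_bound lp'.
rewrite /hflow -cintZ; last exact: cintegrable_hkern.
have Ix : `](x - 1), (x + 1)[%classic x by rewrite /= in_itv /=; lra.
apply: (@cder_under_int _ _ _ mu (hkern l u) (fun x y => 'i * hkern (hder l) u x y)
  (fun y => C * expR (- (3 / 4 * u ^+ 2)) * stretched 1 1 y) x _ _ Ix).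
- by move=> z _; exact: cintegrable_hkern.
- by move=> z y _; exact: cder_hkern.
- by apply: cintegrableZ; exact: cintegrable_hkern.
- exact: iC.
- move=> z y _; rewrite cmodM cmod_i mul1r (le_trans (hC u z y))// ler_wpM2r ?expR_ge0// ler_piMr ?mulr_ge0 ?expR_ge0//.
  by rewrite -expR0 ler_expR oppr_le0 mulr_ge0 ?powR_ge0// ltW// hrate_gt0.
Qed.

(** The wave translates the spectrum by [1], hence the argument [k - 1]. As [line_ft] vanishes at
    negative frequencies, this is zero for [k < 1]. *)
Definition hspec l k : R[i] := gauss_ft 0 * line_ft tau dl l (k - 1) 0.

Lemma hspec0 l : nonpos_exps l -> hspec l 0 = 0.
Proof.
by move=> lp; rewrite /hspec line_ft_negative ?mulr0// sub0r oppr_lt0 ltr01.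
Qed.

Lemma cintegrable_wave_hflow l u k : nonpos_exps l ->
  cintegrable mu (fun x => expi (- k * x) * hflow l u x).
Proof.
move=> lp; have [C C0 hC] := hflow_bound lp; have [t0 t1] := andP tau01.
apply: (@dominated_cintegrable _ _ _ mu _
  (fun x => C * expR (- (3 / 4 * u ^+ 2)) * stretched hrate tau x)).
- apply: cmeasurableM; first exact: (cmeasurable_expi_lin (- k)).
  exact: (@cmeasurable_hflow _ (measurableTypeR R)).
- exact: (integrableZl measurableT _ (integrable_stretched hrate_gt0 t0)).
- by move=> x; rewrite cmodM cmod_expi mul1r.
Qed.

(** Integrating first in [x], translated by [2 u y], and shifting the line back from height
    [2 u ^ 2] leaves a Gaussian integral in [y]. The exponents add up by
    [1 + 2 (k - 1) + (k - 1) ^ 2 = k ^ 2]. *)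
Lemma hflow_ft l u k : nonpos_exps l ->
  cint mu (fun x => expi (- k * x) * hflow l u x) =
  (expR (- (u ^+ 2 * k ^+ 2)))%:C * hspec l k.
Proof.
move=> lp; have [C C0 hC] := hkern_bound lp; have [t0 t1] := andP tau01.
transitivity (cint mu (fun x => cint mu (fun y => expi (- k * x) * hkern l u x y))).
  by apply: eq_cint => x; rewrite cintZ//; exact: cintegrable_hkern.
rewrite (@cint_swap R _ _ (measurableTypeR R) (measurableTypeR R) mu mu
  (fun x y => expi (- k * x) * hkern l u x y)
  (fun x => C * expR (- (3 / 4 * u ^+ 2)) * stretched hrate tau x) (stretched 1 1)); last 4 first.
- apply: cmeasurableM.
    by apply: cmeasurable_expi; apply: measurable_funM => //; exact: measurable_fst.
  apply: (@cmeasurable_hkern _ (measurableTypeR R * measurableTypeR R)%type _ _ _ _ dlW) => //.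
- exact: (integrableZl measurableT _ (integrable_stretched hrate_gt0 t0)).
- exact: i11.
- by move=> x y; rewrite cmodM cmod_expi mul1r.
pose K := (expR (- u ^+ 2))%:C * ((expR (- ((k - 1) * (2 * u ^+ 2))))%:C * line_ft tau dl l (k - 1) 0).
transitivity (cint mu (fun y => K * ((expR (- y ^+ 2))%:C * expi (- (- (2 * u * (k - 1))) * y)))).
  apply: eq_cint => y.
  pose f x := expi (- k * x) * hkern l u x y.
  have fi : cintegrable mu f.
    apply: (@dominated_cintegrable _ _ _ mu _
      (fun x => (C * expR (- (3 / 4 * u ^+ 2))) * stretched 1 1 y * stretched hrate tau x)).
    - apply: cmeasurableM; first exact: (cmeasurable_expi_lin (- k)).
      exact: (@cmeasurable_hkern _ (measurableTypeR R) _ _ _ _ dlW).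
    - exact: (integrableZl measurableT _ (integrable_stretched hrate_gt0 t0)).
    - by move=> x; rewrite cmodM cmod_expi mul1r mulrAC.
  rewrite -[LHS]/(cint mu f) (cint_affine (- (2 * u * y)) ltr01 fi) mul1r.
  transitivity (cint mu (fun x => ((expR (- u ^+ 2))%:C * ((expR (- y ^+ 2))%:C * expi (- (- (2 * u * (k - 1))) * y))) *
      (expi (- (k - 1) * x) * wexps l (2 + dl * (2 * u ^+ 2)) (dl * x)))).
    apply: eq_cint => x; rewrite /f /hkern mul1r subrK.
    have -> : expi (- - (2 * u * (k - 1)) * y) =
        expi (- k * (x - 2 * u * y)) * expi (x - 2 * u * y) * expi ((k - 1) * x) :> R[i].
      by rewrite -!expiD; congr expi; ring.
    rewrite [- (k - 1) * x]mulNr; have : expi ((k - 1) * x) * expi (- ((k - 1) * x)) = 1 :> R[i].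
      by rewrite -expiD addrN expi0.
    move: (expi ((k - 1) * x)) (expi (- _)) => e1 e2 e12.
    transitivity (expi (- k * (x - 2 * u * y)) * ((expR (- y ^+ 2))%:C * ((expR (- u ^+ 2))%:C *
      (expi (x - 2 * u * y) * ((e1 * e2) * wexps l (2 + dl * (2 * u ^+ 2)) (dl * x)))))).
      by rewrite e12 mul1r.
    by ring.
  rewrite cintZ; last by apply: cintegrable_line => //; exact: (kernel_arg_ge1 _ dlW).
  rewrite -/(line_ft tau dl l (k - 1) (2 * u ^+ 2)) line_ft_shift//; last first.
    by rewrite mulr_ge0// sqr_ge0.
  by rewrite /K; ring.
have gi : cintegrable mu (fun y => (expR (- y ^+ 2))%:C * expi (- (- (2 * u * (k - 1))) * y)).
  have [D D0 hD] := @gauss_stretched R.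
  apply: (dominated_cintegrable _ (iC D)).
    apply: cmeasurableM; last exact: (cmeasurable_expi_lin (- - (2 * u * (k - 1)))).
    exact: cmeasurable_expN_sqr.
  by move=> y; rewrite cmodM cmodR cmod_expi mulr1 ger0_norm ?expR_ge0//; exact: (hD y).1.
rewrite cintZ// -/(gauss_ft _) gauss_ftE /K /hspec.
have -> : - (u ^+ 2 * k ^+ 2) = - u ^+ 2 + (- ((k - 1) * (2 * u ^+ 2)) + - ((- (2 * u * (k - 1))) ^+ 2 / 4)).
  by field.
by rewrite !expRD !rmorphM /=; ring.
Qed.

Lemma cintegrable_wave_scaled l u k z e : nonpos_exps l -> 0 < e ->
  cintegrable mu (fun x => expi (- k * x) * hflow l u (e^-1 * (x - z))).
Proof.
move=> lp e0.
have := cintegrable_affine (- (e^-1 * z)) (k := e^-1) _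
  (cintegrableZ (expi (- k * z)) (cintegrable_wave_hflow u (k * e) lp)).
rewrite invr_gt0 => /(_ e0); congr cintegrable; apply/funext => x.
rewrite mulrA -expiD -mulrBr; congr (expi _ * _).
by field; rewrite gt_eqF.
Qed.

Lemma hflow_ft_scaled l u k z e : nonpos_exps l -> 0 < e ->
  cint mu (fun x => expi (- k * x) * hflow l u (e^-1 * (x - z))) =
  (expR (- (u ^+ 2 * (e * k) ^+ 2)))%:C * (e%:C * expi (- k * z) * hspec l (e * k)).
Proof.
move=> lp e0; rewrite (cint_affine z e0 (cintegrable_wave_scaled u k z lp e0)).
transitivity (e%:C * cint mu (fun x => expi (- k * z) * (expi (- (e * k) * x) * hflow l u x))).
  congr (_ * _); apply: eq_cint => x; rewrite addrK mulKf ?gt_eqF// mulrA -expiD.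
  by congr (expi _ * _); ring.
rewrite cintZ; last exact: cintegrable_wave_hflow.
by rewrite hflow_ft//; ring.
Qed.

End heat_kernel.

(** * Tensor products and integration over tuples *)

Section tensor_integral.
Context {R : realType}.
Local Notation T := (measurableTypeR R).
Local Notation leb := (@lebesgue_measure R).
Local Notation Re := (@complex.Re R).
Local Notation Im := (@complex.Im R).

Lemma measurable_cmod d (X : measurableType d) (f : X -> R[i]) :
  cmeasurable f -> measurable_fun setT (fun t => cmod (f t)).
Proof.
move=> [f1 f2]; under eq_fun do rewrite cmodE -powR12_sqrt ?addr_ge0 ?sqr_ge0//.
apply: (measurableT_comp (measurable_powR _)).
by apply: measurable_funD; exact: measurable_funX.
Qed.

Lemma cintegrable_measurable d (X : measurableType d) (m : {measure set X -> \bar R}) f :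
  cintegrable m f -> cmeasurable f.
Proof.
by move=> [f1 f2]; split; apply/measurable_EFinP; exact: (measurable_int m).
Qed.

Lemma integrable_cmod d (X : measurableType d) (m : {measure set X -> \bar R}) f :
  cintegrable m f -> m.-integrable setT (EFin \o (fun t => cmod (f t))).
Proof.
move=> fi; have mf := cintegrable_measurable fi; have [f1 f2] := fi.
apply: (@dominated_integrable _ _ _ m _ (fun t => `|Re (f t)| + `|Im (f t)|)).
- exact: measurable_cmod.
- exact: (integrableD measurableT (integrable_norm f1) (integrable_norm f2)).
- by move=> t; rewrite ger0_norm ?cmod_ge0// cmod_le_ReIm.
Qed.

Section product.
Context {d1 d2 : measure_display} {T1 : measurableType d1} {T2 : measurableType d2}.
Variables (m1 : {sigma_finite_measure set T1 -> \bar R})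
          (m2 : {sigma_finite_measure set T2 -> \bar R}).
Variables (f : T1 -> R[i]) (g : T2 -> R[i]).
Hypothesis fi : cintegrable m1 f.
Hypothesis gi : cintegrable m2 g.

Let mfg : cmeasurable (fun z : T1 * T2 => f z.1 * g z.2).
Proof.
have [f1 f2] := cintegrable_measurable fi; have [g1 g2] := cintegrable_measurable gi.
by apply: cmeasurableM; split;
  [exact: (measurableT_comp f1 measurable_fst)|exact: (measurableT_comp f2 measurable_fst)
  |exact: (measurableT_comp g1 measurable_snd)|exact: (measurableT_comp g2 measurable_snd)].
Qed.

Let bnd c x y : `|Re (c * (f x * g y))| <= (cmod c * cmod (f x)) * cmod (g y).
Proof. by rewrite (le_trans (Re_le_cmod _))// !cmodM mulrA. Qed.

Let i1 c : m1.-integrable setT (EFin \o (fun x => cmod c * cmod (f x))).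
Proof. exact: (integrableZl measurableT (cmod c) (integrable_cmod fi)). Qed.

Let iRe c : (m1 \x m2)%E.-integrable setT (fun z => (Re (c * (f z.1 * g z.2)))%:E).
Proof.
exact: (@integrable_prod_bound R _ _ T1 T2 m1 m2 (fun x y => Re (c * (f x * g y)))
  _ _ (measurable_ReM c mfg) (i1 c) (integrable_cmod gi) (bnd c)).
Qed.

Lemma cintegrable_product : cintegrable (m1 \x m2)%E (fun z => f z.1 * g z.2).
Proof.
split; first by have := iRe 1; under eq_fun do rewrite mul1r.
have := iRe (0 -i* 1); congr (_.-integrable _ _); apply/funext => z; congr EFin.
by case: (f z.1 * g z.2) => p q /=; ring.
Qed.

Lemma cint_product : cint (m1 \x m2)%E (fun z => f z.1 * g z.2) = cint m1 f * cint m2 g.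
Proof.
apply: eq_ReM => c; rewrite (Re_cint c cintegrable_product).
rewrite (@Rintegral_prod R _ _ T1 T2 m1 m2 (fun x y => Re (c * (f x * g y)))
  _ _ (measurable_ReM c mfg) (i1 c) (integrable_cmod gi) (bnd c)).
transitivity (\int[m1]_x Re ((c * cint m2 g) * f x)).
  apply: eq_Rintegral => x _; under eq_Rintegral do rewrite mulrA.
  by rewrite -Re_cint// mulrAC.
by rewrite -Re_cint//; congr complex.Re; ring.
Qed.

End product.

Section cons.
Variable n : nat.
Local Notation ltn := (lebesgue_tuple n).
Local Notation ltSn := (lebesgue_tuple n.+1).

(** [lebesgue_cons] is a pushforward by definition; [pf] presents the same set function as a measure
    to which the change of variables applies. *)
Let pf : {measure set (n.+1.-tuple T) -> \bar R}.
Proof.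
unshelve refine [the {measure set (n.+1.-tuple T) -> \bar R} of
  pushforward (leb \x ltn)%E (@consp R n)]; exact: measurable_consp.
Defined.

Lemma integral_lebesgue_cons (g : n.+1.-tuple T -> R) :
  measurable_fun setT g ->
  (leb \x ltn)%E.-integrable setT (EFin \o (g \o @consp R n)) ->
  ltSn.-integrable setT (EFin \o g) /\
  \int[ltSn]_t g t = \int[(leb \x ltn)%E]_z g (consp z).
Proof.
move=> mg gi; have mE : measurable_fun setT (EFin \o g) by exact/measurable_EFinP.
have E A : measurable A -> A `<=` setT -> ltSn A = pf A by [].
have h1 : pf.-integrable setT (EFin \o g).
  exact: (integrable_pushforward (@measurable_consp R n) mE gi).
split.
  move/integrableP : h1 => [_ h1]; apply/integrableP; split => //.
rewrite /Rintegral; congr fine; transitivity (\int[pf]_x (g x)%:E)%E.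
  exact: eq_measure_integral.
exact: (integral_pushforward (@measurable_consp R n) mE gi).
Qed.

Lemma cint_lebesgue_cons (f : n.+1.-tuple T -> R[i]) :
  cmeasurable f -> cintegrable (leb \x ltn)%E (fun z => f (consp z)) ->
  cintegrable ltSn f /\ cint ltSn f = cint (leb \x ltn)%E (fun z => f (consp z)).
Proof.
move=> [f1 f2] [g1 g2].
have [a1 b1] := integral_lebesgue_cons f1 g1.
have [a2 b2] := integral_lebesgue_cons f2 g2.
by split => //; apply: complex_eq.
Qed.

End cons.

Lemma cint_tensor n (F : 'I_n -> R -> R[i]) : (forall i, cintegrable leb (F i)) ->
  cintegrable (lebesgue_tuple n) (fun t => \prod_(i < n) F i (tnth t i)) /\
  cint (lebesgue_tuple n) (fun t => \prod_(i < n) F i (tnth t i)) = \prod_(i < n) cint leb (F i).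
Proof.
elim: n F => [|n IH] F Fi.
  under [X in cintegrable _ X]eq_fun do rewrite big_ord0.
  have -> : (fun t : 0.-tuple T => \prod_(i < 0) F i (tnth t i)) = (fun=> 1).
    by apply/funext => t; rewrite big_ord0.
  rewrite big_ord0; split.
    split => /=; exact: finite_measure_integrable_cst.
  (* In dimension [0] the measure is a Dirac mass, of total mass [1], as the empty product
     requires. *)
  have I1 (r : R) : \int[lebesgue_tuple 0]_t r = r.
    rewrite Rintegral_cst//; transitivity (r * fine 1%E); last by rewrite /= mulr1.
    by congr (r * fine _); exact: diracT.
  by apply: complex_eq; exact: I1.
have [IH1 IH2] := IH (fun i => F (lift ord0 i)) (fun i => Fi _).
have mF : cmeasurable (fun t : n.+1.-tuple T => \prod_(i < n.+1) F i (tnth t i)).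
  apply: cmeasurable_prod => i; have [m1 m2] := cintegrable_measurable (Fi i).
  by split; [exact: (measurableT_comp m1 (measurable_tnth i))
            |exact: (measurableT_comp m2 (measurable_tnth i))].
have E : (fun z => \prod_(i < n.+1) F i (tnth (consp z) i)) =
    (fun z : T * n.-tuple T => F ord0 z.1 * \prod_(i < n) F (lift ord0 i) (tnth z.2 i)).
  by apply/funext => z; rewrite big_ord_recl tnth0; congr (_ * _); apply: eq_bigr => i _; rewrite tnthS.
have := cint_lebesgue_cons mF; rewrite E => h.
have [h1 h2] := h (cintegrable_product (Fi ord0) IH1).
split => //.
by rewrite h2 (cint_product (Fi ord0) IH1) IH2 big_ord_recl.
Qed.

Let line_quotient (V : normedModType R) (f : V -> R) (x v : V) :
  (fun h : R => h^-1 *: (f (h *: v + x) - f x)) =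
  (fun h : R => h^-1 *: (f ((h *: (1 : R) + 0) *: v + x) - f (0 *: v + x))).
Proof.
apply/funext => h; rewrite scale0r add0r addr0 (_ : h *: (1 : R) = h)//.
exact: mulr1.
Qed.

(** Reduces a directional derivative to the one-variable derivative on the line through [x], so that
    the rules for functions of a real variable apply. *)
Lemma is_derive_line (V : normedModType R) (f : V -> R) (x v : V) l :
  is_derive (0 : R) (1 : R) (fun h : R => f (h *: v + x)) l -> is_derive x v f l.
Proof.
move=> [h1 h2]; apply: DeriveDef; first exact: ((derivable1P f x v).2 h1).
by rewrite -h2 /derive line_quotient.
Qed.

Lemma line_is_derive (V : normedModType R) (f : V -> R) (x v : V) l :
  is_derive x v f l -> is_derive (0 : R) (1 : R) (fun h : R => f (h *: v + x)) l.
Proof.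
move=> [h1 h2]; apply: DeriveDef; first exact: ((derivable1P f x v).1 h1).
by rewrite -h2 /derive line_quotient.
Qed.

End tensor_integral.

(** * Building blocks in several variables and their Fourier transforms *)

Section blocks.
Local Opaque hflow.
Context {R : realType} {d : nat}.
Implicit Types (x z : 'rV[R]_d) (u k e : R).
Local Notation T := (measurableTypeR R).
Local Notation leb := (@lebesgue_measure R).
Local Notation Re := (@complex.Re R).
Local Notation Im := (@complex.Im R).

(** Additive over the coordinates, so that [expR (- (c * wnorm r x))] is a tensor product. It is
    comparable, up to constants, with the power [r] of [enorm x], and is subadditive for
    [r <= 1]. *)
Definition wnorm (r : R) x : R := \sum_(i < d) `|x ord0 i| `^ r.

Lemma wnorm_ge0 r x : 0 <= wnorm r x.
Proof. by apply: sumr_ge0 => i _; exact: powR_ge0. Qed.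

Lemma wnormN r x : wnorm r (- x) = wnorm r x.
Proof. by apply: eq_bigr => i _; rewrite mxE normrN. Qed.

Lemma wnormD r x z : 0 < r <= 1 -> wnorm r (x + z) <= wnorm r x + wnorm r z.
Proof.
move=> r01; have [r0 r1] := andP r01; rewrite /wnorm -big_split /=; apply: ler_sum => i _.
rewrite mxE (le_trans _ (powR_subadd r01 _ _))//.
by rewrite ge0_ler_powR ?nnegrE ?ler_normD ?addr_ge0// ltW.
Qed.

Lemma wnorm_scale r e x : 0 < r -> 1 <= e -> wnorm r x <= wnorm r (e *: x).
Proof.
move=> r0 e1; apply: ler_sum => i _; rewrite mxE normrM.
rewrite ge0_ler_powR ?nnegrE ?mulr_ge0// ?(ltW r0)// ler_peMl//.
by rewrite ger0_norm// (le_trans ler01).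
Qed.

Lemma prod_stretched c r x :
  \prod_(i < d) stretched c r (x ord0 i) = expR (- (c * wnorm r x)).
Proof.
rewrite /stretched /wnorm mulr_sumr -sumrN; elim/big_rec2 : _ => [|i y1 y2 _ ->].
  by rewrite expR0.
by rewrite expRD.
Qed.

Variables (tau dl : R).
Hypothesis tau01 : 0 < tau < 1.
Hypothesis dl0 : 0 < dl.
Hypothesis d0 : (0 < d)%N.
Local Notation hflow := (hflow tau dl).
Local Notation hrate := (hrate tau dl).
Let t0 : 0 < tau. Proof. by case/andP: tau01. Qed.

Definition heat_weight k u : R := `|u| `^ k * expR (- (3 / 4 * u ^+ 2)).

Lemma measurable_heat_weight k : measurable_fun setT (heat_weight k : T -> R).
Proof.
apply: measurable_funM; first exact: measurable_powR_norm.
apply: measurableT_comp => //; apply: measurableT_comp => //.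
by apply: measurable_funM => //; exact: measurable_funX.
Qed.

Lemma heat_weight_ge0 k u : 0 <= heat_weight k u.
Proof. by rewrite mulr_ge0 ?powR_ge0 ?expR_ge0. Qed.

Lemma integrable_heat_weight k : 0 <= k -> leb.-integrable setT (EFin \o heat_weight k).
Proof.
move=> k0; pose m := (Num.trunc k).+1.
have [C C0 hC] := expR_powR_dominates m (@ltr01 R) (@ltr01 R).
apply: (@dominated_integrable _ _ _ leb _ (fun u => ((1 + C) * expR 2) * stretched 1 1 u)).
- exact: measurable_heat_weight.
- exact: (integrableZl measurableT _ (integrable_stretched (@ltr01 R) (@ltr01 R))).
move=> u; rewrite ger0_norm ?heat_weight_ge0// /heat_weight /stretched mul1r powRr1//.
have h1 : `|u| `^ k <= (1 + C) * expR `|u|.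
  have e1 : 1 <= expR `|u| by rewrite -expR0 ler_expR.
  have [u1|u1] := leP 1 `|u|; last first.
    rewrite (@le_trans _ _ 1)//; last by rewrite mulr_ege1// lerDl ltW.
    apply: (@le_trans _ _ (1 `^ k)); last by rewrite powR1.
    by rewrite ge0_ler_powR ?nnegrE// ltW.
  have := hC `|u| (normr_ge0 u); rewrite mul1r powRr1// => h.
  rewrite mulrDl ler_wpDl ?mul1r ?expR_ge0// (le_trans _ h)//.
  rewrite -powR_mulrn// ler_powR// ltW// /m.
  exact: truncnS_gt.
rewrite (le_trans (ler_wpM2r (expR_ge0 _) h1))// -!mulrA ler_wpM2l ?addr_ge0 ?(ltW C0)//.
rewrite -!expRD ler_expR; have -> : u ^+ 2 = `|u| ^+ 2 by rewrite real_normK ?num_real.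
by have := sqr_ge0 (3 * `|u| - 4); lra.
Qed.

Definition hprod (ls : 'I_d -> seq (R * R)) u (y : 'I_d -> R) : R[i] :=
  \prod_(i < d) hflow (ls i) u (y i).

(** The constant [c] collects the factors ['i] produced by derivatives, and [ls] allows a different
    list for each coordinate, so that partial derivatives of blocks are blocks. *)
Definition block k c (ls : 'I_d -> seq (R * R)) x : R :=
  \int[leb]_u (`|u| `^ k * Re (c * hprod ls u (fun i => x ord0 i))).

Lemma hprod_bound ls : (forall i, nonpos_exps (ls i)) -> exists2 C, 0 <= C & forall u y,
  cmod (hprod ls u y) <= C * expR (- (3 / 4 * u ^+ 2)) * \prod_(i < d) stretched hrate tau (y i).
Proof.
move=> lp; have /choice[C hC] : forall i, exists C, 0 <= C /\ forall u (x : R),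
    cmod (hflow (ls i) u x) <= C * expR (- (3 / 4 * u ^+ 2)) * stretched hrate tau x.
  by move=> i; have [C C0 hC] := hflow_bound tau01 dl0 (lp i); exists C.
exists (\prod_(i < d) C i); first by apply: prodr_ge0 => i _; exact: (hC i).1.
move=> u y; rewrite /hprod cmod_prod.
apply: (@le_trans _ _ (\prod_(i < d) (C i * expR (- (3 / 4 * u ^+ 2)) * stretched hrate tau (y i)))).
  by apply: ler_prod => i _; rewrite cmod_ge0/=; exact: (hC i).2.
rewrite !big_split /= -!mulrA ler_wpM2l//; first by apply: prodr_ge0 => i _; exact: (hC i).1.
rewrite ler_wpM2r//; first by apply: prodr_ge0 => i _; exact: expR_ge0.
(* Of the [d] Gaussian factors in [u] one is kept, as [d > 0], and the others are bounded by [1]. *)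
rewrite prodr_const card_ord; case: (d) d0 => // n _.
rewrite exprS ler_piMr ?expR_ge0// exprn_ile1 ?expR_ge0//.
by rewrite -[leRHS]expR0 ler_expR; have := sqr_ge0 u; lra.
Qed.

Lemma cmeasurable_hprod d' (X : measurableType d') ls (U : X -> R) (Y : 'I_d -> X -> R) :
  measurable_fun setT U -> (forall i, measurable_fun setT (Y i)) ->
  cmeasurable (fun t : X => hprod ls (U t) (fun i => Y i t)).
Proof.
by move=> mU mY; apply: cmeasurable_prod => i; exact: cmeasurable_hflow.
Qed.

Lemma measurable_block_integrand d' (X : measurableType d') k c ls (U : X -> R) (Y : 'I_d -> X -> R) :
  measurable_fun setT U -> (forall i, measurable_fun setT (Y i)) ->
  measurable_fun setT (fun t : X => `|U t| `^ k * Re (c * hprod ls (U t) (fun i => Y i t))).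
Proof.
move=> mU mY; apply: measurable_funM.
  exact: (measurableT_comp (@measurable_powR_norm R k) mU).
by apply: measurable_ReM; exact: cmeasurable_hprod.
Qed.

Lemma block_integrand_bound k c ls : (forall i, nonpos_exps (ls i)) ->
  exists2 C, 0 <= C & forall u y,
  `| `|u| `^ k * Re (c * hprod ls u y)| <=
  C * \prod_(i < d) stretched hrate tau (y i) * heat_weight k u.
Proof.
move=> lp; have [C C0 hC] := hprod_bound lp.
exists (cmod c * C); first by rewrite mulr_ge0 ?cmod_ge0.
move=> u y; rewrite normrM (ger0_norm (powR_ge0 _ _)) /heat_weight.
rewrite [leRHS]mulrCA ler_wpM2l ?powR_ge0// (le_trans (Re_le_cmod _))// cmodM.
have := hC u y; set P := \prod_(i < d) _; set e := expR _ => h.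
have -> : cmod c * C * P * e = cmod c * (C * e * P) by ring.
by rewrite ler_wpM2l ?cmod_ge0.
Qed.

Lemma integrable_block_integrand k c ls x : 0 <= k -> (forall i, nonpos_exps (ls i)) ->
  leb.-integrable setT (EFin \o (fun u => `|u| `^ k * Re (c * hprod ls u (fun i => x ord0 i)))).
Proof.
move=> k0 lp; have [C C0 hC] := block_integrand_bound k c lp.
apply: (@dominated_integrable _ _ _ leb _
  (fun u => C * \prod_(i < d) stretched hrate tau (x ord0 i) * heat_weight k u)).
- exact: (@measurable_block_integrand _ T k c ls id (fun i _ => x ord0 i)).
- exact: (integrableZl measurableT _ (integrable_heat_weight k0)).
- by move=> u; exact: hC.
Qed.

Lemma block_bound k c ls : 0 <= k -> (forall i, nonpos_exps (ls i)) ->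
  exists2 C, 0 <= C & forall x, `|block k c ls x| <= C * expR (- (hrate * wnorm tau x)).
Proof.
move=> k0 lp; have [C C0 hC] := block_integrand_bound k c lp.
exists (C * \int[leb]_u heat_weight k u).
  by rewrite mulr_ge0//; apply: Rintegral_ge0 => u _; exact: heat_weight_ge0.
move=> x; rewrite /block.
have fi := integrable_block_integrand c x k0 lp.
rewrite (le_trans (le_normr_Rintegral measurableT fi))// -prod_stretched.
rewrite mulrAC -(RintegralZl _ measurableT); last exact: integrable_heat_weight.
apply: le_Rintegral => //; first exact: integrable_norm.
exact: (integrableZl measurableT _ (integrable_heat_weight k0)).
Qed.

Definition hder_at (j : 'I_d) (ls : 'I_d -> seq (R * R)) : 'I_d -> seq (R * R) :=
  fun i => if i == j then hder tau dl (ls i) else ls i.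

Lemma nonpos_hder_at j ls : (forall i, nonpos_exps (ls i)) ->
  forall i, nonpos_exps (hder_at j ls i).
Proof.
by move=> lp i; rewrite /hder_at; case: eqP => // _; exact: nonpos_hder.
Qed.

Lemma line_coord j x (h : R) i :
  (h *: basisv j + x) ord0 i = if i == j then h + x ord0 i else x ord0 i.
Proof.
rewrite !mxE eqxx /=; case: eqP => _; first by rewrite mulr1.
by rewrite mulr0 add0r.
Qed.

Lemma hprod_line ls u j x (h : R) :
  hprod ls u (fun i => (h *: basisv j + x) ord0 i) =
  hflow (ls j) u (h + x ord0 j) * \prod_(i < d | i != j) hflow (ls i) u (x ord0 i).
Proof.
rewrite /hprod (eq_bigr (fun i => hflow (ls i) u (if i == j then h + x ord0 i else x ord0 i))).
  rewrite (bigD1 j); last by [].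
  rewrite (eqxx j); apply: congr1; apply: eq_bigr => i /negbTE ->; reflexivity.
by move=> i _; rewrite line_coord.
Qed.

Lemma is_derive_block k c ls j x : 0 <= k -> (forall i, nonpos_exps (ls i)) ->
  is_derive x (basisv j) (block k c ls) (block k (c * 'i) (hder_at j ls) x).
Proof.
move=> k0 lp; have lp' := nonpos_hder_at j lp.
have [C C0 hC] := block_integrand_bound k (c * 'i) lp'.
apply: is_derive_line.
have I0 : `](-1), 1[%classic (0 : R) by rewrite /= in_itv /=; lra.
pose F (h u : R) := `|u| `^ k * Re (c * hprod ls u (fun i => (h *: basisv j + x) ord0 i)).
pose F' (h u : R) := `|u| `^ k * Re (c * 'i * hprod (hder_at j ls) u (fun i => (h *: basisv j + x) ord0 i)).
have E : \int[leb]_u F' 0 u = block k (c * 'i) (hder_at j ls) x.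
  by apply: eq_Rintegral => u _; rewrite /F' scale0r add0r.
rewrite -E; apply: (@is_derive_under_int _ _ _ leb F F' (fun u => C * heat_weight k u) 0 (-1) 1 I0).
- by move=> h _; exact: integrable_block_integrand.
- move=> h u _; rewrite /F /F'.
  pose P := \prod_(i < d | i != j) hflow (ls i) u (x ord0 i).
  have E1 : (fun h => `|u| `^ k * Re (c * hprod ls u (fun i => (h *: basisv j + x) ord0 i))) =
      (`|u| `^ k) \*: (fun h => Re ((c * P) * hflow (ls j) u (h + x ord0 j))).
    apply/funext => h'; rewrite hprod_line -/P.
    transitivity (`|u| `^ k * Re (c * P * hflow (ls j) u (h' + x ord0 j))); last by [].
    by congr (_ * Re _); ring.
  rewrite E1.
  have d1 : is_derive h (1 : R) (fun h => h + x ord0 j) 1.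
    by apply: is_derive_eq; rewrite addr0.
  have d2 := @cder_comp _ (hflow (ls j) u) (fun h => h + x ord0 j) h _ _
    (cder_hflow tau01 dl0 u (h + x ord0 j) (lp j)) d1.
  apply: (is_derive_eq (is_deriveZ (`|u| `^ k) (d2 (c * P)))).
  rewrite hprod_line /hder_at eqxx.
  rewrite (eq_bigr (fun i => hflow (ls i) u (x ord0 i))) -/P; last first.
    by move=> i ij; rewrite (negbTE ij).
  transitivity (`|u| `^ k * Re (c * P * (1%:C * ('i * hflow (hder tau dl (ls j)) u (h + x ord0 j))))); first by [].
  by congr (_ * Re _); rewrite rmorph1; ring.
- exact: (integrableZl measurableT _ (integrable_heat_weight k0)).
- move=> h u _; apply: (le_trans (hC u (fun i => (h *: basisv j + x) ord0 i))).
  apply: ler_wpM2r; first exact: heat_weight_ge0.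
  apply: ler_piMr; first exact: C0.
  apply: prodr_ile1 => i _; apply/andP; split; first exact: expR_ge0.
  rewrite -[leRHS]expR0 ler_expR oppr_le0; apply: mulr_ge0; last exact: powR_ge0.
  by apply: ltW; exact: hrate_gt0.
Qed.

Lemma affine_coord e z (t : d.-tuple T) i :
  (e^-1 *: (rowt t - z)) ord0 i = e^-1 * (tnth t i - z ord0 i).
Proof. by rewrite !mxE. Qed.

Lemma block_affineE k c ls e z (t : d.-tuple T) :
  block k c ls (e^-1 *: (rowt t - z)) =
  \int[leb]_u (`|u| `^ k * Re (c * hprod ls u (fun i => e^-1 * (tnth t i - z ord0 i)))).
Proof.
rewrite /block; apply: eq_Rintegral => u _.
have -> : (fun i => (e^-1 *: (rowt t - z)) ord0 i) = (fun i => e^-1 * (tnth t i - z ord0 i)).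
  by apply/funext => i; rewrite affine_coord.
by [].
Qed.

Lemma integrable_affine_integrand k c ls e z (t : d.-tuple T) : 0 <= k -> (forall i, nonpos_exps (ls i)) ->
  leb.-integrable setT (EFin \o (fun u => `|u| `^ k * Re (c * hprod ls u (fun i => e^-1 * (tnth t i - z ord0 i))))).
Proof.
move=> k0 lp; have := integrable_block_integrand c (e^-1 *: (rowt t - z)) k0 lp.
have -> : (fun i => (e^-1 *: (rowt t - z)) ord0 i) = (fun i => e^-1 * (tnth t i - z ord0 i)).
  by apply/funext => i; rewrite affine_coord.
by [].
Qed.

Let mcoord e z i : measurable_fun setT (fun t : d.-tuple T => e^-1 * (tnth t i - z ord0 i)).
Proof. by apply: measurable_funM => //; apply: measurable_funB => //; exact: measurable_tnth. Qed.

Lemma measurable_affine_integrand k c ls e z :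
  measurable_fun setT (fun w : d.-tuple T * T =>
    `|w.2| `^ k * Re (c * hprod ls w.2 (fun i => e^-1 * (tnth w.1 i - z ord0 i)))).
Proof.
apply: (@measurable_block_integrand _ (d.-tuple T * T)%type k c ls snd
  (fun i w => e^-1 * (tnth w.1 i - z ord0 i))); first exact: measurable_snd.
by move=> i; exact: (measurableT_comp (mcoord e z i) measurable_fst).
Qed.

Lemma measurable_block_affine k c ls e z :
  measurable_fun setT (fun t : d.-tuple T => block k c ls (e^-1 *: (rowt t - z))).
Proof.
under eq_fun do rewrite block_affineE.
exact: (@measurable_Rintegral R _ _ _ T leb _ (measurable_affine_integrand k c ls e z)).
Qed.

Lemma integrable_stretched_tensor r a e z : 0 < r -> 0 < a -> 0 < e ->
  (lebesgue_tuple d).-integrable setT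
    (EFin \o (fun t => \prod_(i < d) stretched a r (e^-1 * (tnth t i - z ord0 i)))).
Proof.
move=> r0 a0 e0; have i1 i : cintegrable leb (fun x : T => (stretched a r (e^-1 * (x - z ord0 i)))%:C).
  split => /=; last by have := @integrable0 _ _ _ leb setT.
  have ei : 0 < e^-1 by rewrite invr_gt0.
  have := integrable_affine (- (e^-1 * z ord0 i)) ei (integrable_stretched a0 r0).
  by congr (_.-integrable _ _); apply/funext => x /=; rewrite mulrBr.
have [[h _] _] := cint_tensor i1.
move: h; congr (_.-integrable _ _); apply/funext => t /=; congr EFin.
by rewrite -rmorph_prod.
Qed.

Lemma integrable_expR_wnorm c r : 0 < c -> 0 < r ->
  (lebesgue_tuple d).-integrable setT
    (EFin \o (fun t : d.-tuple T => expR (- (c * wnorm r (rowt t))))).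
Proof.
move=> c0 r0.
have := integrable_stretched_tensor 0 r0 c0 (@ltr01 R).
apply: eq_integrable => // t _ /=; congr EFin; rewrite -prod_stretched.
by apply: eq_bigr => i _; rewrite !mxE subr0 invr1 mul1r.
Qed.

(** The part of the Fourier transform of the flow, centred at [z] with scale [e], that does not
    depend on [u]; [eta] is the angular frequency [2 pi xi]. *)
Definition spec_factor l e z (eta : 'I_d -> R) : R[i] :=
  \prod_(i < d) (e%:C * expi (- eta i * z ord0 i) * hspec tau dl l (e * eta i)).

Lemma cint_hprod l u e z (eta : 'I_d -> R) : nonpos_exps l -> 0 < e ->
  cintegrable (lebesgue_tuple d) (fun t => expi (- \sum_(i < d) eta i * tnth t i) *
     hprod (fun=> l) u (fun i => e^-1 * (tnth t i - z ord0 i))) /\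
  cint (lebesgue_tuple d) (fun t => expi (- \sum_(i < d) eta i * tnth t i) *
     hprod (fun=> l) u (fun i => e^-1 * (tnth t i - z ord0 i))) =
  (expR (- (u ^+ 2 * (e ^+ 2 * \sum_(i < d) eta i ^+ 2))))%:C * spec_factor l e z eta.
Proof.
move=> lp e0; have h1 i := cintegrable_wave_scaled tau01 dl0 u (eta i) (z ord0 i) lp e0.
have [h2 h3] := cint_tensor h1.
have E : (fun t : d.-tuple T => \prod_(i < d) (expi (- eta i * tnth t i) * hflow l u (e^-1 * (tnth t i - z ord0 i)))) =
    (fun t => expi (- \sum_(i < d) eta i * tnth t i) *
     hprod (fun=> l) u (fun i => e^-1 * (tnth t i - z ord0 i))).
  apply/funext => t; rewrite big_split -sumrN expi_sum; congr (_ * _).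
  by apply: eq_bigr => i _; rewrite mulNr.
rewrite -E; split; first exact: h2.
rewrite h3 /spec_factor (eq_bigr (fun i => (expR (- (u ^+ 2 * (e * eta i) ^+ 2)))%:C *
  (e%:C * expi (- eta i * z ord0 i) * hspec tau dl l (e * eta i)))); last first.
  by move=> i _; exact: hflow_ft_scaled.
rewrite big_split -rmorph_prod; congr (_%:C * _).
rewrite !mulr_sumr -sumrN; elim/big_rec2 : _ => [|i y1 y2 _ ->]; first by rewrite expR0.
by rewrite -expRD exprMn.
Qed.

Definition moment k r : R := \int[leb]_u (`|u| `^ k * expR (- (u ^+ 2 * r))).

Definition heat_mass k : R := \int[leb]_u heat_weight k u.

(** Substituting [a u] for [u] in [heat_mass k] shows that [moment k r] is proportional to
    [r ^ (- (k + 1) / 2)]; the form [r = 3 / 4 a ^ 2] matches the Gaussian in [heat_weight]. *)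
Lemma integrable_moment k a : 0 <= k -> 0 < a ->
  leb.-integrable setT (EFin \o (fun u => `|u| `^ k * expR (- (u ^+ 2 * (3 / 4 * a ^+ 2))))) /\
  a * a `^ k * moment k (3 / 4 * a ^+ 2) = heat_mass k.
Proof.
move=> k0 a0; have h := integrable_heat_weight k0.
have ak : 0 < a `^ k by exact: powR_gt0.
have E u : heat_weight k (a * u + 0) = a `^ k * (`|u| `^ k * expR (- (u ^+ 2 * (3 / 4 * a ^+ 2)))).
  rewrite /heat_weight addr0 normrM (ger0_norm (ltW a0)) powRM ?(ltW a0)// -mulrA.
  by congr (_ * (_ * expR _)); ring.
have i1 : leb.-integrable setT (EFin \o (fun u => `|u| `^ k * expR (- (u ^+ 2 * (3 / 4 * a ^+ 2))))).
  have := integrableZl measurableT (a `^ k)^-1 (integrable_affine 0 a0 h).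
  congr (_.-integrable _ _); apply/funext => u /=; rewrite -EFinM E mulKf// gt_eqF//.
split => //; rewrite /heat_mass (Rintegral_affine 0 a0 h) -mulrA; congr (_ * _).
rewrite /moment -(RintegralZl _ measurableT)//.
by apply: eq_Rintegral => u _; rewrite E.
Qed.

(** From [Re A cos t = (Re (exp (i t) A) + Re (exp (- i t) A)) / 2]: a block is a real part, so both
    signs of the frequency occur. The phase [phi] treats cosine and sine transforms together. *)
Definition spec_value l e z (eta : 'I_d -> R) phi : R :=
  2^-1 * (Re (expi phi * spec_factor l e z (fun i => - eta i)) +
          Re (expi (- phi) * spec_factor l e z eta)).

Lemma spec_value0 l e z (eta : 'I_d -> R) phi : nonpos_exps l -> (forall i, eta i = 0) ->
  spec_value l e z eta phi = 0.
Proof.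
move=> lp eta0; have h0 (f : 'I_d -> R) : (forall i, f i = 0) -> spec_factor l e z f = 0.
  move=> f0; rewrite /spec_factor (bigD1 (Ordinal d0)); last by [].
  by rewrite f0 mulr0 hspec0// mulr0; exact: mul0r.
have h1 := h0 eta eta0.
have h2 : spec_factor l e z (fun i => - eta i) = 0 by apply: h0 => i; rewrite eta0 oppr0.
by rewrite /spec_value h1 h2 !mulr0 /= addr0 mulr0.
Qed.

Lemma block_ft k l e z (eta : 'I_d -> R) phi : 0 <= k -> nonpos_exps l -> 0 < e ->
  \int[lebesgue_tuple d]_t (block k 1 (fun=> l) (e^-1 *: (rowt t - z)) *
     cos (\sum_(i < d) eta i * tnth t i + phi)) =
  moment k (e ^+ 2 * \sum_(i < d) eta i ^+ 2) * spec_value l e z eta phi.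
Proof.
move=> k0 lp e0; have lps : forall i : 'I_d, nonpos_exps ((fun=> l) i) by [].
have [C C0 hC] := block_integrand_bound k 1 lps.
pose psi (t : d.-tuple T) := \sum_(i < d) eta i * tnth t i.
pose A (t : d.-tuple T) u := hprod (fun=> l) u (fun i => e^-1 * (tnth t i - z ord0 i)).
have mcos : measurable_fun setT (fun t : d.-tuple T => cos (psi t + phi)).
  apply: measurableT_comp; first by apply: continuous_measurable_fun; exact: continuous_cos.
  apply: measurable_funD => //; apply: measurable_sum => i.
  by apply: measurable_funM => //; exact: measurable_tnth.
transitivity (\int[lebesgue_tuple d]_t \int[leb]_u (`|u| `^ k * Re (1 * A t u) * cos (psi t + phi))).
  apply: eq_Rintegral => t _; rewrite block_affineE.
  have h := RintegralZr (cos (psi t + phi)) measurableT (integrable_affine_integrand 1 e z t k0 lps).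
  exact: esym h.
rewrite (@Rintegral_swap R _ _ _ T (lebesgue_tuple d) leb
  (fun t u => `|u| `^ k * Re (1 * A t u) * cos (psi t + phi))
  (fun t => C * \prod_(i < d) stretched hrate tau (e^-1 * (tnth t i - z ord0 i))) (heat_weight k)); last 4 first.
- apply: measurable_funM; first exact: measurable_affine_integrand.
  exact: (measurableT_comp mcos measurable_fst).
- exact: (integrableZl measurableT _ (integrable_stretched_tensor z t0 (hrate_gt0 tau01 dl0) e0)).
- exact: integrable_heat_weight.
- move=> t u; rewrite normrM (le_trans _ (hC u _))// ler_piMr// ler_norml.
  by rewrite cos_geN1 cos_le1.
transitivity (\int[leb]_u (`|u| `^ k * expR (- (u ^+ 2 * (e ^+ 2 * \sum_(i < d) eta i ^+ 2))) * spec_value l e z eta phi)).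
  apply: eq_Rintegral => u _.
  have [i1 v1] := cint_hprod u z eta lp e0.
  have [i2 v2] := cint_hprod u z (fun i => - eta i) lp e0.
  pose E1 t := expi (- \sum_(i < d) eta i * tnth t i) * A t u.
  pose E2 t := expi (- \sum_(i < d) - eta i * tnth t i) * A t u.
  transitivity (`|u| `^ k * (2^-1 * (Re (expi phi * cint (lebesgue_tuple d) E2) +
      Re (expi (- phi) * cint (lebesgue_tuple d) E1)))).
    rewrite !Re_cint// -RintegralD//; last 2 first.
    - exact: (integrable_ReM (expi phi) i2).
    - exact: (integrable_ReM (expi (- phi)) i1).
    rewrite -!RintegralZl//; last 2 first.
    - have := integrableZl measurableT 2^-1 (integrableD measurableT
        (integrable_ReM (expi phi) i2) (integrable_ReM (expi (- phi)) i1)).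
      by congr (_.-integrable _ _).
    - exact: (integrableD measurableT
        (integrable_ReM (expi phi) i2) (integrable_ReM (expi (- phi)) i1)).
    apply: eq_Rintegral => t _; rewrite mul1r -mulrA; congr (_ * _).
    rewrite /E1 /E2 !mulrA -!expiD.
    have -> : phi - \sum_(i < d) - eta i * tnth t i = psi t + phi.
      by rewrite -sumrN addrC; congr (_ + _); apply: eq_bigr => i _; rewrite mulNr opprK.
    have -> : - phi - \sum_(i < d) eta i * tnth t i = - (psi t + phi).
      by rewrite opprD addrC.
    by case: (A t u) => p q; rewrite /expi /= cosN sinN; field.
  rewrite v1 v2 /spec_value -mulrA; congr (_ * _).
  have -> : \sum_(i < d) (- eta i) ^+ 2 = \sum_(i < d) eta i ^+ 2.
    by apply: eq_bigr => i _; rewrite sqrrN.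
  set g := expR _; move: (spec_factor _ _ _ _) (spec_factor _ _ _ _) => [p1 q1] [p2 q2] /=; ring.
have S0 : 0 <= \sum_(i < d) eta i ^+ 2 by apply: sumr_ge0 => i _; exact: sqr_ge0.
(* At zero frequency the integral of the moment diverges, but the spectral value vanishes there, so
   both sides are [0]. *)
have [S1|S1] := eqVneq (\sum_(i < d) eta i ^+ 2) 0.
  have eta0 i : eta i = 0.
    have /psumr_eq0P := S1 => /(_ (fun i _ => sqr_ge0 (eta i)) i isT) /eqP.
    by rewrite sqrf_eq0 => /eqP.
  rewrite (spec_value0 _ _ _ lp eta0).
  by rewrite mulr0; under eq_Rintegral do rewrite mulr0; rewrite Rintegral_cst// mul0r.
have Sp : 0 < \sum_(i < d) eta i ^+ 2 by rewrite lt_def S1.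
pose a := e * Num.sqrt (4 / 3 * \sum_(i < d) eta i ^+ 2).
have a0 : 0 < a by rewrite mulr_gt0// sqrtr_gt0 mulr_gt0.
have aE : e ^+ 2 * \sum_(i < d) eta i ^+ 2 = 3 / 4 * a ^+ 2.
  by rewrite /a exprMn sqr_sqrtr ?mulr_ge0//; field.
have [hm _] := integrable_moment k0 a0.
by rewrite RintegralZr// aE.
Qed.

End blocks.

(** * Positivity of the blocks at the origin for small [dl] *)

Section positivity.
Context {R : realType}.
Local Notation leb := (@lebesgue_measure R).
Local Notation Re := (@complex.Re R).
Local Notation Im := (@complex.Im R).
Implicit Types (x u y : R).

Lemma Rintegral_gt0 (f : R -> R) c : 0 < c ->
  leb.-integrable setT (EFin \o f) -> (forall x, 0 <= f x) ->
  (forall x, 1 <= x <= 2 -> c <= f x) -> 0 < \int[leb]_x f x.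
Proof.
move=> c0 fi f0 fc; apply: (@lt_le_trans _ _ c) => //.
have m12 : measurable (`[1, 2]%classic : set R) by exact: measurable_itv.
have I1 : (leb `[1%R, 2%R]%classic = 1)%E.
  by rewrite lebesgue_measure_itv /= lte_fin ltr1n -EFinB; congr EFin; ring.
have i1 : leb.-integrable setT (EFin \o \1_(`[1, 2]%classic : set R)).
  exact: (integrable_indic_itv 1 2 true false).
have ci := integrableZl measurableT c i1.
apply: (@le_trans _ _ (\int[leb]_x (c * \1_(`[1, 2]%classic : set R) x))).
  rewrite RintegralZl// (_ : Rintegral _ _ _ = 1) ?mulr1//.
  have := integral_indic leb measurableT m12; rewrite setIT => /(congr1 fine) E.
  by rewrite /Rintegral E [LHS](congr1 fine I1).
apply: le_Rintegral => // x _; rewrite indicE.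
case: (boolP (x \in _)) => [|_]; last by rewrite mulr0.
by rewrite inE /= in_itv /= mulr1; exact: fc.
Qed.

Definition ccont (F : R -> R[i]) x :=
  {for x, continuous (fun t => Re (F t))} /\ {for x, continuous (fun t => Im (F t))}.

Lemma ccont_cst c x : ccont (fun=> c) x.
Proof. by split; exact: cst_continuous. Qed.

Lemma ccontM F G x : ccont F x -> ccont G x -> ccont (fun t => F t * G t) x.
Proof.
move=> [f1 f2] [g1 g2]; split; rewrite /prop_for /continuous_at.
  by under eq_fun do rewrite ReM; rewrite ReM; apply: cvgB; exact: cvgM.
by under eq_fun do rewrite ImM; rewrite ImM; apply: cvgD; exact: cvgM.
Qed.

Lemma ccontB F G x : ccont F x -> ccont G x -> ccont (fun t => F t - G t) x.
Proof.
move=> [f1 f2] [g1 g2]; split; rewrite /prop_for /continuous_at.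
  have E z w : Re (z - w) = Re z - Re w by case: z; case: w.
  by under eq_fun do rewrite E; rewrite E; exact: cvgB.
have E z w : Im (z - w) = Im z - Im w by case: z; case: w.
by under eq_fun do rewrite E; rewrite E; exact: cvgB.
Qed.

Lemma ccont_cexp F x : ccont F x -> ccont (fun t => cexp (F t)) x.
Proof.
move=> [f1 f2]; split; rewrite /prop_for /continuous_at /cexp /=; apply: cvgM.
- by apply: continuous_cvg => //; exact: continuous_expR.
- by apply: continuous_cvg => //; exact: continuous_cos.
- by apply: continuous_cvg => //; exact: continuous_expR.
- by apply: continuous_cvg => //; exact: continuous_sin.
Qed.

Lemma ccont_clog (a b : R -> R) x : 0 < a x ->
  {for x, continuous a} -> {for x, continuous b} -> ccont (fun t => clog (a t) (b t)) x.
Proof.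
move=> a0 ca cb; split; rewrite /prop_for /continuous_at /clog /=.
  apply: cvgM; last exact: cvg_cst.
  apply: continuous_cvg; first by apply: continuous_ln; exact: sqr_norm_gt0.
  by rewrite !expr2; under eq_fun do rewrite !expr2; apply: cvgD; exact: cvgM.
apply: cvgN; apply: continuous_cvg; first exact: continuous_atan.
by apply: cvgM => //; apply: cvgV => //; rewrite gt_eqF.
Qed.

Variable tau : R.
Hypothesis tau01 : 0 < tau < 1.

Definition wbase : seq (R * R) := [:: (1, 0)].

Lemma nonpos_wbase : nonpos_exps wbase.
Proof. by rewrite /= lexx. Qed.

Lemma wexps_wbase a b : wexps tau wbase a b = cexp (0 - cexp (tau%:C * clog a b)).
Proof. by rewrite /wexps big_seq1 mul1r /wexp mul0r. Qed.

(* The absolute value makes [dl = 0], where positivity is explicit, an interior point. *)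
Definition hkern0 (dl u y : R) : R[i] := hkern tau `|dl| wbase u 0 y.

Lemma ccont_hkern0 u y dl : ccont (fun dl => hkern0 dl u y) dl.
Proof.
rewrite /hkern0 /hkern; apply: ccontM; first exact: ccont_cst.
apply: ccontM; first exact: ccont_cst.
apply: ccontM; first exact: ccont_cst.
under eq_fun do rewrite wexps_wbase.
apply: ccont_cexp; apply: ccontB; first exact: ccont_cst.
apply: ccont_cexp; apply: ccontM; first exact: ccont_cst.
apply: ccont_clog.
- by rewrite ltr_pwDl// mulr_ge0// mulr_ge0// sqr_ge0.
- rewrite /prop_for /continuous_at; apply: cvgD; first exact: cvg_cst.
  by apply: cvgM; [exact: norm_continuous|exact: cvg_cst].
- rewrite /prop_for /continuous_at.
  by apply: cvgM; [exact: norm_continuous|exact: cvg_cst].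
Qed.

(** The bound has to be uniform in [dl] to serve as a dominating function. The decay of the
    holomorphic factor is given up, since its rate degenerates as [dl] tends to [0]. *)
Lemma cmod_hkern0 dl u y : cmod (hkern0 dl u y) <= expR (- u ^+ 2) * gauss_fun y.
Proof.
rewrite /hkern0 /hkern !cmodM !cmodR cmod_expi mul1r !(ger0_norm (expR_ge0 _)).
rewrite mulrCA /gauss_fun ler_wpM2l ?expR_ge0// ler_piMr ?expR_ge0//.
rewrite wexps_wbase cmod_cexp -expR0 ler_expR ReD /=.
rewrite add0r oppr_le0 (le_trans _ (@Re_cpow _ _ tau01 _ _ _))//.
  by rewrite mulr_ge0 ?powR_ge0// ltW// decay_rate_gt0.
by rewrite ltr_pwDl// mulr_ge0// mulr_ge0// sqr_ge0.
Qed.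

Lemma cmeasurable_hkern0 (dl : R) d (T : measurableType d) (U Y : T -> R) :
  measurable_fun setT U -> measurable_fun setT Y ->
  cmeasurable (fun t : T => hkern0 dl (U t) (Y t)).
Proof.
move=> mU mY; exact: (@cmeasurable_hkern R tau `|dl| _ T wbase U (fun=> 0) Y).
Qed.

Definition hflow0 (dl u : R) : R[i] := cint leb (hkern0 dl u).

Lemma cintegrable_hkern0 dl u : cintegrable leb (hkern0 dl u).
Proof.
apply: (@dominated_cintegrable _ _ _ leb _ (fun y => expR (- u ^+ 2) * gauss_fun y)).
- exact: (@cmeasurable_hkern0 dl _ (measurableTypeR R) (fun=> u) id).
- exact: (integrableZl measurableT _ integrableT_gauss).
- by move=> y; exact: cmod_hkern0.
Qed.

Lemma cmod_hflow0 : exists2 C, 0 <= C & forall dl u, cmod (hflow0 dl u) <= C * expR (- u ^+ 2).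
Proof.
exists (2 * \int[leb]_y gauss_fun y).
  by rewrite mulr_ge0//; apply: Rintegral_ge0 => y _; exact: gauss_fun_ge0.
move=> dl u.
have gi := integrableZl measurableT (expR (- u ^+ 2)) (@integrableT_gauss R).
have := cmod_cint (cintegrable_hkern0 dl u) gi (cmod_hkern0 dl u).
by rewrite RintegralZl//; [rewrite mulrCA mulrC|exact: integrableT_gauss].
Qed.

Lemma ccont_hflow0 u dl : `](-1), 1[%classic dl -> ccont (fun dl => hflow0 dl u) dl.
Proof.
move=> Idl; have gi := integrableZl measurableT (expR (- u ^+ 2)) (@integrableT_gauss R).
split.
- apply: (@continuity_under_integral R _ _ leb (fun dl y => Re (hkern0 dl u y)) setT
    measurableT (-1) 1 _ _ (fun y => expR (- u ^+ 2) * gauss_fun y)) => //.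
  + by move=> x _; case: (cintegrable_hkern0 x u).
  + by apply: aeW => y _ x _; case: (ccont_hkern0 u y x).
  + by move=> x _; apply: aeW => y _; rewrite (le_trans (Re_le_cmod _))// cmod_hkern0.
  + by rewrite inE.
- apply: (@continuity_under_integral R _ _ leb (fun dl y => Im (hkern0 dl u y)) setT
    measurableT (-1) 1 _ _ (fun y => expR (- u ^+ 2) * gauss_fun y)) => //.
  + by move=> x _; case: (cintegrable_hkern0 x u).
  + by apply: aeW => y _ x _; case: (ccont_hkern0 u y x).
  + by move=> x _; apply: aeW => y _; rewrite (le_trans (Im_le_cmod _))// cmod_hkern0.
  + by rewrite inE.
Qed.

(** At [dl = 0] the holomorphic factor is the constant [exp (- 2 ^ tau)]; what is left is the
    Gaussian integral in [y]. *)
Lemma hflow0_0 : exists2 K, 0 < K & forall u, hflow0 0 u = (expR (- u ^+ 2) * K)%:C.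
Proof.
pose w := expR (- expR (tau * (ln 4 / 2))).
have wE u y : hkern0 0 u y = (expR (- u ^+ 2) * w * gauss_fun y)%:C.
  rewrite /hkern0 /hkern normr0 !mul0r expi0 mul1r addr0 wexps_wbase.
  rewrite (_ : clog 2 0 = (ln 4 / 2)%:C); last first.
    by rewrite /clog mul0r atan0 oppr0 expr0n addr0 -natrX.
  rewrite -rmorphM cexpR sub0r -rmorphN cexpR -!rmorphM /=; congr (_%:C).
  by rewrite /gauss_fun /w; ring.
exists (w * Num.sqrt pi); first by rewrite mulr_gt0 ?expR_gt0// sqrtr_gt0 pi_gt0.
move=> u; apply: complex_eq => /=.
  under eq_Rintegral do rewrite wE /=.
  rewrite RintegralZl//; last exact: integrableT_gauss.
  by rewrite /Rintegral integralT_gauss /= mulrA.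
by under eq_Rintegral do rewrite wE /=; rewrite Rintegral_cst// mul0r.
Qed.

Variable d : nat.
Hypothesis d0 : (0 < d)%N.

Definition block0 (k dl : R) : R := \int[leb]_u (`|u| `^ k * Re (hflow0 dl u ^+ d)).

Lemma block0E k dl : 0 < dl ->
  block0 k dl = @block R d tau dl k 1 (fun=> wbase) 0.
Proof.
move=> dl0; apply: eq_Rintegral => u _; rewrite mul1r /hprod; congr (_ * Re _).
rewrite -[X in _ ^+ X]card_ord -prodr_const; apply: eq_bigr => i _.
by rewrite mxE /hflow0 /hflow /hkern0 gtr0_norm.
Qed.

(** The value at [dl = 0] is explicit and positive; dominated convergence in [u] gives continuity in
    [dl], which extends the sign to a neighbourhood. *)
Lemma block0_gt0 k : 0 <= k -> \forall dl \near (0 : R), 0 < block0 k dl.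
Proof.
move=> k0; have [C C0 hC] := cmod_hflow0.
have gE u dl : `| `|u| `^ k * Re (hflow0 dl u ^+ d)| <= C ^+ d * heat_weight k u.
  rewrite normrM (ger0_norm (powR_ge0 _ _)) /heat_weight [leRHS]mulrCA ler_wpM2l ?powR_ge0//.
  rewrite (le_trans (Re_le_cmod _))//.
  have -> : cmod (hflow0 dl u ^+ d) = cmod (hflow0 dl u) ^+ d.
    by elim: (d) => [|n IH]; rewrite ?expr0 ?(cmodR 1) ?normr1// !exprS cmodM IH.
  rewrite (@le_trans _ _ ((C * expR (- u ^+ 2)) ^+ d))//.
    by rewrite lerXn2r ?nnegrE ?cmod_ge0 ?mulr_ge0 ?expR_ge0.
  rewrite exprMn ler_wpM2l ?exprn_ge0//; case: (d) d0 => // n _.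
  rewrite exprS (@le_trans _ _ (expR (- u ^+ 2)))//.
    rewrite ler_piMr ?expR_ge0// exprn_ile1 ?expR_ge0//.
    by rewrite -[leRHS]expR0 ler_expR oppr_le0 sqr_ge0.
  by rewrite ler_expR; have := sqr_ge0 u; lra.
have hi k' : 0 <= k' -> leb.-integrable setT (EFin \o (fun u => C ^+ d * heat_weight k' u)).
  by move=> k0'; exact: (integrableZl measurableT _ (integrable_heat_weight k0')).
have ccX u dl : `](-1), 1[%classic dl -> ccont (fun dl => hflow0 dl u ^+ d) dl.
  move=> Idl; elim: (d) => [|n IH]; first exact: ccont_cst.
  by under eq_fun do rewrite exprS; apply: ccontM => //; exact: ccont_hflow0.
have fi dl : leb.-integrable setT (EFin \o (fun u => `|u| `^ k * Re (hflow0 dl u ^+ d))).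
  apply: (@dominated_integrable _ _ _ leb _ (fun u => C ^+ d * heat_weight k u)).
  - apply: measurable_funM; first exact: measurable_powR_norm.
    have mh : cmeasurable (hflow0 dl : measurableTypeR R -> _).
      apply: (@cmeasurable_cint R _ _ (measurableTypeR R) (measurableTypeR R) leb (hkern0 dl)).
      exact: (@cmeasurable_hkern0 dl _ (measurableTypeR R * measurableTypeR R)%type fst snd).
    have : cmeasurable (fun u : measurableTypeR R => \prod_(i < d) hflow0 dl u).
      by apply: cmeasurable_prod.
    by under eq_fun do rewrite prodr_const card_ord; case.
  - exact: hi.
  - by move=> u; exact: gE.
have c0 : {for 0, continuous (block0 k)}.
  apply: (@continuity_under_integral R _ _ leb (fun dl u => `|u| `^ k * Re (hflow0 dl u ^+ d)) setT
    measurableT (-1) 1 _ _ (fun u => C ^+ d * heat_weight k u)) => //.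
  - apply: aeW => u _ x; rewrite inE => Ix; apply: cvgM; first exact: cvg_cst.
    by case: (ccX u x Ix).
  - exact: hi.
  - by move=> x _; apply: aeW => u _; exact: gE.
  - by rewrite inE /= in_itv /=; lra.
have p0 : 0 < block0 k 0.
  have [K K0 hK] := hflow0_0.
  have E u : `|u| `^ k * Re (hflow0 0 u ^+ d) = `|u| `^ k * (expR (- u ^+ 2) * K) ^+ d.
    by rewrite hK -rmorphXn.
  (* On [[1, 2]] the weight is at least [1] and the Gaussian at least [exp (- 4)]. *)
  apply: (@Rintegral_gt0 _ ((expR (- 4) * K) ^+ d)).
  - by rewrite exprn_gt0// mulr_gt0// expR_gt0.
  - exact: fi.
  - by move=> u; rewrite E mulr_ge0 ?powR_ge0// exprn_ge0// mulr_ge0 ?expR_ge0// ltW.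
  - move=> u /andP[u1 u2]; rewrite E.
    have k1 : 1 <= `|u| `^ k.
      rewrite ger0_norm ?(le_trans ler01)//.
      apply: (@le_trans _ _ (u `^ 0)); first by rewrite powRr0.
      by apply: ler_powR.
    apply: (@le_trans _ _ ((expR (- u ^+ 2) * K) ^+ d)).
      rewrite lerXn2r ?nnegrE ?mulr_ge0 ?expR_ge0 ?(ltW K0)// ler_pM2r// ler_expR.
      by nra.
    by rewrite ler_peMl// exprn_ge0// mulr_ge0 ?expR_ge0// ltW.
exact: (cvgr_gt _ c0 _ p0).
Qed.

End positivity.

(** * A rapidly decaying pair related by the fractional Laplacian *)

Section laplacian_pair.
Local Opaque hflow.
Context {R : realType} {d : nat}.
Implicit Types (x z : 'rV[R]_d) (u k e : R).
Local Notation leb := (@lebesgue_measure R).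
Hypothesis d0 : (0 < d)%N.

(** The derivatives form a family indexed by words, which passes through sums and integrals more
    easily than iterated [derive]. The decay at every rate [K] comes from blocks whose exponent
    [tau] exceeds [theta]. *)
Definition rapid (theta : R) (u : 'rV[R]_d -> R) :=
  exists D : seq 'I_d -> 'rV[R]_d -> R, [/\ D [::] = u,
    forall w i x, is_derive x (basisv i) (D w) (D (i :: w) x) &
    forall w K, exists2 C, 0 <= C & forall x, `|D w x| <= C * expR (- (K * wnorm theta x))].

Lemma rapidZ theta c (u : 'rV[R]_d -> R) : rapid theta u -> rapid theta (fun x => c * u x).
Proof.
move=> [D [<- dD bD]]; exists (fun w x => c * D w x); split => //.
  by move=> w i x; exact: is_deriveZ.
move=> w K; have [C C0 hC] := bD w K; exists (`|c| * C); first by rewrite mulr_ge0.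
by move=> x; rewrite normrM -mulrA ler_wpM2l.
Qed.

Lemma measurable_dotv (xi : 'rV[R]_d) :
  measurable_fun setT (fun t : d.-tuple (measurableTypeR R) => dotv xi (rowt t)).
Proof.
apply: measurable_sum => i; apply: measurable_funM => //.
by under eq_fun do rewrite mxE; exact: measurable_tnth.
Qed.

Lemma measurable_wave (xi : 'rV[R]_d) phi :
  measurable_fun setT (fun t : d.-tuple (measurableTypeR R) => cos (2 * pi * dotv xi (rowt t) + phi)).
Proof.
apply: measurableT_comp; first exact: (continuous_measurable_fun (@continuous_cos R)).
by apply: measurable_funD => //; apply: measurable_funM => //; exact: measurable_dotv.
Qed.

Lemma integrable_decay theta C e z (u g : d.-tuple (measurableTypeR R) -> R) :
  0 < theta -> 0 < e -> measurable_fun setT u -> measurable_fun setT g ->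
  (forall t, `|g t| <= 1) ->
  (forall t, `|u t| <= C * expR (- (1 * wnorm theta (e^-1 *: (rowt t - z))))) ->
  (lebesgue_tuple d).-integrable setT (EFin \o (fun t => u t * g t)).
Proof.
move=> th0 e0 mu mg g1 uC.
apply: (@dominated_integrable _ _ _ (lebesgue_tuple d) _
  (fun t => C * \prod_(i < d) stretched 1 theta (e^-1 * (tnth t i - z ord0 i)))).
- exact: measurable_funM.
- exact: (integrableZl measurableT _ (integrable_stretched_tensor z th0 ltr01 e0)).
- move=> t; rewrite normrM; apply: (@le_trans _ _ `|u t|); first by rewrite ler_piMr.
  apply: le_trans (uC t) _; rewrite -prod_stretched; under eq_bigr do rewrite affine_coord.
  exact: lexx.
Qed.

Lemma wnorm_dominates K c th tau : 0 < c -> 0 < th < tau ->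
  exists2 C, 0 <= C & forall x, K * wnorm th x <= C + c * wnorm tau x.
Proof.
move=> c0 tt; have [C C0 hC] := powR_dominates K c0 tt.
exists (\sum_(i < d) C); first by rewrite sumr_ge0.
move=> x; rewrite /wnorm !mulr_sumr -big_split /=; apply: ler_sum => i _.
exact: hC.
Qed.

Lemma rapid_block tau dl k theta l : 0 < theta < tau -> tau < 1 -> 0 < dl -> 0 <= k ->
  nonpos_exps l -> rapid theta (block tau dl k 1 (fun=> l) : 'rV[R]_d -> R).
Proof.
move=> /andP[th0 tht] t1 dl0 k0 lp.
have tau01 : 0 < tau < 1 by rewrite t1 andbT (lt_trans th0).
(* Each letter of the word multiplies the constant by ['i] and differentiates the list of one
   coordinate. *)
pose cs := foldr (fun (i : 'I_d) (p : R[i] * ('I_d -> seq (R * R))) =>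
  (p.1 * 'i, hder_at tau dl i p.2)) (1, fun=> l).
have csp w i : nonpos_exps ((cs w).2 i).
  by elim: w i => [|j w IH] i //=; exact: nonpos_hder_at.
exists (fun w => block tau dl k (cs w).1 (cs w).2); split; first reflexivity.
  by move=> w i x; exact: (is_derive_block tau01 dl0 d0 _ _ _ k0 (csp w)).
move=> w K; have [C C0 hC] := block_bound tau01 dl0 d0 (cs w).1 k0 (csp w).
have ht : 0 < theta < tau by rewrite th0.
have [C' C'0 hC'] := wnorm_dominates K (hrate_gt0 tau01 dl0) ht.
exists (C * expR C'); first by rewrite mulr_ge0 ?expR_ge0.
move=> x; apply: le_trans (hC x) _; rewrite -mulrA ler_wpM2l// -expRD ler_expR.
by have := hC' x; lra.
Qed.

Lemma heat_mass_gt0 k : 0 <= k -> 0 < heat_mass (k : R).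
Proof.
move=> k0; apply: (@Rintegral_gt0 _ _ (expR (- 3))).
- exact: expR_gt0.
- exact: integrable_heat_weight.
- by move=> u; exact: heat_weight_ge0.
- move=> u /andP[u1 u2]; rewrite /heat_weight.
  have k1 : 1 <= `|u| `^ k.
    rewrite ger0_norm ?(le_trans ler01)//.
    by apply: (@le_trans _ _ (u `^ 0)); [rewrite powRr0|exact: ler_powR].
  apply: (@le_trans _ _ (expR (- (3 / 4 * u ^+ 2)))); first by rewrite ler_expR; nra.
  by rewrite ler_peMl// expR_ge0.
Qed.

(** The transforms of the two blocks share the factor [spec_value], and their moments differ by a
    multiple of [(e |xi|) ^ (2 s)]. Cosine integrals with a free phase express the Fourier identity
    for real functions, and [e], [z] make it applicable to rescaled translates. *)
Lemma laplacian_pair (theta s : R) : 0 < theta < 1 -> 0 < s ->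
  exists P Q : 'rV[R]_d -> R, [/\ P 0 != 0, Q 0 != 0, rapid theta P, rapid theta Q &
   (forall e z, 
     measurable_fun setT (fun t : d.-tuple (measurableTypeR R) => P (e^-1 *: (rowt t - z))) /\
     measurable_fun setT (fun t : d.-tuple (measurableTypeR R) => Q (e^-1 *: (rowt t - z)))) /\
   forall e z (xi : 'rV[R]_d) phi, 0 < e ->
   \int[lebesgue_tuple d]_t (Q (e^-1 *: (rowt t - z)) * cos (2 * pi * dotv xi (rowt t) + phi)) =
   e `^ (2 * s) * enorm xi `^ (2 * s) *
   \int[lebesgue_tuple d]_t (P (e^-1 *: (rowt t - z)) * cos (2 * pi * dotv xi (rowt t) + phi))].
Proof.
move=> /andP[th0 th1] s0; pose tau := (theta + 1) / 2.
have tau01 : 0 < tau < 1 by rewrite /tau; lra.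
have k0 : 0 <= 2 * s by rewrite mulr_ge0// ltW.
(* The same [dl] has to serve both values of [k], hence the intersection of two neighbourhoods. *)
have [dl [dl0 b1 b2]] : exists dl, [/\ 0 < dl, 0 < block0 tau d 0 dl & 0 < block0 tau d (2 * s) dl].
  have h1 : \forall dl \near (0:R)^'+, 0 < block0 tau d 0 dl.
    by apply: cvg_within; exact: block0_gt0.
  have h2 : \forall dl \near (0:R)^'+, 0 < block0 tau d (2 * s) dl.
    by apply: cvg_within; exact: block0_gt0.
  have h3 : \forall dl \near (0:R)^'+, 0 < dl by exact: nbhs_right_gt.
  by have [dl [? [? ?]]] := filter_ex (filterI h3 (filterI h1 h2)); exists dl.
(* Chosen so that [a = b0 * e * enorm xi] satisfies [3 / 4 a ^ 2 = (2 pi e |xi|) ^ 2]; [q]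
   normalises the resulting ratio of moments. *)
pose b0 := 4 * pi / Num.sqrt 3 : R.
have b00 : 0 < b0 by rewrite divr_gt0 ?sqrtr_gt0// mulr_gt0// pi_gt0.
pose q := heat_mass (2 * s) / heat_mass 0 * (b0 `^ (2 * s))^-1.
have q0 : 0 < q.
  by rewrite mulr_gt0 ?invr_gt0 ?powR_gt0// divr_gt0// heat_mass_gt0.
have tht : 0 < theta < tau by rewrite /tau; lra.
have t1 : tau < 1 by case/andP: tau01.
have rQ : rapid theta (block tau dl 0 1 (fun=> wbase) : 'rV[R]_d -> R).
  by apply: (rapid_block tht t1 dl0 (lexx 0)); exact: nonpos_wbase.
exists (block tau dl (2 * s) 1 (fun=> wbase)).
exists (fun x => q * block tau dl 0 1 (fun=> wbase) x); split.
- by rewrite -block0E// gt_eqF.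
- by rewrite -block0E// mulf_neq0// gt_eqF.
- by apply: (rapid_block tht t1 dl0 k0); exact: nonpos_wbase.
- exact: rapidZ.
split.
  move=> e z; split; first exact: measurable_block_affine.
  by apply: measurable_funM => //; exact: measurable_block_affine.
move=> e z xi phi e0.
have dE (t : d.-tuple (measurableTypeR R)) :
    2 * pi * dotv xi (rowt t) = \sum_(i < d) (2 * pi * xi ord0 i) * tnth t i.
  by rewrite /dotv mulr_sumr; apply: eq_bigr => i _; rewrite mxE mulrA.
have sE : \sum_(i < d) (2 * pi * xi ord0 i) ^+ 2 = (2 * pi * enorm xi) ^+ 2.
  rewrite exprMn /enorm sqr_sqrtr; last by rewrite sumr_ge0// => i _; rewrite -expr2 sqr_ge0.
  by rewrite /dotv mulr_sumr; apply: eq_bigr => i _; rewrite exprMn expr2 expr2.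
under eq_Rintegral do rewrite dE.
under [X in _ = _ * X]eq_Rintegral do rewrite dE.
have -> : \int[lebesgue_tuple d]_t (q * block tau dl 0 1 (fun=> wbase) (e^-1 *: (rowt t - z)) *
    cos (\sum_(i < d) 2 * pi * xi ord0 i * tnth t i + phi)) =
   q * \int[lebesgue_tuple d]_t (block tau dl 0 1 (fun=> wbase) (e^-1 *: (rowt t - z)) *
    cos (\sum_(i < d) 2 * pi * xi ord0 i * tnth t i + phi)).
  have lp : forall i : 'I_d, nonpos_exps ((fun=> wbase) i : seq (R * R)) by move=> i; exact: nonpos_wbase.
  under eq_Rintegral do rewrite -mulrA.
  apply: RintegralZl => //.
  have [D [D0 _ bD]] := rQ.
  have [C C0 hC] := bD [::] 1.
  apply: (@integrable_decay theta C e z) => //.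
  - exact: measurable_block_affine.
  - by under eq_fun do rewrite -dE; exact: measurable_wave.
  - by move=> t; exact: cos_max.
  - by move=> t; rewrite -D0.
rewrite (block_ft tau01 dl0 d0 z (fun i => 2 * pi * xi ord0 i) phi (lexx 0) nonpos_wbase e0).
rewrite (block_ft tau01 dl0 d0 z (fun i => 2 * pi * xi ord0 i) phi k0 nonpos_wbase e0) sE.
have [x0|x0] := eqVneq (enorm xi) 0.
  have eta0 i : 2 * pi * xi ord0 i = 0.
    apply/eqP; rewrite -sqrf_eq0.
    have : \sum_(i < d) (2 * pi * xi ord0 i) ^+ 2 == 0 by rewrite sE x0 mulr0 expr0n.
    by rewrite psumr_eq0 => [/allP/(_ i (mem_index_enum _))|j _]; rewrite ?sqr_ge0.
  by rewrite (spec_value0 tau01 dl0 d0 _ _ _ nonpos_wbase eta0) !mulr0.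
have xp : 0 < enorm xi by rewrite lt_neqAle eq_sym x0 sqrtr_ge0.
pose a := b0 * e * enorm xi.
have a0 : 0 < a by apply: mulr_gt0 => //; exact: mulr_gt0.
have aE : e ^+ 2 * (2 * pi * enorm xi) ^+ 2 = 3 / 4 * a ^+ 2.
  have s3 : Num.sqrt 3 ^+ 2 = 3 :> R by rewrite sqr_sqrtr.
  have s3' : Num.sqrt 3 != 0 :> R by rewrite gt_eqF// sqrtr_gt0.
  rewrite /a /b0 !exprMn exprVn s3; field; exact: isT.
have [_ m1] := integrable_moment k0 a0.
have [_ m2] := integrable_moment (lexx (0:R)) a0.
have H0 : heat_mass 0 != 0 :> R by rewrite gt_eqF// heat_mass_gt0.
have an : a != 0 by rewrite gt_eqF.
have B0 : b0 `^ (2 * s) != 0 by rewrite gt_eqF// powR_gt0.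
have aX : a `^ (2 * s) = b0 `^ (2 * s) * e `^ (2 * s) * enorm xi `^ (2 * s).
  have be0 : 0 <= b0 * e by apply: mulr_ge0; exact: ltW.
  by rewrite (powRM _ be0 (ltW xp)) (powRM _ (ltW b00) (ltW e0)).
rewrite powRr0 mulr1 in m2; rewrite -m2 mulf_eq0 negb_or an /= in H0.
rewrite aE /q -m1 -m2 aX; move: B0 H0 an.
move: (b0 `^ _) (moment 0 (3 / 4 * a ^+ 2)) (moment (2 * s) (3 / 4 * a ^+ 2)) (spec_value _ _ _ _ _ _ _) (e `^ _) (enorm xi `^ _) (a : R).
by clear=> B M0 M2 S E X b B0 H0 b1; field; rewrite H0 b1 B0.
Qed.

End laplacian_pair.

(** * Series as integrals for the counting measure, and the Neumann series *)

HB.instance Definition _ (R : realType) := @Measure_isSigmaFinite.Build _ nat R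
  (@counting nat R) (@sigma_finite_counting R).

Section counting_sums.
Context {R : realType}.
Implicit Types (f g w b : nat -> R) (C : R).
Local Notation cnt := (@counting nat R).

(** With series as integrals, differentiation of a series and its exchange with integrals or other
    series are instances of the integration theorems. *)
Definition nsum f : R := \int[cnt]_n f n.

Lemma measurable_nat_prod d (T : measurableType d) (f : nat -> T -> R) :
  (forall n, measurable_fun setT (f n)) ->
  measurable_fun setT (fun z : nat * T => f z.1 z.2).
Proof.
move=> mf _ Y mY; rewrite setTI.
have -> : (fun z : nat * T => f z.1 z.2) @^-1` Y = \bigcup_n ([set n] `*` (f n @^-1` Y)).
  apply/seteqP; split=> [[n t] /= Yn|[n t] [m _ [/= -> ?]]//].
  by exists n.
apply: bigcup_measurable => n _; apply: measurableX => //.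
by rewrite -[X in measurable X]setTI; exact: mf.
Qed.

Lemma nat_measurable_fun d (T : measurableType d) (f : nat -> T) : measurable_fun setT f.
Proof. by []. Qed.

(** Equal to [1 / (n + 1) - 1 / (n + 2)], with telescoping sum [1]. Its inverse is polynomial in
    [n], so bounds on the numbering of the nodes translate into lower bounds for [wt]. *)
Definition wt n : R := (n.+1%:R * n.+2%:R)^-1.

Lemma wt_gt0 n : 0 < wt n.
Proof. by rewrite invr_gt0 mulr_gt0. Qed.

Lemma wt_ge0 n : 0 <= wt n. Proof. exact/ltW/wt_gt0. Qed.

Lemma wtS n : wt n.+1 <= wt n.
Proof.
rewrite /wt lef_pV2 ?posrE ?mulr_gt0// -!natrM ler_nat; lia.
Qed.

Lemma sum_wt n : \sum_(0 <= k < n) wt k = 1 - n.+1%:R^-1.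
Proof.
elim: n => [|n IH]; first by rewrite big_geq// invr1 subrr.
rewrite big_nat_recr//= IH /wt.
have h1 : n.+1%:R != 0 :> R by rewrite pnatr_eq0.
have h2 : n.+2%:R != 0 :> R by rewrite pnatr_eq0.
rewrite -[n.+2%:R]natr1 in h2 *; move: (n.+1%:R : R) h1 h2 => X h1 h2.
by field; rewrite h1 h2.
Qed.

Lemma integrable_wt : cnt.-integrable setT (EFin \o wt) /\ nsum wt <= 1.
Proof.
have I : (\int[cnt]_n (wt n)%:E <= 1)%E.
  rewrite ge0_integral_count; last by move=> n; rewrite lee_fin wt_ge0.
  apply: lime_le; first by apply: is_cvg_nneseries => n _ _; rewrite lee_fin wt_ge0.
  apply: nearW => n; rewrite sumEFin lee_fin sum_wt lerBlDr lerDl invr_ge0//.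
split; last by rewrite /nsum /Rintegral -lee_fin fineK// fin_num_abs gee0_abs ?(le_lt_trans I) ?ltry//; apply: integral_ge0 => n _; rewrite lee_fin wt_ge0.
apply/integrableP; split; first exact: nat_measurable_fun.
under eq_integral => n _ do rewrite /= ger0_norm ?wt_ge0//.
by rewrite (le_lt_trans I)// ltry.
Qed.

Lemma integrable_nat f C : (forall n, `|f n| <= C * wt n) -> cnt.-integrable setT (EFin \o f).
Proof.
move=> fC; apply: (@dominated_integrable _ _ _ cnt _ (fun n => C * wt n)) => //.
exact: (integrableZl measurableT C integrable_wt.1).
Qed.

Lemma nsum_bound f C : (forall n, `|f n| <= C * wt n) -> `|nsum f| <= C.
Proof.
move=> fC; have C0 : 0 <= C.
  by have := le_trans (normr_ge0 _) (fC 0); rewrite pmulr_lge0// wt_gt0.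
rewrite (le_trans (le_normr_Rintegral _ _))//; first exact: (integrable_nat fC).
apply: (@le_trans _ _ (nsum (fun n => C * wt n))).
  apply: le_Rintegral => //.
  - apply: (@integrable_nat _ C) => n; rewrite normr_id; exact: fC.
  - exact: (integrableZl measurableT C integrable_wt.1).
by rewrite /nsum RintegralZl ?integrable_wt.1// ler_piMr// integrable_wt.2.
Qed.

Lemma eq_nsum f g : f =1 g -> nsum f = nsum g.
Proof. by move=> fg; apply: eq_Rintegral => n _; exact: fg. Qed.

Lemma nsumZ a f C : (forall n, `|f n| <= C * wt n) -> nsum (fun n => a * f n) = a * nsum f.
Proof. by move=> fC; rewrite /nsum RintegralZl//; exact: (integrable_nat fC). Qed.

Lemma nsumD f g C C' : (forall n, `|f n| <= C * wt n) -> (forall n, `|g n| <= C' * wt n) ->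
  nsum (fun n => f n + g n) = nsum f + nsum g.
Proof.
by move=> fC gC; rewrite /nsum RintegralD//; [exact: (integrable_nat fC)|exact: (integrable_nat gC)].
Qed.

Lemma nsum_delta m c : nsum (fun n => if n == m then c else 0) = c.
Proof.
rewrite (@eq_nsum _ (fun n => c * \1_[set m] n)); last first.
  move=> n; rewrite indicE; case: eqP => [->|nm]; first by rewrite mem_set ?mulr1.
  by rewrite memNset ?mulr0.
have c1 : cnt [set m] = 1%E.
  rewrite /counting asboolT; last exact: finite_set1.
  by rewrite fset_set1 finmap.cardfs1.
have m1 : measurable [set m] by [].
have I1 : nsum \1_[set m] = 1.
  have := integral_indic cnt measurableT m1; rewrite setIT => /(congr1 fine) E.
  by rewrite /nsum /Rintegral E [LHS](congr1 fine c1).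
rewrite /nsum RintegralZl ?[X in _ * X]I1 ?mulr1//.
apply: (@integrable_nat _ (wt m)^-1) => n; rewrite indicE.
case: (boolP (n \in _)) => [|_]; last by rewrite normr0 mulr_ge0 ?invr_ge0 ?wt_ge0.
by rewrite inE /= => ->; rewrite normr1 mulVf// gt_eqF// wt_gt0.
Qed.

Lemma nsum_cvg f C : (forall n, `|f n| <= C * wt n) ->
  (fun n => \sum_(0 <= k < n) f k) @ \oo --> nsum f.
Proof.
move=> fC; pose h n k := if (k < n)%N then f k else 0.
have hC n k : `|h n k| <= C * wt k.
  by rewrite /h; case: ifP => // _; rewrite normr0 (le_trans (normr_ge0 _) (fC k)).
have hE n : nsum (h n) = \sum_(0 <= k < n) f k.
  elim: n => [|n IH].
    rewrite big_geq// (@eq_nsum _ (fun k => if k == 0%N then 0 else 0)) ?nsum_delta// => k.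
    by rewrite /h; case: eqP.
  rewrite big_nat_recr//= -IH.
  rewrite (@eq_nsum _ (fun k => h n k + (if k == n then f n else 0))); last first.
    move=> k; rewrite /h ltnS leq_eqVlt; case: eqP => [->|_]/=; last by rewrite addr0.
    by rewrite ltnn add0r.
  rewrite (@nsumD _ _ C C)// ?nsum_delta// => k.
  by case: eqP => [->//|_]; rewrite normr0 (le_trans (normr_ge0 _) (fC k)).
under eq_fun do rewrite -hE.
apply: fine_cvg; rewrite fineK; last first.
  by have := integrable_fin_num measurableT (integrable_nat fC).
apply: (@dominated_cvg _ _ _ cnt setT measurableT (fun n => EFin \o h n) (EFin \o f)
  (EFin \o (fun k => C * wt k))) => //.
- move=> k _; apply: cvg_near_cst; exists k.+1 => // n /= kn.
  by rewrite /h kn.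
- exact: (integrableZl measurableT C integrable_wt.1).
- by move=> n k _; rewrite lee_fin; exact: hC.
Qed.

Lemma nsum_recl f C : (forall n, `|f n| <= C * wt n) -> nsum f = f 0%N + nsum (f \o S).
Proof.
move=> fC; have C0 : 0 <= C.
  by have := le_trans (normr_ge0 _) (fC 0); rewrite pmulr_lge0// wt_gt0.
have sC n : `|(f \o S) n| <= C * wt n by rewrite (le_trans (fC _))// ler_wpM2l// wtS.
have h := nsum_cvg fC; rewrite -cvg_shiftS in h.
apply: (cvg_unique _ h) => //.
have -> : [sequence \sum_(0 <= k < n.+1) f k]_n = (fun n => f 0%N + \sum_(0 <= k < n) (f \o S) k).
  by apply/funext => n; rewrite /= big_nat_recl.
by apply: cvgD; [exact: cvg_cst|exact: (nsum_cvg sC)].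
Qed.

Lemma pow2_wt k : 2^-1 ^+ k <= 3 * wt k.
Proof.
rewrite /wt ler_pdivlMr ?mulr_gt0// -natrM exprVn ler_pdivrMl ?exprn_gt0//.
rewrite -natrX -natrM ler_nat; case: k => // k.
elim: k => [//|k IH]; rewrite (@leq_trans (2 * (k.+2 * k.+3)))//.
  by nia.
by rewrite [(2 ^ k.+2)%N]expnS -mulnA leq_mul2l /=.
Qed.

(** As the weights [wt i] sum to at most [1], the operator [T] has norm at most [1 / 2] in the sup
    norm weighted by [w]. The solution is the sum of [(- T) ^ k b]; the bound of [2 ^ (- k)] by
    [3 wt k] brings this series under the same domination as the others. *)
Lemma neumann (T : nat -> nat -> R) w b c :
  (forall i, 0 < w i) -> (forall j i, `|T j i| * w i <= 2^-1 * wt i * w j) ->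
  0 <= c -> (forall j, `|b j| <= c * w j) ->
  exists a, (forall j, `|a j| <= 6 * c * w j) /\
    (forall j, a j + nsum (fun i => T j i * a i) = b j).
Proof.
move=> w0 Tw c0 bw; pose step r j := - nsum (fun i => T j i * r i).
have TwC j i (r : R) c' : 0 <= c' -> `|r| <= c' * w i -> `|T j i * r| <= 2^-1 * c' * w j * wt i.
  move=> c'0 rc; rewrite normrM (@le_trans _ _ (c' * (`|T j i| * w i)))//.
    by rewrite mulrCA ler_wpM2l.
  by rewrite (le_trans (ler_wpM2l c'0 (Tw j i)))//; lra.
pose r k := iter k step b.
have rb k j : `|r k j| <= c * 2^-1 ^+ k * w j.
  elim: k j => [|k IH] j; first by rewrite expr0 mulr1.
  rewrite /r iterS -/(r k) /step normrN exprS.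
  rewrite [leRHS](_ : _ = 2^-1 * (c * 2^-1 ^+ k) * w j); last by rewrite (mulrCA c).
  apply: nsum_bound.
  by move=> i; apply: TwC => //; rewrite mulr_ge0// exprn_ge0// invr_ge0.
have rb3 j k : `|r k j| <= 3 * c * w j * wt k.
  rewrite (le_trans (rb k j))// (@le_trans _ _ (c * (3 * wt k) * w j))//; last by lra.
  by rewrite ler_wpM2r ?(ltW (w0 j))// ler_wpM2l// pow2_wt.
exists (fun j => nsum (fun k => r k j)); split.
  move=> j; rewrite (le_trans (nsum_bound (rb3 j)))// ler_wpM2r ?(ltW (w0 j))//.
  by rewrite ler_wpM2r// ler_nat.
move=> j; rewrite (nsum_recl (rb3 j)) /= -addrA [X in _ + X](_ : _ = 0) ?addr0//.
have -> : nsum (fun i => T j i * nsum (fun k => r k i)) =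
          nsum (fun i => nsum (fun k => T j i * r k i)).
  by apply: eq_nsum => i; rewrite (nsumZ _ (rb3 i)).
have b2 i k : `|T j i * r k i| <= wt i * (3 * c * w j * wt k).
  have c'0 : 0 <= 3 * c * wt k by rewrite !mulr_ge0// wt_ge0.
  have rc : `|r k i| <= 3 * c * wt k * w i by rewrite (le_trans (rb3 i k))//; lra.
  rewrite (le_trans (TwC j i _ _ c'0 rc))//.
  have : 0 <= 3 * c * wt k * w j * wt i.
    by rewrite mulr_ge0 ?wt_ge0// mulr_ge0// ltW.
  lra.
have -> : nsum (fun i => nsum (fun k => T j i * r k i)) = nsum (fun k => nsum (fun i => T j i * r k i)).
  refine (@Rintegral_swap R _ _ nat nat cnt cnt (fun i k => T j i * r k i) wt (fun k => 3 * c * w j * wt k) _ _ _ _).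
  - by apply: (@measurable_nat_prod _ nat (fun i k => T j i * r k i)) => n.
  - exact: integrable_wt.1.
  - exact: (integrableZl measurableT _ integrable_wt.1).
  - exact: b2.
(* After the exchange of sums every term vanishes, since [r k.+1] is minus [T] applied to [r k]. *)
rewrite -(@nsumD _ _ (3 * c * w j) (3 * c * w j)).
- rewrite (@eq_nsum _ (fun k => if k == 0%N then 0 else 0)) ?nsum_delta// => k.
  by rewrite /r /= -/(r k) /step addNr; case: eqP.
- by move=> k; rewrite (le_trans (rb3 _ _))// ler_wpM2l ?wtS// mulr_ge0 ?mulr_ge0// ltW.
- move=> k; rewrite (@nsum_bound _ (3 * c * w j * wt k))// => i.
  by rewrite (le_trans (b2 i k))// mulrC.
Qed.

End counting_sums.

(** * Superpositions of rescaled translates *)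

Section superposition.
Context {R : realType} {d : nat}.
Implicit Types (x y z : 'rV[R]_d).
Local Notation cnt := (@counting nat R).

(** Like [rapid], but with a single rate [K] for all derivatives, which is what is left after
    summing over infinitely many centres. *)
Definition decaying (theta : R) (u : 'rV[R]_d -> R) :=
  exists (D : seq 'I_d -> 'rV[R]_d -> R) (K : R), [/\ 0 < K, D [::] = u,
    forall w i x, is_derive x (basisv i) (D w) (D (i :: w) x) &
    forall w, exists2 C, 0 <= C & forall x, `|D w x| <= C * expR (- (K * wnorm theta x))].

Variable theta : R.
Hypothesis theta01 : 0 < theta < 1.
Let th01 : 0 < theta <= 1. Proof. by case/andP: theta01 => -> /ltW. Qed.
Let th0 : 0 < theta. Proof. by case/andP: theta01. Qed.

(** Half of [wnorm x <= wnorm (x - z) + wnorm z]; dilation by [e^-1 >= 1] only increases the norm of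
    [x - z]. *)
Lemma shifted_decay (e : R) x z : 0 < e <= 1 ->
  expR (- (1 * wnorm theta (e^-1 *: (x - z)))) <=
  expR (wnorm theta z / 2) * expR (- (2^-1 * wnorm theta x)).
Proof.
move=> /andP[e0 e1]; rewrite -expRD ler_expR mul1r.
have h1 : wnorm theta (x - z) <= wnorm theta (e^-1 *: (x - z)).
  by apply: wnorm_scale => //; rewrite invf_ge1.
have h2 := wnormD (x - z) z th01; rewrite subrK in h2.
have := wnorm_ge0 theta (x - z); lra.
Qed.

Variables (u : 'rV[R]_d -> R) (A e : nat -> R) (z : nat -> 'rV[R]_d).
Hypothesis e01 : forall n, 0 < e n <= 1.
Hypothesis A_small : forall k : nat, exists2 C, 0 <= C & forall n,
  `|A n| * (e n)^-1 ^+ k * expR (wnorm theta (z n) / 2) <= C * wt n.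

(** [A_small] is assumed for every [k] because each derivative brings out a factor [(e n)^-1]; the
    exponential in it pays for the translation by [z n]. *)
Lemma superposition_bound k (v : 'rV[R]_d -> R) C :
  0 <= C -> (forall x, `|v x| <= C * expR (- (1 * wnorm theta x))) ->
  exists2 C', 0 <= C' & forall n x,
    `|A n * (e n)^-1 ^+ k * v ((e n)^-1 *: (x - z n))| <= C' * expR (- (2^-1 * wnorm theta x)) * wt n.
Proof.
move=> C0 vC; have [C1 C10 hC1] := A_small k.
exists (C1 * C); first by rewrite mulr_ge0.
move=> n x; rewrite !normrM; have [e0 e1] := andP (e01 n).
rewrite (ger0_norm (exprn_ge0 _ _)); last by rewrite invr_ge0 ltW.
set a := `|A n| * _; have a0 : 0 <= a by rewrite mulr_ge0// exprn_ge0// invr_ge0 ltW.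
have h := le_trans (vC ((e n)^-1 *: (x - z n))) (ler_wpM2l C0 (shifted_decay x (z n) (e01 n))).
rewrite (le_trans (ler_wpM2l a0 h))// [leLHS](_ : _ =
  (a * expR (wnorm theta (z n) / 2)) * (C * expR (- (2^-1 * wnorm theta x)))); last by ring.
rewrite [leRHS](_ : _ = (C1 * wt n) * (C * expR (- (2^-1 * wnorm theta x)))); last by ring.
by rewrite ler_wpM2r ?hC1// mulr_ge0 ?expR_ge0.
Qed.

Lemma is_derive_scaled (v v' : 'rV[R]_d -> R) i (h c : R) x z0 :
  (forall y, is_derive y (basisv i) v (v' y)) ->
  is_derive h 1 (fun t => v (c *: (t *: basisv i + x - z0))) (v' (c *: (h *: basisv i + x - z0)) * c).
Proof.
move=> dv; pose y0 := c *: (h *: basisv i + x - z0).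
have dl : is_derive (h : R) 1 (fun t : R => c * (t - h)) c.
  by apply: is_derive_eq; rewrite subr0 scaler1.
have g0 := line_is_derive (dv y0).
have g1 : is_derive ((fun t : R => c * (t - h)) h) 1 (fun t : R => v (t *: basisv i + y0)) (v' y0).
  by rewrite subrr mulr0.
have := @is_derive1_comp _ (fun t : R => v (t *: basisv i + y0)) (fun t : R => c * (t - h)) h _ _ g1 dl; congr (is_derive _ _ _ _).
apply/funext => t /=; congr v; rewrite /y0 -scalerA -scalerDr; congr (_ *: _).
by rewrite scalerBl !addrA subrK.
Qed.

Lemma superposition_decaying : rapid theta u ->
  decaying theta (fun x => nsum (fun n => A n * u ((e n)^-1 *: (x - z n)))).
Proof.
move=> [D [D0 dD bD]].
pose f w n x := A n * (e n)^-1 ^+ size w * D w ((e n)^-1 *: (x - z n)).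
have fb w : exists2 C', 0 <= C' & forall n x,
    `|f w n x| <= C' * expR (- (2^-1 * wnorm theta x)) * wt n.
  have [C C0 hC] := bD w 1; exact: superposition_bound hC.
have fb1 w : exists2 C', 0 <= C' & forall n x, `|f w n x| <= C' * wt n.
  have [C C0 hC] := fb w; exists C => // n x; rewrite (le_trans (hC n x))//.
  rewrite ler_wpM2r ?wt_ge0// ler_piMr// -[leRHS]expR0 ler_expR oppr_le0.
  by rewrite mulr_ge0// ?invr_ge0// wnorm_ge0.
exists (fun w x => nsum (fun n => f w n x)), 2^-1; split.
- by rewrite invr_gt0.
- apply/funext => x; apply: eq_nsum => n; rewrite /f expr0 mulr1 D0//.
- move=> w i x; apply: is_derive_line.
  have [C C0 hC] := fb1 w; have [C' C'0 hC'] := fb1 (i :: w).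
  have I0 : `](-1), 1[%classic (0 : R) by rewrite /= in_itv /=; lra.
  have := @is_derive_under_int R _ nat cnt (fun (h : R) n => f w n (h *: basisv i + x))
    (fun (h : R) n => f (i :: w) n (h *: basisv i + x)) (fun n => C' * wt n) 0 (-1) 1 I0 _ _ _ _.
  rewrite scale0r add0r; apply.
  + by move=> h _; exact: (integrable_nat (fun n => hC n _)).
  + move=> h n _; have dv y : is_derive y (basisv i) (D w) (D (i :: w) y) by exact: dD.
    have := is_deriveZ (A n * (e n)^-1 ^+ size w) (is_derive_scaled h (e n)^-1 x (z n) dv).
    by congr (is_derive _ _ _ _); rewrite /f /= exprS /GRing.scale /=; ring.
  + exact: (integrableZl measurableT _ integrable_wt.1).
  + by move=> h n _; exact: hC'.
- move=> w; have [C C0 hC] := fb w; exists C => // x.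
  by apply: nsum_bound => n; exact: hC.
Qed.

(** The bound on the terms belongs to the conclusion because it is what [nsumZ] requires to take a
    factor out of the series. *)
Lemma superposition_integral (g : d.-tuple (measurableTypeR R) -> R) : rapid theta u ->
  (forall n, measurable_fun setT
    (fun t : d.-tuple (measurableTypeR R) => u ((e n)^-1 *: (rowt t - z n)))) ->
  measurable_fun setT g -> (forall t, `|g t| <= 1) ->
  exists2 C, 0 <= C &
  (forall n, `|A n * \int[lebesgue_tuple d]_t (u ((e n)^-1 *: (rowt t - z n)) * g t)| <= C * wt n) /\
  \int[lebesgue_tuple d]_t (nsum (fun n => A n * u ((e n)^-1 *: (rowt t - z n))) * g t) =
  nsum (fun n => A n * \int[lebesgue_tuple d]_t (u ((e n)^-1 *: (rowt t - z n)) * g t)).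
Proof.
move=> [D [D0 _ bD]] mu mg g1.
have [C0 C00 hC0] := bD [::] 1; rewrite D0 in hC0.
have [C C_ge0 hC] := superposition_bound 0 C00 hC0.
pose f (t : d.-tuple (measurableTypeR R)) n := A n * (u ((e n)^-1 *: (rowt t - z n)) * g t).
pose G (t : d.-tuple (measurableTypeR R)) := C * expR (- (2^-1 * wnorm theta (rowt t))).
have fE n t : A n * u ((e n)^-1 *: (rowt t - z n)) * g t = f t n by rewrite /f mulrA.
have b0 t n : `|A n * u ((e n)^-1 *: (rowt t - z n))| <= G t * wt n.
  by have := hC n (rowt t); rewrite expr0 mulr1.
have fb t n : `|f t n| <= G t * wt n.
  by rewrite -fE normrM (le_trans _ (b0 t n))// ler_piMr.
have iG : (lebesgue_tuple d).-integrable setT (EFin \o G).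
  have e0 : 0 < 2^-1 :> R by rewrite invr_gt0.
  exact: (integrableZl measurableT C (integrable_expR_wnorm e0 th0)).
have iu n : (lebesgue_tuple d).-integrable setT (EFin \o (fun t => u ((e n)^-1 *: (rowt t - z n)) * g t)).
  have [en0 _] := andP (e01 n).
  exact: (@integrable_decay _ _ theta C0 (e n) (z n)).
exists (\int[lebesgue_tuple d]_t G t).
  by apply: Rintegral_ge0 => t _; rewrite mulr_ge0 ?expR_ge0.
split.
  move=> n; rewrite -RintegralZl//.
  have ifn : (lebesgue_tuple d).-integrable setT (EFin \o (f^~ n)).
    exact: (integrableZl measurableT (A n) (iu n)).
  rewrite (le_trans (le_normr_Rintegral measurableT ifn))// mulrC -RintegralZl//.
  apply: le_Rintegral => //.
  - exact: (integrable_norm ifn).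
  - exact: (integrableZl measurableT (wt n) iG).
  - by move=> t _; rewrite mulrC.
transitivity (\int[lebesgue_tuple d]_t nsum (f t)).
  apply: eq_Rintegral => t _; rewrite mulrC -(nsumZ _ (b0 t)).
  by apply: eq_nsum => n; rewrite mulrC fE.
rewrite (_ : (fun n => _) = (fun n => \int[lebesgue_tuple d]_t f t n)); last first.
  by apply/funext => n; rewrite RintegralZl.
refine (@Rintegral_swap R _ _ _ nat (lebesgue_tuple d) cnt f G wt _ iG integrable_wt.1 fb).
apply: (measurableT_comp (f := fun z : nat * _ => f z.2 z.1) _ (@measurable_swap _ _ _ _)).
apply: (@measurable_nat_prod R _ (d.-tuple (measurableTypeR R)) (fun n t => f t n)) => n.
by apply: measurable_funM => //; apply: measurable_funM.
Qed.

End superposition.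

(** * Injective numbering of lists of integers, with polynomial growth *)

Section pairing.

(** Since [(a + b) ^ 2 + a < (a + b + 1) ^ 2], the sum [a + b] is the integer square root, which
    gives injectivity; the growth is only quadratic. *)
Definition pairn (a b : nat) := ((a + b) ^ 2 + a)%N.

Lemma pairn_inj a b a' b' : pairn a b = pairn a' b' -> a = a' /\ b = b'.
Proof.
rewrite /pairn => h; have s : (a + b = a' + b')%N by nia.
by rewrite s in h; lia.
Qed.

Lemma double_bit_inj (a a' : nat) (b b' : bool) :
  (2 * a + b = 2 * a' + b')%N -> a = a' /\ b = b'.
Proof. by case: b; case: b' => h; split => //; lia. Qed.

(** A digit consists of the integer part of [|a| m] and a sign bit, so equal digits put [a] and [b]
    in the same cell of width [1 / m]. *)
Lemma same_digit (R : realType) (a b m : R) : 0 < m ->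
  (2 * Num.truncn (`|a| * m) + (a < 0)%R)%N = (2 * Num.truncn (`|b| * m) + (b < 0)%R)%N ->
  `|a - b| <= m^-1.
Proof.
move=> m0 /double_bit_inj[h1 h2].
have itv (c : R) : (Num.truncn (`|c| * m))%:R <= `|c| * m < (Num.truncn (`|c| * m)).+1%:R.
  by rewrite truncn_itv// mulr_ge0// ltW.
have /andP[b1 b2] := itv a; have /andP[b3 b4] := itv b.
rewrite h1 in b1 b2; rewrite -natr1 in b2 b4.
rewrite -[leRHS]mul1r ler_pdivlMr//.
have -> : `|a - b| = `| `|a| - `|b| |.
  move: h2; case: (ltP a) => ha; case: (ltP b) => hb // _.
    by rewrite (ltr0_norm ha) (ltr0_norm hb) -opprD normrN.
  by rewrite (ger0_norm ha) (ger0_norm hb).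
rewrite -[X in _ * X](ger0_norm (ltW m0)) -normrM mulrBl ler_norml; lra.
Qed.

Definition coden (l : seq nat) := foldr pairn 0%N l.

Lemma coden_inj l l' : size l = size l' -> coden l = coden l' -> l = l'.
Proof.
elim: l l' => [|a l IH] [|a' l'] //= [sl] /pairn_inj[-> h].
by rewrite (IH l').
Qed.

Lemma coden_bound (R : realType) n : exists k, forall (X : R) l, 2 <= X -> size l = n ->
  all (fun a => a.+1%:R <= X) l -> (coden l).+1%:R <= X ^+ k.
Proof.
elim: n => [|n [k IH]]; first by exists 0%N => X [|//] _ _ _; rewrite expr0.
exists (2 * k.+1 + 2)%N => X [//|a l] X2 /= [sl] /andP[aX lX].
have {IH} h := IH X l X2 sl lX; rewrite /pairn.
have X1 : 1 <= X by lra.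
have Xk : X ^+ k <= X ^+ k.+1 by rewrite ler_weXn2l.
have XX : X <= X ^+ k.+1 by rewrite -[leLHS]expr1 ler_weXn2l.
apply: (@le_trans _ _ ((2 * X ^+ k.+1) ^+ 2)).
  apply: (@le_trans _ _ ((a + coden l).+1%:R ^+ 2)); first by rewrite -natrX ler_nat; nia.
  rewrite lerXn2r ?nnegrE ?mulr_ge0 ?exprn_ge0 ?(le_trans ler01 X1)//.
  rewrite -addSn natrD mulr_natl mulr2n lerD// ?(le_trans aX)//.
  by rewrite (le_trans _ Xk)// (le_trans _ h)// ler_nat.
rewrite exprMn -exprM [leRHS]exprD [(k.+1 * 2)%N]mulnC mulrC ler_wpM2l ?exprn_ge0 ?(le_trans ler01 X1)//.
by rewrite lerXn2r ?nnegrE ?(le_trans ler01 X1).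
Qed.

End pairing.

(** * Numbering of separated points with exponential growth in the power [rho] of the norm *)

Section counting_code.
Context {R : realType} {d : nat}.
Implicit Types (x y z : 'rV[R]_d).

Lemma sqr_sumr_ge (I : Type) (s : seq I) (f : I -> R) : (forall i, 0 <= f i) ->
  \sum_(i <- s) f i ^+ 2 <= (\sum_(i <- s) f i) ^+ 2.
Proof.
move=> f0; elim: s => [|i s IH]; first by rewrite !big_nil expr0n.
rewrite !big_cons sqrrD -addrA lerD2l (le_trans IH)// lerDr mulrn_wge0// mulr_ge0//.
by rewrite sumr_ge0.
Qed.

Lemma enorm_le_sum x : enorm x <= \sum_(i < d) `|x ord0 i|.
Proof.
rewrite /enorm -[leRHS]ger0_norm ?sumr_ge0// -sqrtr_sqr ler_wsqrtr// /dotv.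
by rewrite (le_trans _ (sqr_sumr_ge _ _))//; apply: ler_sum => i _; rewrite real_normK ?num_real.
Qed.

Lemma coord_le_enorm x i : `|x ord0 i| <= enorm x.
Proof.
rewrite /enorm -sqrtr_sqr ler_wsqrtr// /dotv (bigD1 i)//= -expr2 lerDl.
by apply: sumr_ge0 => j _; rewrite -expr2 sqr_ge0.
Qed.

Lemma enorm_powR r x : 0 < r <= 1 -> enorm x `^ r <= wnorm r x.
Proof.
move=> r01; have [r0 r1] := andP r01.
rewrite (@le_trans _ _ ((\sum_(i < d) `|x ord0 i|) `^ r))//.
  by rewrite ge0_ler_powR ?nnegrE ?sumr_ge0 ?sqrtr_ge0 ?enorm_le_sum// ltW.
have h (s : seq 'I_d) : (\sum_(i <- s) `|x ord0 i|) `^ r <= \sum_(i <- s) `|x ord0 i| `^ r.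
  elim: s => [|i s IH]; first by rewrite !big_nil powR0// gt_eqF.
  rewrite !big_cons (le_trans _ (lerD (lexx _) IH))//.
  by apply: (powR_subadd r01); rewrite ?sumr_ge0.
exact: h.
Qed.

Definition separated (rho A B : R) (L : set 'rV[R]_d) :=
  forall x y, L x -> L y -> y <> x -> A * expR (- (B * wnorm rho x)) <= enorm (x - y).

Lemma coord_powR_le rho x i : 0 < rho -> `|x ord0 i| `^ rho <= wnorm rho x.
Proof.
by move=> r0; rewrite /wnorm (bigD1 i)//= lerDl sumr_ge0// => j _; exact: powR_ge0.
Qed.

(** Coordinates are rounded at resolution [1 / m x], with [m x > d exp (B * wnorm rho x) / A], fine
    enough to tell the points of [L] apart. The number [m x] is itself the first digit, because two
    points can be compared only at a common resolution. *)
Lemma separated_code rho A B L : (0 < d)%N -> 0 < rho -> 0 < A -> 0 < B -> separated rho A B L ->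
  exists code : 'rV[R]_d -> nat, {in L &, injective code} /\
  exists C D, [/\ 0 < C, 0 < D & forall x, (code x).+1%:R <= C * expR (D * wnorm rho x)].
Proof.
move=> d0 r0 A0 B0 sL.
pose v x := d%:R * expR (B * wnorm rho x) / A : R.
have v0 x : 0 <= v x by rewrite divr_ge0 ?mulr_ge0 ?expR_ge0// ltW.
pose m x := (Num.truncn (v x)).+1.
have mv x : v x < (m x)%:R by rewrite /m truncnS_gt.
have mv' x : (m x)%:R <= v x + 1 by rewrite /m -natr1 lerD2r truncn_le.
pose dg x (i : 'I_d) := (2 * Num.truncn (`|x ord0 i| * (m x)%:R)%R + (x ord0 i < 0)%R)%N.
pose digits x := m x :: [seq dg x i | i <- enum 'I_d].
have [k hk] := coden_bound R d.+1.
have [C1 C10 hC1] := @expR_powR_dominates R 1 1 rho ltr01 r0.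
have dA : 0 < d%:R / A by rewrite divr_gt0// ltr0n.
pose C := 2 * C1 * (d%:R / A + 1) + 2 + d%:R / A.
have C2 : 2 <= C by rewrite /C -addrA addrCA lerDl addr_ge0 ?ltW// !mulr_gt0// addr_gt0.
exists (coden \o digits); split; last first.
  exists (C ^+ k), ((B + 1) * k.+1%:R); split.
  - by rewrite exprn_gt0// (lt_le_trans _ C2).
  - by rewrite mulr_gt0// addr_gt0.
  - move=> x; have N0 := wnorm_ge0 rho x; pose E := expR ((B + 1) * wnorm rho x).
    have E1 : 1 <= E by rewrite -[leLHS]expR0 ler_expR mulr_ge0// addr_ge0// ltW.
    have EB : expR (B * wnorm rho x) <= E by rewrite ler_expR ler_wpM2r// lerDl.
    have EE : E = expR (wnorm rho x) * expR (B * wnorm rho x).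
      by rewrite -expRD; congr expR; ring.
    have mE : (m x)%:R <= (d%:R / A + 1) * expR (B * wnorm rho x).
      rewrite (le_trans (mv' x))// mulrDl mul1r /v mulrAC lerD2l.
      by rewrite -[leLHS]expR0 ler_expR mulr_ge0// ltW.
    apply: (@le_trans _ _ ((C * E) ^+ k)); last first.
      rewrite exprMn ler_wpM2l ?exprn_ge0 ?(le_trans _ C2)// -expRM_natl ler_expR.
      rewrite mulrC -mulrA [leRHS]mulrAC -mulrA ler_wpM2l ?addr_ge0 ?(ltW B0)//.
      by rewrite ler_wpM2l// ler_nat.
    apply: hk => [||].
    + by rewrite (le_trans C2)// ler_peMr// (le_trans _ C2).
    + by rewrite /= size_map size_enum_ord.
    + rewrite /= -natr1; apply/andP; split.
        rewrite (@le_trans _ _ ((d%:R / A + 1) * E + E))//.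
          rewrite lerD// (le_trans mE)// ler_wpM2l// addr_ge0// ltW//.
        rewrite -[X in _ + X]mul1r -mulrDl ler_wpM2r ?expR_ge0// /C.
        have : 0 <= 2 * C1 * (d%:R / A + 1) by rewrite !mulr_ge0 ?addr_ge0// ltW.
        lra.
      rewrite all_map; apply/allP => i _ /=.
      have xi : `|x ord0 i| <= C1 * expR (wnorm rho x).
        have := hC1 `|x ord0 i| (normr_ge0 _); rewrite expr1 mul1r => h.
        by rewrite (le_trans h)// ler_wpM2l ?(ltW C10)// ler_expR coord_powR_le.
      have xm : `|x ord0 i| * (m x)%:R <= C1 * (d%:R / A + 1) * E.
        rewrite EE [leRHS](_ : _ = (C1 * expR (wnorm rho x)) *
          ((d%:R / A + 1) * expR (B * wnorm rho x))); last by ring.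
        by apply: ler_pM.
      apply: (@le_trans _ _ (2 * (`|x ord0 i| * (m x)%:R) + 2)).
        rewrite -addnS natrD natrM lerD//.
          by rewrite ler_wpM2l// truncn_le// mulr_ge0.
        by rewrite ler_nat ltnS leq_b1.
      rewrite (@le_trans _ _ (2 * (C1 * (d%:R / A + 1) * E) + 2 * E))//.
        by rewrite lerD ?ler_wpM2l// ler_peMr.
      rewrite /C; have : 0 <= d%:R / A * E by rewrite mulr_ge0 ?ltW// expR_gt0.
      lra.
move=> x y; rewrite !inE => Lx Ly h.
have sz : size (digits x) = size (digits y) by rewrite /= !size_map.
have Ed := coden_inj sz h.
have mxy : m y = m x := esym (congr1 (head 0%N) Ed).
have /eq_in_map dxy := congr1 behead Ed.
clear h sz Ed hk.
apply/eqP; apply/negP => /negP/eqP xy.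
have := sL x y Lx Ly (fun h => xy (esym h)); apply/negP; rewrite -ltNge.
have m0 : 0 < (m x)%:R :> R by rewrite ltr0n.
have c i : `|(x - y) ord0 i| <= (m x)%:R^-1.
  have := dxy i (mem_enum _ _); rewrite /dg mxy => hd.
  by rewrite !mxE; exact: same_digit hd.
clear dxy mxy xy.
(* Equal digits leave a distance of at most [d / m x], below the separation by the choice of
   [m x]. *)
apply: (@le_lt_trans _ _ (d%:R * (m x)%:R^-1)).
  rewrite (le_trans (enorm_le_sum _))// -[X in X%:R * _]card_ord mulr_natl -sumr_const.
  by apply: ler_sum => i _; exact: c.
rewrite ltr_pdivrMr// -ltr_pdivrMl; last by rewrite mulr_gt0// expR_gt0.
have := mv x; rewrite /v expRN; congr (_ < _).
by rewrite invrM ?unitfE ?gt_eqF ?invr_gt0 ?expR_gt0// invrK; ring.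
Qed.

End counting_code.

(** * Scales, amplitudes and weights at the nodes *)

Section nodes.
Context {R : realType} {d : nat}.
Implicit Types (x y z : 'rV[R]_d).
Variables (theta rho s : R) (P Q : 'rV[R]_d -> R).
Hypotheses (rt : 0 < rho < theta) (t1 : theta < 1) (s0 : 0 < s).
Hypotheses (P0 : P 0 != 0) (Q0 : Q 0 != 0) (rP : rapid theta P) (rQ : rapid theta Q).
Local Notation N := (wnorm theta).
Local Notation n := (wnorm rho).

Let rho0 : 0 < rho. Proof. by case/andP: rt. Qed.
Let th0 : 0 < theta. Proof. by apply: lt_trans rho0 _; case/andP: rt. Qed.
Let th01 : 0 < theta <= 1. Proof. by rewrite th0 ltW. Qed.
Let rho01 : 0 < rho <= 1.
Proof. by rewrite rho0 ltW// (lt_trans _ t1)//; case/andP: rt. Qed.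

Lemma enorm_le_expR : exists2 C, 0 <= C & forall y, enorm y <= C * expR (N y).
Proof.
have [C C0 hC] := @expR_powR_dominates R 1 1 theta ltr01 th0.
exists (\sum_(i < d) C); first by rewrite sumr_ge0// => i _; exact: ltW.
move=> y; rewrite (le_trans (enorm_le_sum y))// mulr_suml; apply: ler_sum => i _.
have := hC `|y ord0 i| (normr_ge0 _); rewrite expr1 mul1r => h.
by rewrite (le_trans h)// ler_wpM2l ?(ltW C0)// ler_expR coord_powR_le.
Qed.

(** The rate [3] is spent in equal shares on [1 + enorm y], on [N y], and on [Pc * n y], which [N y]
    dominates up to a constant because [rho < theta]. *)
Lemma rapid_weighted u Pc : rapid theta u -> exists2 S, 0 <= S & forall y,
  `|u y| * (1 + enorm y) * expR (N y + Pc * n y) <= S.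
Proof.
move=> [D [D0 _ bD]]; have [C C0 hC] := bD [::] 3; rewrite D0 in hC.
have [C1 C10 hC1] := enorm_le_expR.
have [C2 C20 hC2] := @wnorm_dominates R d Pc 1 rho theta ltr01 rt.
exists (C * (1 + C1) * expR C2); first by rewrite !mulr_ge0 ?addr_ge0 ?expR_ge0.
move=> y; have N0 := wnorm_ge0 theta y.
have e1 : 1 + enorm y <= (1 + C1) * expR (N y).
  by rewrite mulrDl mul1r lerD ?hC1// -[leLHS]expR0 ler_expR.
have e2 : expR (N y + Pc * n y) <= expR C2 * expR (2 * N y).
  by rewrite -expRD ler_expR; have := hC2 y; lra.
have en0 : 0 <= enorm y by rewrite sqrtr_ge0.
have h := ler_pM (mulr_ge0 (normr_ge0 _) (addr_ge0 ler01 en0)) (expR_ge0 _)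
  (ler_pM (normr_ge0 _) (addr_ge0 ler01 en0) (hC y) e1) e2.
rewrite (le_trans h)// [leLHS](_ : _ = C * (1 + C1) * expR C2 *
  (expR (- (3 * N y)) * expR (N y) * expR (2 * N y))); last by ring.
by rewrite -!expRD (_ : - (3 * N y) + N y + 2 * N y = 0) ?expR0 ?mulr1//; ring.
Qed.

Lemma enormZ (c : R) y : 0 <= c -> enorm (c *: y) = c * enorm y.
Proof.
move=> c0; rewrite /enorm (_ : dotv _ _ = c ^+ 2 * dotv y y).
  by rewrite sqrtrM ?sqr_ge0// sqrtr_sqr ger0_norm.
by rewrite /dotv mulr_sumr; apply: eq_bigr => i _; rewrite !mxE; ring.
Qed.

Lemma enormN y : enorm (- y) = enorm y.
Proof. by rewrite /enorm /dotv; congr Num.sqrt; apply: eq_bigr => i _; rewrite !mxE mulrNN. Qed.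

(** Carries the weight [expR (- N z + c * n z)] from the centre [z] to the point [x] by the triangle
    inequalities for [N] and [n]; the loss depends on [y] only and is paid by the decay of [u]. [X]
    is a gain: [1], or what the separation of the nodes provides. *)
Lemma transfer (u : 'rV[R]_d -> R) Pc S : 0 <= Pc ->
  (forall y, `|u y| * (1 + enorm y) * expR (N y + Pc * n y) <= S) ->
  forall (e c X : R) x z, 0 < e <= 1 -> 0 <= c <= Pc -> X <= 1 + e^-1 * enorm (x - z) ->
  `|u (e^-1 *: (x - z))| * X * expR (- N z + c * n z) <= S * expR (- N x + c * n x).
Proof.
move=> Pc0 hS e c X x z /andP[e0 e1] /andP[c0 cP] hX; set y := e^-1 *: (x - z).
have ei : 1 <= e^-1 by rewrite invf_ge1.
have ye : e^-1 * enorm (x - z) = enorm y by rewrite enormZ// (le_trans ler01).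
have hN : N x <= N z + N y.
  have := wnormD (x - z) z th01; rewrite subrK => /le_trans; apply.
  by rewrite addrC lerD2l wnorm_scale.
have hn : n z <= n x + n y.
  have := wnormD (z - x) x rho01; rewrite subrK => /le_trans; apply.
  by rewrite addrC lerD2l -opprB wnormN wnorm_scale.
have ny := wnorm_ge0 rho y.
rewrite (@le_trans _ _ (`|u y| * (1 + enorm y) * expR (N y + Pc * n y) * expR (- N x + c * n x)))//.
  rewrite -!mulrA ler_wpM2l// -expRD; apply: (@le_trans _ _ ((1 + enorm y) * expR (- N z + c * n z))).
    by rewrite ler_wpM2r ?expR_ge0// -ye.
  rewrite ler_wpM2l ?addr_ge0 ?sqrtr_ge0// ler_expR.
  have : c * n z <= c * (n x + n y) by rewrite ler_wpM2l.
  have : c * n y <= Pc * n y by rewrite ler_wpM2r.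
  lra.
by rewrite ler_wpM2r ?expR_ge0.
Qed.

Lemma absorb (a g E E' W c : R) : 0 <= E' -> 0 < g ->
  a * g * E <= W * E' -> W <= c * g -> a * E <= c * E'.
Proof.
move=> E0 g0 h Wc; rewrite -(ler_pM2r g0) mulrAC (le_trans h)// mulrAC.
by rewrite ler_wpM2r.
Qed.

Lemma le_sum5 (a b c e f : R) : 0 < a -> 0 < b -> 0 < c -> 0 < e -> 0 < f ->
  let S := a + b + c + e + f in 0 <= S /\ [/\ a <= S, b <= S, c <= S, e <= S & f <= S].
Proof. by move=> a0 b0 c0 e0 f0; split; [|split]; lra. Qed.

(** The boolean is [false] at points where [f] is prescribed and [true] at points where
    [(- Delta) ^ s f] is. *)
Definition node := (bool * 'rV[R]_d)%type.

(** Contribution of the block at [p] to the datum at [q]; the fractional Laplacian of a block of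
    scale [eps p] carries the factor [eps p ^ (- 2 s)]. *)
Definition entry (mm eps : node -> R) (q p : node) : R :=
  if q.1 then mm p / eps p `^ (2 * s) * Q ((eps p)^-1 *: (q.2 - p.2))
  else mm p * P ((eps p)^-1 *: (q.2 - p.2)).

(* In the norm weighted by [om] the off-diagonal entries are small: those between
   nodes of the same kind because separated nodes are far apart at scale [eps],
   a first-kind block at a second-kind node because of the factor
   [expR (Pc * wnorm rho z)] in the weight of the latter, and a second-kind block
   at a first-kind node because its amplitude [mm] is tiny. *)
Lemma node_scales (A B D dl : R) (S : node -> Prop) : 0 < A -> 0 < B -> 0 < D -> 0 < dl ->
  (forall b, separated rho A B [set z | S (b, z)]) ->
  exists mm eps om : node -> R,
  [/\ forall p, 0 < eps p <= 1, forall p, 0 < om p, forall z, om (false, z) = expR (- N z),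
      forall p, entry mm eps p p = 1 &
      (forall p q, S p -> S q -> p <> q ->
        `|entry mm eps q p| * om p <= dl * expR (- (D * n p.2)) * om q) /\
      exists2 C, 0 < C & exists2 K, 0 <= K & forall p,
        [/\ (eps p)^-1 <= C * expR (K * n p.2),
            `|mm p| <= C * expR (K * n p.2),
            (eps p `^ (2 * s))^-1 <= C * expR (K * n p.2) &
            om p <= C * expR (K * n p.2) * expR (- N p.2)]].
Proof.
move=> A0 B0 D0 dl0 sep.
have nP0 : 0 < `|P 0| by rewrite normr_gt0.
have nQ0 : 0 < `|Q 0| by rewrite normr_gt0.
have s20 : 0 < 2 * s by rewrite mulr_gt0.
(* At scale [exp (- K1 n)] a separation [exp (- B n)] becomes [exp (D n)]. [Pc] outweighs the factor
   [exp (2 s K1 n)] coming from [eps ^ (- 2 s)], and [K2] is defined by [2 s K2 = 2 s K1 + Pc + D].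
   In each case a factor [exp (- D n)] is left. *)
pose K1 := B + D; pose Pc := 2 * s * K1 + D.
have K10 : 0 < K1 by rewrite addr_gt0.
have Pc0 : 0 < Pc by rewrite addr_gt0// mulr_gt0.
pose K2 := K1 + (Pc + D) / (2 * s).
have K20 : 0 < K2 by rewrite addr_gt0// divr_gt0// addr_gt0.
have [SP SP0 hSP] := rapid_weighted Pc rP.
have [SQ SQ0 hSQ] := rapid_weighted Pc rQ.
pose W := SP + SQ + 1.
have W0 : 0 < W by rewrite ltr_wpDl// addr_ge0.
have {}hSP y : `|P y| * (1 + enorm y) * expR (N y + Pc * n y) <= W.
  by rewrite (le_trans (hSP y))// /W; lra.
have {}hSQ y : `|Q y| * (1 + enorm y) * expR (N y + Pc * n y) <= W.
  by rewrite (le_trans (hSQ y))// /W; lra.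
(* The order [k1], [Qc], [k2] avoids circularity: [Qc] makes the blocks of the first kind small at
   nodes of the second kind for the given [k1], and [k2] then compensates [Qc] in the opposite
   entries. *)
pose k1 := Num.min 1 (dl * A * `|P 0| / W).
have k10 : 0 < k1 by rewrite lt_min ltr01 divr_gt0// !mulr_gt0.
pose Qc := W / (k1 `^ (2 * s) * `|P 0| * dl).
have k1s : 0 < k1 `^ (2 * s) by rewrite powR_gt0.
have Qc0 : 0 < Qc by rewrite divr_gt0// !mulr_gt0.
pose k2 := Num.min 1 (Num.min (dl * A * `|Q 0| / W) ((dl * `|Q 0| / (Qc * W)) `^ (2 * s)^-1)).
have k20 : 0 < k2.
  have h1 : 0 < dl * A * `|Q 0| / W by apply: divr_gt0 => //; rewrite !mulr_gt0.
  have h2 : 0 < (dl * `|Q 0| / (Qc * W)) `^ (2 * s)^-1.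
    by apply: powR_gt0; apply: divr_gt0; apply: mulr_gt0.
  by rewrite !lt_min ltr01 h1 h2.
have k2s : k2 `^ (2 * s) <= dl * `|Q 0| / (Qc * W).
  have h0 : 0 <= dl * `|Q 0| / (Qc * W) by apply: ltW; apply: divr_gt0; apply: mulr_gt0.
  apply: (@le_trans _ _ (((dl * `|Q 0| / (Qc * W)) `^ (2 * s)^-1) `^ (2 * s))).
    rewrite ge0_ler_powR ?nnegrE ?powR_ge0 ?(ltW s20) ?(ltW k20)//.
    by rewrite /k2 !ge_min lexx !orbT.
  by rewrite -powRrM mulVf ?gt_eqF// powRr1.
pose eps (p : node) := if p.1 then k2 * expR (- (K2 * n p.2)) else k1 * expR (- (K1 * n p.2)).
(* These amplitudes make the diagonal entries equal to [1]. *)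
pose mm (p : node) := if p.1 then eps p `^ (2 * s) / Q 0 else (P 0)^-1.
pose om (p : node) := if p.1 then Qc * expR (- N p.2 + Pc * n p.2) else expR (- N p.2).
have eE k K x : 0 < k -> (k * expR (- (K * n x))) `^ (2 * s) = k `^ (2 * s) * expR (- (2 * s * K * n x)).
  move=> k0; rewrite powRM ?expR_ge0 ?(ltW k0)//; congr (_ * _).
  by rewrite -expRM; congr expR; ring.
have TrP := transfer (ltW Pc0) hSP; have TrQ := transfer (ltW Pc0) hSQ.
have c0P : (0 : R) <= 0 <= Pc by apply/andP; split; rewrite ?lexx ?(ltW Pc0).
have cPP : 0 <= Pc <= Pc by rewrite lexx (ltW Pc0).
have eps01 p : 0 < eps p <= 1.
  rewrite /eps; case: p => [[] x] /=; rewrite mulr_gt0 ?expR_gt0//= mulr_ile1 ?expR_ge0 ?(ltW k10) ?(ltW k20)//.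
  - by rewrite /k2 ge_min lexx.
  - by rewrite -[leRHS]expR0 ler_expR oppr_le0 mulr_ge0 ?wnorm_ge0// ltW.
  - by rewrite /k1 ge_min lexx.
  - by rewrite -[leRHS]expR0 ler_expR oppr_le0 mulr_ge0 ?wnorm_ge0// ltW.
have epss p : 0 < eps p `^ (2 * s) by rewrite powR_gt0//; case/andP: (eps01 p).
exists mm, eps, om; split => //.
- move=> [[] x]; rewrite /om /=; last exact: expR_gt0.
  by apply: mulr_gt0 => //; exact: expR_gt0.
- move=> [[] x]; rewrite /entry /mm /= subrr scaler0.
    have := epss (true, x); move: (eps _ `^ _) => E E0; field.
    by rewrite Q0 gt_eqF.
  by rewrite mulVf.
split.
  have sepX b x z k K : S (b, z) -> S (b, x) -> x <> z -> 0 < k -> B + D <= K ->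
      A / k * expR (D * n z) <= 1 + (k * expR (- (K * n z)))^-1 * enorm (x - z).
    move=> Sz Sx xz k0 BK; have := sep b z x Sz Sx xz; rewrite -enormN opprB => h.
    have kE : 0 <= (k * expR (- (K * n z)))^-1 by rewrite invr_ge0 mulr_ge0 ?expR_ge0// ltW.
    apply: (@le_trans _ _ ((k * expR (- (K * n z)))^-1 * enorm (x - z))); last by rewrite lerDr.
    rewrite (le_trans _ (ler_wpM2l kE h))// invfM -expRN opprK.
    rewrite [leRHS](_ : _ = A / k * (expR (K * n z) * expR (- (B * n z)))); last by ring.
    rewrite ler_wpM2l ?divr_ge0 ?(ltW A0) ?(ltW k0)// -expRD ler_expR.
    by have := wnorm_ge0 rho z; nra.
  have gX k z : 0 < k -> 0 < A / k * expR (D * n z) by move=> k0; rewrite mulr_gt0 ?expR_gt0// divr_gt0.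
  have X1 x z e : 0 < e <= 1 -> 1 <= 1 + e^-1 * enorm (x - z).
    by move=> /andP[e0 _]; rewrite lerDl mulr_ge0 ?invr_ge0 ?sqrtr_ge0// ltW.
  have Wk k c : 0 < k -> k <= dl * A * c / W -> forall z,
      W <= dl * c * expR (- (D * n z)) * (A / k * expR (D * n z)).
    move=> k0; rewrite ler_pdivlMr// => h z.
    rewrite [leRHS](_ : _ = dl * A * c / k * (expR (- (D * n z)) * expR (D * n z))); last by ring.
    by rewrite -expRD addNr expR0 mulr1 ler_pdivlMr// mulrC.
  have k1le : k1 <= dl * A * `|P 0| / W by rewrite /k1 ge_min lexx orbT.
  have k2le : k2 <= dl * A * `|Q 0| / W by rewrite /k2 !ge_min lexx !orbT.
  have Wk1 := Wk k1 `|P 0| k10 k1le.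
  have Wk2 := Wk k2 `|Q 0| k20 k2le.
  move=> [bp zp] [bq zq] Sp Sq pq; rewrite /entry /om /=.
  set y := (eps (bp, zp))^-1 *: (zq - zp).
  case: bp Sp pq @y => Sp pq y; case: bq Sq pq => Sq pq.
  - have xz : zq <> zp by move=> h; apply: pq; rewrite h.
    have KK : B + D <= K2 by rewrite /K2 lerDl ltW// divr_gt0// addr_gt0.
    have h := TrQ (eps (true, zp)) Pc _ zq zp (eps01 _) cPP (sepX true zq zp k2 K2 Sp Sq xz k20 KK).
    have h' := absorb (expR_ge0 _) (gX k2 zp k20) h (Wk2 zp).
    rewrite /mm /=.
    have -> : eps (true, zp) `^ (2 * s) / Q 0 / eps (true, zp) `^ (2 * s) = (Q 0)^-1.
      by rewrite mulrAC mulfV ?mul1r// gt_eqF.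
    rewrite normrM normfV.
    rewrite [leLHS](_ : _ = Qc / `|Q 0| * (`|Q y| * expR (- N zp + Pc * n zp))); last by ring.
    rewrite [leRHS](_ : _ = Qc / `|Q 0| * (dl * `|Q 0| * expR (- (D * n zp)) * expR (- N zq + Pc * n zq))).
      by rewrite ler_wpM2l// ltW// divr_gt0.
    by field; rewrite gt_eqF.
  (* Here [eps ^ (2 s)] contains [exp (- (Pc + D) n)], which cancels the weight of [p] and leaves
     [exp (- D n)]. *)
  - have h := TrP (eps (true, zp)) 0 1 zq zp (eps01 _) c0P (X1 _ _ _ (eps01 _)).
    rewrite !mul0r !addr0 mulr1 in h.
    rewrite /mm /= eE// !normrM normfV (ger0_norm (powR_ge0 _ _)) (ger0_norm (expR_ge0 _)).
    have E : expR (- (2 * s * K2 * n zp)) * expR (- N zp + Pc * n zp) =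
        expR (- (2 * s * K1 * n zp)) * (expR (- (D * n zp)) * expR (- N zp)).
      by rewrite -!expRD; congr expR; rewrite /K2; field; rewrite gt_eqF.
    rewrite [leLHS](_ : _ = k2 `^ (2 * s) * Qc / `|Q 0| * `|P y| *
      (expR (- (2 * s * K2 * n zp)) * expR (- N zp + Pc * n zp))); last by ring.
    rewrite E [leLHS](_ : _ = expR (- (2 * s * K1 * n zp)) * (k2 `^ (2 * s) * Qc / `|Q 0| *
      expR (- (D * n zp)) * (`|P y| * expR (- N zp)))); last by ring.
    have c0 : 0 <= k2 `^ (2 * s) * Qc / `|Q 0| * expR (- (D * n zp)).
      by rewrite mulr_ge0 ?expR_ge0// divr_ge0// mulr_ge0 ?powR_ge0// (ltW Qc0).
    rewrite (le_trans (ler_piMl _ _))//.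
    + by exact: (mulr_ge0 c0 (mulr_ge0 (normr_ge0 _) (expR_ge0 _))).
    + by rewrite -[leRHS]expR0 ler_expR oppr_le0 mulr_ge0 ?wnorm_ge0// ltW// mulr_gt0.
    rewrite (le_trans (ler_wpM2l c0 h))//.
    rewrite [leLHS](_ : _ = (k2 `^ (2 * s) * (Qc * W) / `|Q 0|) * (expR (- (D * n zp)) * expR (- N zq))); last by ring.
    rewrite -[leRHS]mulrA ler_wpM2r ?mulr_ge0 ?expR_ge0//.
    by rewrite ler_pdivrMr// -ler_pdivlMr// mulr_gt0.
  (* As [2 s K1 = Pc - D], the growth [exp (2 s K1 n)] is of the form that [transfer] with [c = Pc]
     carries to [q], where [om] contains it. *)
  - have h := TrQ (eps (false, zp)) Pc 1 zq zp (eps01 _) cPP (X1 _ _ _ (eps01 _)).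
    rewrite mulr1 in h.
    rewrite /mm /= eE// !normrM !normfV normrM !(ger0_norm (expR_ge0 _)) (ger0_norm (ltW k1s)).
    have E : (expR (- (2 * s * K1 * n zp)))^-1 * expR (- N zp) =
        expR (- (D * n zp)) * expR (- N zp + Pc * n zp).
      by rewrite -expRN -!expRD; congr expR; rewrite /Pc; ring.
    rewrite [leLHS](_ : _ = (`|P 0| * k1 `^ (2 * s))^-1 * `|Q y| *
      ((expR (- (2 * s * K1 * n zp)))^-1 * expR (- N zp))); last by rewrite !invfM; ring.
    rewrite E [leLHS](_ : _ = (`|P 0| * k1 `^ (2 * s))^-1 * expR (- (D * n zp)) *
      (`|Q y| * expR (- N zp + Pc * n zp))); last by ring.
    rewrite [leRHS](_ : _ = (`|P 0| * k1 `^ (2 * s))^-1 * expR (- (D * n zp)) *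
      (W * expR (- N zq + Pc * n zq))); last first.
      by rewrite /Qc; field; rewrite !gt_eqF.
    by rewrite ler_wpM2l// mulr_ge0 ?expR_ge0// invr_ge0 ltW// mulr_gt0.
  - have xz : zq <> zp by move=> h; apply: pq; rewrite h.
    have h := TrP (eps (false, zp)) 0 _ zq zp (eps01 _) c0P (sepX false zq zp k1 K1 Sp Sq xz k10 (lexx _)).
    rewrite !mul0r !addr0 in h.
    have h' := absorb (expR_ge0 _) (gX k1 zp k10) h (Wk1 zp).
    rewrite /mm /= normrM normfV -[leLHS]mulrA.
    rewrite [leRHS](_ : _ = `|P 0|^-1 * (dl * `|P 0| * expR (- (D * n zp)) * expR (- N zq))).
      by rewrite ler_wpM2l// invr_ge0.
    by field; rewrite gt_eqF.
have i1 : 0 < k1^-1 by rewrite invr_gt0.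
have i2 : 0 < k2^-1 by rewrite invr_gt0.
have i3 : 0 < `|P 0|^-1 by rewrite invr_gt0.
have i4 : 0 < `|Q 0|^-1 by rewrite invr_gt0.
have i5 : 0 < (k1 `^ (2 * s))^-1 by rewrite invr_gt0.
have i6 : 0 < (k2 `^ (2 * s))^-1 by rewrite invr_gt0 powR_gt0.
pose C := 1 + k1^-1 + k2^-1 + `|P 0|^-1 + `|Q 0|^-1 + (k1 `^ (2 * s))^-1 + (k2 `^ (2 * s))^-1 + Qc.
have [c1 c2 c3 c4] : [/\ 1 <= C, k1^-1 <= C, k2^-1 <= C & `|P 0|^-1 <= C].
  by move: i1 i2 i3 i4 i5 i6 Qc0; rewrite /C; clear; split; lra.
have [c5 c6 c7 c8] : [/\ `|Q 0|^-1 <= C, (k1 `^ (2 * s))^-1 <= C, (k2 `^ (2 * s))^-1 <= C & Qc <= C].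
  by move: i1 i2 i3 i4 i5 i6 Qc0; rewrite /C; clear; split; lra.
have C0 : 0 < C by rewrite (lt_le_trans ltr01).
exists C => //.
have j1 : 0 < 2 * s * K1 by rewrite mulr_gt0.
have j2 : 0 < 2 * s * K2 by rewrite mulr_gt0.
pose K := K1 + K2 + 2 * s * K1 + 2 * s * K2 + Pc.
have [d0 [d1 d2 d3 d4 d5]] := le_sum5 K10 K20 j1 j2 Pc0.
rewrite -/K in d0 d1 d2 d3 d4 d5.
exists K => //.
clearbody C K; move=> [b z] /=; have n0 := wnorm_ge0 rho z.
have hF t c : 0 <= t -> t <= C -> c <= K -> t * expR (c * n z) <= C * expR (K * n z).
  by move=> t0 tC cK; rewrite ler_pM ?expR_ge0// ler_expR ler_wpM2r.
have F1 t : 0 <= t -> t <= C -> t <= C * expR (K * n z).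
  by move=> t0 tC; rewrite -[leLHS]mulr1 -expR0 -(mul0r (n z)); exact: hF.
case: b; rewrite /eps /mm /om /=; split.
- by rewrite invfM expRN invrK; apply: hF => //; exact: ltW.
- rewrite normrM normfV; apply: (@le_trans _ _ `|Q 0|^-1).
    have E1 : (1 : R) `^ (2 * s) = 1 by rewrite powR1.
    rewrite ler_piMl ?(ltW i4)// ger0_norm ?powR_ge0// -[leRHS]E1.
    have /andP[e0 e1] := eps01 (true, z).
    by rewrite ge0_ler_powR ?nnegrE ?(ltW e0) ?(ltW s20).
  by apply: F1 => //; exact: ltW.
- by rewrite eE// invfM expRN invrK; apply: hF => //; exact: ltW.
- rewrite expRD mulrCA [leLHS]mulrC ler_wpM2r ?expR_ge0//.
  by apply: hF => //; exact: ltW.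
- by rewrite invfM expRN invrK; apply: hF => //; exact: ltW.
- by rewrite normfV; apply: F1 => //; exact: ltW.
- by rewrite eE// invfM expRN invrK; apply: hF => //; exact: ltW.
- by rewrite -[leLHS]mul1r ler_wpM2r ?expR_ge0//; exact: (F1 1 ler01 c1).
Qed.

End nodes.

(** * Solution of the interpolation problem *)

Section interpolation.
Context {R : realType} {d : nat}.
Implicit Types (x y z : 'rV[R]_d).

(** Rests on [(2 k + b + 1) (2 k + b + 2) <= 9 (k + 1) ^ 2]. *)
Lemma wt_code (k : nat) (b : bool) (C D t : R) : 0 <= C -> k.+1%:R <= C * expR (D * t) ->
  expR (- (2 * D * t)) <= 9 * C ^+ 2 * wt (2 * k + b).
Proof.
move=> C0 h; have k0 : 0 <= k.+1%:R :> R by [].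
rewrite /wt ler_pdivlMr ?mulr_gt0//.
have -> : - (2 * D * t) = - (D * t) - (D * t) by ring.
apply: (@le_trans _ _ (expR (- (D * t) - D * t) * (9 * (C * expR (D * t)) ^+ 2))).
  rewrite ler_wpM2l ?expR_ge0//; apply: (@le_trans _ _ (9 * k.+1%:R ^+ 2)).
    by rewrite -natrX -!natrM ler_nat; case: b; nia.
  by rewrite ler_pM2l// lerXn2r// nnegrE (le_trans k0).
rewrite exprMn expr2 [in leLHS]expr2 expRD.
rewrite [leLHS](_ : _ = 9 * (C * C) * ((expR (- (D * t)) * expR (D * t)) * (expR (- (D * t)) * expR (D * t)))); last by ring.
by rewrite -expRD addNr expR0 !mulr1.
Qed.

Lemma node_enumeration rho A B (S : bool * 'rV[R]_d -> Prop) :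
  (0 < d)%N -> 0 < rho -> 0 < A -> 0 < B ->
  (forall b, separated rho A B [set z | S (b, z)]) ->
  exists (pt : nat -> bool * 'rV[R]_d) (valid : pred nat) (D C : R), [/\ 0 < D, 0 < C,
    forall j, valid j -> S (pt j) /\ expR (- (D * wnorm rho (pt j).2)) <= C * wt j,
    forall i j, valid i -> valid j -> pt i = pt j -> i = j &
    forall p, S p -> exists2 j, valid j & pt j = p].
Proof.
move=> d0 r0 A0 B0 sep.
have [c0 [inj0 [C0 [D0 [C00 D00 h0]]]]] := separated_code d0 r0 A0 B0 (sep false).
have [c1 [inj1 [C1 [D1 [C10 D10 h1]]]]] := separated_code d0 r0 A0 B0 (sep true).
(* The last bit of an index records the kind of the node. Indices that are not codes receive a
   default point, which [valid] excludes. *)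
pose cd (p : bool * 'rV[R]_d) := (2 * (if p.1 then c1 p.2 else c0 p.2) + p.1)%N.
pose pt j := xget (false, 0) [set p | S p /\ cd p = j].
have cd_inj p p' : S p -> S p' -> cd p = cd p' -> p = p'.
  case: p p' => [b z] [b' z'] Sp Sp' /double_bit_inj /= [].
  move=> hc hb; move: hb Sp Sp' hc => -> {b}; case: b' => Sp Sp' hc.
    by rewrite (inj1 z z')// inE.
  by rewrite (inj0 z z')// inE.
exists pt, (fun j => `[< S (pt j) /\ cd (pt j) = j >]), (2 * (D0 + D1)), (9 * (C0 + C1) ^+ 2).
have CC : 0 < C0 + C1 by rewrite addr_gt0.
split.
- by rewrite mulr_gt0// addr_gt0.
- by rewrite mulr_gt0// exprn_gt0.
- move=> j /asboolP[Sj cj]; split => //; rewrite -{2}cj /cd.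
  apply: wt_code; first exact: ltW.
  have n0 := wnorm_ge0 rho (pt j).2.
  have aux c' D' : 0 <= c' -> c' <= C0 + C1 -> D' <= D0 + D1 ->
      c' * expR (D' * wnorm rho (pt j).2) <= (C0 + C1) * expR ((D0 + D1) * wnorm rho (pt j).2).
    by move=> c'0 cC DD; rewrite ler_pM ?expR_ge0// ler_expR ler_wpM2r.
  case: (pt j).1.
    by rewrite (le_trans (h1 _))// aux ?(ltW C10)// ?lerDr ?ltW.
  by rewrite (le_trans (h0 _))// aux ?(ltW C00)// ?lerDl ?ltW.
- by move=> i j /asboolP[_ ci] /asboolP[_ cj] ij; rewrite -ci -cj ij.
- move=> p Sp; have [S' c'] : S (pt (cd p)) /\ cd (pt (cd p)) = cd p.
    by rewrite /pt; case: xgetP => [q _ //|/(_ p)]; case.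
  by exists (cd p); [exact/asboolP|exact: cd_inj].
Qed.

(** The decay imposed on [b] is exactly the weight [om] at nodes of the first kind, so the data lie
    in the weighted space where the system is solved. *)
Lemma interpolation (theta rho s A B : R) (L1 L2 : set 'rV[R]_d) (b : 'rV[R]_d -> R) c :
  (0 < d)%N -> 0 < rho < theta -> theta < 1 -> 0 < s -> 0 < A -> 0 < B ->
  separated rho A B L1 -> separated rho A B L2 ->
  0 <= c -> (forall x, L1 x -> `|b x| <= c * expR (- wnorm theta x)) ->
  exists F G : 'rV[R]_d -> R, [/\ decaying theta F, decaying theta G,
    forall x, L1 x -> F x = b x, forall x, L2 x -> G x = 0 &
    forall xi phi,
      \int[lebesgue_tuple d]_t (G (rowt t) * cos (2 * pi * dotv xi (rowt t) + phi)) =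
      enorm xi `^ (2 * s) *
      \int[lebesgue_tuple d]_t (F (rowt t) * cos (2 * pi * dotv xi (rowt t) + phi))].
Proof.
move=> d0 rt t1 s0 A0 B0 sep1 sep2 c0 hb.
have r0 : 0 < rho by case/andP: rt.
have th01 : 0 < theta < 1 by rewrite t1 andbT (lt_trans r0)//; case/andP: rt.
have [P [Q [P0 Q0 rP rQ [mPQ ft]]]] := laplacian_pair d0 th01 s0.
pose S (p : bool * 'rV[R]_d) := if p.1 then L2 p.2 else L1 p.2.
have sep b' : separated rho A B [set z | S (b', z)] by case: b'.
have [pt [valid [D [C [D0 C0 vS vinj vsurj]]]]] := node_enumeration d0 r0 A0 B0 sep.
(* This value makes [dl * C = 1 / 2], the contraction factor in [neumann]. *)
have dl0 : 0 < (2 * C)^-1 by rewrite invr_gt0 mulr_gt0.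
have [mm [eps [om [eps01 om0 omF ent1 [entS [C1 C10 [K K0 hC]]]]]]] :=
  node_scales rt t1 s0 P0 Q0 rP rQ A0 B0 D0 dl0 sep.
(* The diagonal is left out: its entries are [1] and form the identity of the perturbed system. *)
pose T j i := if [&& valid j, valid i & i != j] then entry s P Q mm eps (pt j) (pt i) else 0.
pose w j := om (pt j).
pose bb j := if valid j && ~~ (pt j).1 then b (pt j).2 else 0.
have w0 i : 0 < w i by exact: om0.
have Tw j i : `|T j i| * w i <= 2^-1 * wt i * w j.
  rewrite /T; case: ifPn => [/and3P[vj vi ij]|_]; last first.
    by rewrite normr0 mul0r mulr_ge0 ?(ltW (w0 _))// mulr_ge0 ?wt_ge0.
  have [Si ei] := vS i vi; have [Sj _] := vS j vj.
  have pp : pt i <> pt j by move=> h; move/eqP: ij; apply; exact: vinj.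
  rewrite (le_trans (entS _ _ Si Sj pp))// ler_wpM2r ?(ltW (w0 j))//.
  rewrite (le_trans (ler_wpM2l (ltW dl0) ei))// invfM -mulrA ler_wpM2l ?invr_ge0//.
  by rewrite mulKf// gt_eqF.
have bw j : `|bb j| <= c * w j.
  rewrite /bb; case: ifPn => [/andP[vj]|_]; last by rewrite normr0 mulr_ge0 ?(ltW (w0 j)).
  have [] := vS j vj; rewrite /S /w; case: (pt j) => [[] z] //= Sj _ _.
  by rewrite omF hb.
have [a [aw aE]] := neumann w0 Tw c0 bw.
pose A1 i := if valid i then a i * mm (pt i) else 0.
(* Rescaling by [e] multiplies the relation between [P] and [Q] by [e ^ (2 s)]; the division
   compensates this. *)
pose B1 i := A1 i / eps (pt i) `^ (2 * s).
pose e i := eps (pt i); pose z i := (pt i).2.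
have e01 i : 0 < e i <= 1 by exact: eps01.
have es i : 0 < e i `^ (2 * s) by rewrite powR_gt0//; case/andP: (e01 i).
(* since [rho < theta], the decay [expR (- wnorm theta z)] absorbs every [expR (K * wnorm rho z)] *)
have small (Z : nat -> R) (C2 : R) (m : nat) : 0 <= C2 ->
    (forall i, `|Z i| <= (if valid i then C2 * expR (m%:R * K * wnorm rho (z i)) * expR (- wnorm theta (z i)) else 0)) ->
    forall k : nat, exists2 C', 0 <= C' & forall n, `|Z n| * (e n)^-1 ^+ k * expR (wnorm theta (z n) / 2) <= C' * wt n.
  move=> C20 ZC k.
  have h2 : 0 < 2^-1 :> R by rewrite invr_gt0.
  have [C3 C30 hC3] := @wnorm_dominates R d (m%:R * K + k%:R * K + D) 2^-1 rho theta h2 rt.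
  exists (C2 * C1 ^+ k * expR C3 * C).
    by rewrite !mulr_ge0 ?expR_ge0 ?exprn_ge0// ltW.
  move=> i; have [e0 _] := andP (e01 i).
  have ek : 0 <= (e i)^-1 ^+ k by rewrite exprn_ge0// invr_ge0 ltW.
  have := ZC i; case: ifPn => vi hZ; last first.
    have -> : Z i = 0 by apply/normr0_eq0/eqP; rewrite eq_le hZ normr_ge0.
    by rewrite normr0 !mul0r mulr_ge0 ?wt_ge0// !mulr_ge0 ?expR_ge0 ?exprn_ge0// ltW.
  have [_ ei] := vS i vi; have [hC' _ _ _] := hC (pt i).
  have ek' : (e i)^-1 ^+ k <= C1 ^+ k * expR (k%:R * K * wnorm rho (z i)).
    apply: (@le_trans _ _ ((C1 * expR (K * wnorm rho (z i))) ^+ k)).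
      by rewrite lerXn2r// nnegrE ?invr_ge0 ?mulr_ge0 ?expR_ge0// ltW.
    by rewrite exprMn -expRM_natl mulrA.
  have h1 := ler_pM (normr_ge0 _) ek hZ ek'.
  rewrite (le_trans (ler_wpM2r (expR_ge0 _) h1))//.
  rewrite [leLHS](_ : _ = C2 * C1 ^+ k * (expR (m%:R * K * wnorm rho (z i)) * expR (- wnorm theta (z i)) *
    expR (k%:R * K * wnorm rho (z i)) * expR (wnorm theta (z i) / 2))); last by ring.
  rewrite -2![leRHS]mulrA ler_wpM2l ?mulr_ge0 ?exprn_ge0 ?(ltW C10)//.
  rewrite (le_trans _ (ler_wpM2l (expR_ge0 C3) ei))// -!expRD ler_expR.
  by have := hC3 (z i); rewrite /z; lra.
have aB i : valid i -> `|a i| <= 6 * c * C1 * expR (K * wnorm rho (z i)) * expR (- wnorm theta (z i)).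
  move=> vi; have [_ _ _ h] := hC (pt i); have c6 : 0 <= 6 * c by rewrite mulr_ge0.
  by rewrite (le_trans (aw i))// (le_trans (ler_wpM2l c6 h))// !mulrA.
have C6 : 0 <= 6 * c * C1 by rewrite !mulr_ge0// ltW.
have AB i : `|A1 i| <= (if valid i then 6 * c * C1 * C1 * expR (2%:R * K * wnorm rho (z i)) *
    expR (- wnorm theta (z i)) else 0).
  rewrite /A1; case: ifPn => [vi|_]; last by rewrite normr0.
  have [_ h _ _] := hC (pt i).
  rewrite normrM (le_trans (ler_pM (normr_ge0 _) (normr_ge0 _) (aB i vi) h))//.
  have -> : 2%:R * K * wnorm rho (z i) = K * wnorm rho (z i) + K * wnorm rho (z i) by ring.
  by rewrite expRD /z; rewrite le_eqVlt; apply/orP; left; apply/eqP; ring.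
have smallA := small A1 (6 * c * C1 * C1) 2%N (mulr_ge0 C6 (ltW C10)) AB.
have smallB : forall k : nat, exists2 C', 0 <= C' & forall n,
    `|B1 n| * (e n)^-1 ^+ k * expR (wnorm theta (z n) / 2) <= C' * wt n.
  apply: (small B1 (6 * c * C1 * C1 * C1) 3%N); first by rewrite mulr_ge0 ?(ltW C10)// mulr_ge0// ltW.
  move=> i; rewrite /B1 normrM normfV (ger0_norm (ltW (es i))); have := AB i.
  case: ifPn => [vi hA|_ hA]; last first.
    by rewrite (_ : `|A1 i| = 0) ?mul0r//; apply/eqP; rewrite eq_le hA normr_ge0.
  have [_ _ h _] := hC (pt i).
  have ei : 0 <= (eps (pt i) `^ (2 * s))^-1 by rewrite invr_ge0 ltW// es.
  rewrite (le_trans (ler_pM (normr_ge0 _) ei hA h))//.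
  have -> : 3%:R * K * wnorm rho (z i) = 2%:R * K * wnorm rho (z i) + K * wnorm rho (z i) by ring.
  by rewrite expRD /z; rewrite le_eqVlt; apply/orP; left; apply/eqP; ring.
have sumE j : valid j ->
    nsum (fun i => if valid i then a i * entry s P Q mm eps (pt j) (pt i) else 0) = bb j.
  move=> vj; rewrite -(aE j) addrC -[in RHS](nsum_delta j (a j)).
  rewrite -(@nsumD _ _ _ (3 * c * w j) (`|a j| / wt j)).
  - apply: eq_nsum => i; rewrite /T vj /=; case: (eqVneq i j) => [->|ij].
      by rewrite vj andbF mul0r add0r ent1 mulr1.
    by rewrite andbT addr0; case: ifP => _; rewrite ?mul0r// mulrC.
  - move=> i; rewrite normrM (le_trans (ler_wpM2l (normr_ge0 _) (aw i)))//.
    rewrite [leLHS](_ : _ = 6 * c * (`|T j i| * w i)); last by ring.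
    rewrite (le_trans (ler_wpM2l _ (Tw j i))) ?mulr_ge0//.
    by rewrite le_eqVlt; apply/orP; left; apply/eqP; field.
  - move=> i; case: eqP => [->|_]; first by rewrite mulfVK// gt_eqF// wt_gt0.
    by rewrite normr0 mulr_ge0 ?wt_ge0// divr_ge0// wt_ge0.
exists (fun x => nsum (fun n => A1 n * P ((e n)^-1 *: (x - z n)))).
exists (fun x => nsum (fun n => B1 n * Q ((e n)^-1 *: (x - z n)))); split.
- exact: superposition_decaying.
- exact: superposition_decaying.
- move=> x Lx; have [j vj jx] := vsurj (false, x) Lx.
  have := sumE j vj; rewrite /bb vj jx /= => <-; apply: eq_nsum => i.
  by rewrite /A1; case: ifP => _; rewrite ?mul0r// mulrA.
- move=> x Lx; have [j vj jx] := vsurj (true, x) Lx.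
  have := sumE j vj; rewrite /bb vj jx /= => <-; apply: eq_nsum => i.
  by rewrite /B1 /A1 /entry /=; case: ifP => _; rewrite ?mul0r// !mulrA.
- move=> xi phi.
  have mw := measurable_wave xi phi.
  have w1 (t : d.-tuple (measurableTypeR R)) : `|cos (2 * pi * dotv xi (rowt t) + phi)| <= 1.
    exact: cos_max.
  have mP n := (mPQ (e n) (z n)).1; have mQ n := (mPQ (e n) (z n)).2.
  have [CA _ [hA ->]] := superposition_integral th01 e01 smallA rP mP mw w1.
  have [_ _ [_ ->]] := superposition_integral th01 e01 smallB rQ mQ mw w1.
  rewrite -(nsumZ _ hA); apply: eq_nsum => n; rewrite ft; last by case/andP: (e01 n).
  by rewrite /B1 /e; field; rewrite gt_eqF// es.
Qed.

End interpolation.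

(** * Continuity from bounded gradients, and measurability of continuous functions *)

Section continuity.
Context {R : realType} {d : nat}.
Implicit Types (x y z : 'rV[R]_d).

Lemma coord_le_norm x i : `|x ord0 i| <= `|x|.
Proof.
rewrite [leRHS]/Num.norm /= mx_normrE.
exact: (le_bigmax 0 (fun ij : 'I_1 * 'I_d => `|x ij.1 ij.2|) (ord0, i)).
Qed.

Lemma line_increment (v v' : 'rV[R]_d -> R) i x C h :
  (forall y, is_derive y (basisv i) v (v' y)) -> (forall y, `|v' y| <= C) ->
  `|v (h *: basisv i + x) - v x| <= C * `|h|.
Proof.
move=> dv v'C; pose g t := v (1 *: (t *: basisv i + x - 0)).
have gE t : g t = v (t *: basisv i + x) by rewrite /g scale1r subr0.
pose g' t := v' (1 *: (t *: basisv i + x - 0)) * 1.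
have dg (t : R) : is_derive t 1 g (g' t) := is_derive_scaled t 1 x 0 dv.
have cg a b : {within `[a, b], continuous g}.
  apply: derivable_within_continuous => t _; exact: (@ex_derive _ _ _ _ _ _ _ (dg t)).
have key a b : a <= b -> `|g b - g a| <= C * (b - a).
  move=> ab; have [c _ ->] := MVT_segment ab (fun t _ => dg t) (cg a b).
  rewrite normrM (ger0_norm (_ : 0 <= b - a)) ?subr_ge0//.
  by rewrite ler_wpM2r ?subr_ge0// /g' mulr1.
have g0 : v x = g 0 by rewrite gE scale0r add0r.
rewrite g0 -gE; case: (leP 0 h) => h0.
  by have := key 0 h h0; rewrite subr0 (ger0_norm h0).
by have := key h 0 (ltW h0); rewrite sub0r distrC (ltr0_norm h0).
Qed.

(** One coordinate is changed at a time, through the points [m k] that take their first [k]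
    coordinates from [y], and the mean value theorem is used on each edge. *)
Lemma bounded_gradient_lipschitz (v : 'rV[R]_d -> R) C : 0 <= C ->
  (forall i, exists2 v' : 'rV[R]_d -> R, forall y, is_derive y (basisv i) v (v' y) &
    forall y, `|v' y| <= C) ->
  forall x y, `|v y - v x| <= C * \sum_(i < d) `|y ord0 i - x ord0 i|.
Proof.
move=> C0 dv x y.
pose m k : 'rV[R]_d := \row_i (if (i < k)%N then y ord0 i else x ord0 i).
have m0 : m 0%N = x by apply/rowP => i; rewrite mxE.
have md : m d = y by apply/rowP => i; rewrite mxE ltn_ord.
suff h k : (k <= d)%N -> `|v (m k) - v (m 0%N)| <= C * \sum_(i < d | (i < k)%N) `|y ord0 i - x ord0 i|.
  rewrite -{1}md -{1}m0 (le_trans (h d (leqnn d)))// ler_wpM2l//.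
  by rewrite (eq_bigl xpredT)// => i; rewrite ltn_ord.
elim: k => [_|k IH kd]; first by rewrite subrr normr0 mulr_ge0// sumr_ge0.
pose i0 : 'I_d := Ordinal kd.
rewrite (bigD1 i0)//= mulrDr.
have -> : m k.+1 = (y ord0 i0 - x ord0 i0) *: basisv i0 + m k.
  apply/rowP => i; rewrite !mxE eqxx /= ltnS leq_eqVlt -val_eqE /=.
  case: eqP => [ik|_]/=; last by rewrite mulr0 add0r.
  have -> : i = i0 by exact: val_inj.
  by rewrite ltnn mulr1 subrK.
have [v' dv' v'C] := dv i0.
rewrite -(subrKA (v (m k))) (le_trans (ler_normD _ _))// lerD//.
  exact: line_increment.
rewrite (le_trans (IH (ltnW kd)))// ler_wpM2l//.
rewrite le_eqVlt; apply/orP; left; apply/eqP; apply: eq_bigl => i.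
by rewrite ltnS -val_eqE /= ltn_neqAle andbC.
Qed.

Lemma bounded_gradient_continuous (v : 'rV[R]_d -> R) C : 0 <= C ->
  (forall i, exists2 v' : 'rV[R]_d -> R, forall y, is_derive y (basisv i) v (v' y) &
    forall y, `|v' y| <= C) -> continuous v.
Proof.
move=> C0 dv x; apply/(@cvgrPdist_lt _ _ _ (nbhs x)) => e e0.
have K0 : 0 < C * d%:R + 1 by rewrite ltr_wpDl// mulr_ge0.
have e'0 : 0 < e / (C * d%:R + 1) by rewrite divr_gt0.
have := @cvgr_dist_lt _ _ _ (nbhs x) _ id x (@cvg_id _ (nbhs x)) _ e'0.
move=> /(_ (nbhs_filter x)); apply: filterS => y; rewrite ltr_pdivlMr// => xy.
rewrite distrC (le_lt_trans _ xy)//.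
rewrite (le_trans (bounded_gradient_lipschitz C0 dv x y))//.
apply: (@le_trans _ _ (C * \sum_(i < d) `|x - y|)).
  by rewrite ler_wpM2l//; apply: ler_sum => i _; have := coord_le_norm (x - y) i; rewrite !mxE distrC.
rewrite sumr_const card_ord -[X in C * X]mulr_natr.
have : 0 <= `|x - y| by exact: normr_ge0.
by move: `|x - y| => X X0; nra.
Qed.

Lemma floor_approx (r m : R) : 0 < m -> `|r - (Num.floor (r * m))%:~R / m| < m^-1.
Proof.
move=> m0; have /andP[h1 h2] := floor_itv (r * m); rewrite intrD in h2.
rewrite (_ : r - _ = (r * m - (Num.floor (r * m))%:~R) / m); last by field; rewrite gt_eqF.
rewrite normrM normfV (gtr0_norm m0) ltr_pdivrMr// mulVf ?gt_eqF// ltr_norml; lra.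
Qed.

(** Tuples carry the product sigma-algebra. The function is the pointwise limit of its values at
    grid points of mesh [1 / (m + 1)], and these approximants are constant on countably many
    boxes. *)
Lemma measurable_rowt_continuous (u : 'rV[R]_d -> R) : continuous u ->
  measurable_fun setT (fun t : d.-tuple (measurableTypeR R) => u (rowt t)).
Proof.
move=> cu.
pose phi m (t : d.-tuple (measurableTypeR R)) : d.-tuple int :=
  [tuple Num.floor ((tnth t i : R) * m.+1%:R) | i < d].
pose psi m (c : d.-tuple int) : 'rV[R]_d := \row_i ((tnth c i)%:~R / m.+1%:R).
apply: (@measurable_fun_cvg _ _ _ _ (fun m t => u (psi m (phi m t)))).
- move=> m _ Y mY; rewrite setTI.
  have -> : (fun t => u (psi m (phi m t))) @^-1` Y =
      \bigcup_(c in [set c | Y (u (psi m c))]) [set t | phi m t = c].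
    by apply/seteqP; split => [t Yt|t [c /= Yc ct]]; [exists (phi m t)|rewrite /= ct].
  rewrite bigcup_mkcond; apply: countable_bigcupT_measurable => [|c]; first exact: countableP.
  case: ifP => // _.
  have -> : [set t | phi m t = c] = \bigcap_(i in [set: 'I_d])
      ((fun t : d.-tuple (measurableTypeR R) => (tnth t i : R) * m.+1%:R) @^-1`
        `[(tnth c i)%:~R, (tnth c i + 1)%:~R[%classic).
    apply/seteqP; split=> [t /= <- i _|t h] /=.
      by rewrite in_itv /= tnth_mktuple floor_le /= floorD1_gt.
    apply: eq_from_tnth => i; rewrite tnth_mktuple; apply: floor_def.
    by have := h i I; rewrite /= in_itv.
  apply: fin_bigcap_measurable => [|i _]; first exact: finite_finset.
  rewrite -[X in measurable X]setTI; apply: measurable_funM => //.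
  exact: measurable_tnth.
- move=> t _; apply: (@continuous_cvg _ _ _ _ _ (fun m => psi m (phi m t))); first exact: cu.
  apply/cvgrPdist_lt => e e0; near=> m.
  rewrite /Num.norm /= mx_normrE; apply: bigmax_lt => //= -[i j] _ /=.
  rewrite !mxE tnth_mktuple.
  have m0 : 0 < m.+1%:R :> R by [].
  rewrite (@lt_trans _ _ (m.+1%:R)^-1)//; last by near: m; exact: (near_infty_natSinv_lt (PosNum e0)).
  exact: floor_approx.
Unshelve. all: by end_near.
Qed.

End continuity.

(** * Membership of decaying functions in the Schwartz class and in the weighted space *)

Section decaying_functions.
Context {R : realType} {d : nat}.
Implicit Types (x y z : 'rV[R]_d) (f g : 'rV[R]_d -> R[i]).
Local Notation Re := (@complex.Re R).
Local Notation Im := (@complex.Im R).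
Variable theta : R.
Hypothesis theta0 : 0 < theta.

Lemma decaying0 : decaying theta (fun _ : 'rV[R]_d => 0).
Proof.
exists (fun _ _ => 0), 1; split => //.
  by move=> w i x; exact: (@is_derive_cst _ _ _ 0).
by move=> w; exists 0 => // x; rewrite normr0 mul0r.
Qed.

(** The family [D] coincides with the iterated [partials]; each member is continuous because the
    next ones are bounded. *)
Lemma decaying_smooth (u : 'rV[R]_d -> R) : decaying theta u ->
  smoothR u /\ exists2 K, 0 < K & forall w, exists2 C, 0 <= C &
    forall x, `|partials w u x| <= C * expR (- (K * wnorm theta x)).
Proof.
move=> [D [K [K0 D0 dD bD]]].
have pE w : partials w u = D w.
  elim: w => [//|i w IH] /=; rewrite IH; apply/funext => x.
  by have := dD w i x => h; rewrite derive_val.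
split; last by exists K => // w; rewrite pE.
move=> w; rewrite pE; split => [|i x]; last exact: (@ex_derive _ _ _ _ _ _ _ (dD w i x)).
have /choice[C hC] : forall i, exists C, 0 <= C /\ forall x, `|D (i :: w) x| <= C.
  move=> i; have [C C0 hC] := bD (i :: w); exists C; split => // x.
  rewrite (le_trans (hC x))// ler_piMr// -[leRHS]expR0 ler_expR oppr_le0.
  by rewrite mulr_ge0 ?wnorm_ge0// ltW.
have sC0 : 0 <= \sum_i C i by apply: sumr_ge0 => i _; exact: (hC i).1.
apply: (bounded_gradient_continuous sC0) => i; exists (D (i :: w)); first exact: dD.
move=> y; rewrite (le_trans ((hC i).2 y))// (bigD1 i)//= lerDl sumr_ge0// => j _.
exact: (hC j).1.
Qed.

Lemma monomial_bound K (a : 'I_d -> nat) : 0 < K ->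
  exists2 C, 0 <= C & forall x, `|monomial a x| <= C * expR (K * wnorm theta x).
Proof.
move=> K0; have /choice[C hC] : forall i, exists C : R, 0 <= C /\
    forall r, 0 <= r -> r ^+ a i <= C * expR (K * r `^ theta).
  by move=> i; have [C C0 hC] := expR_powR_dominates (a i) K0 theta0; exists C; split => //; exact: ltW.
exists (\prod_i C i); first by apply: prodr_ge0 => i _; exact: (hC i).1.
move=> x; rewrite /monomial normr_prod /wnorm mulr_sumr expR_sum -big_split /=.
by apply: ler_prod => i _; rewrite normrX exprn_ge0//=; exact: (hC i).2.
Qed.

Lemma decaying_schwartz f : decaying theta (Re \o f) -> decaying theta (Im \o f) -> schwartz f.
Proof.
move=> /decaying_smooth[s1 [K1 K10 h1]] /decaying_smooth[s2 [K2 K20 h2]]; split => // a w.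
have [C1 C10 hC1] := h1 w; have [C2 C20 hC2] := h2 w.
have [A1 A10 hA1] := monomial_bound a K10; have [A2 A20 hA2] := monomial_bound a K20.
exists (A1 * C1 + A2 * C2) => x; rewrite cmodM cmodR.
rewrite (le_trans (ler_wpM2l (normr_ge0 _) (cmod_le_ReIm _)))//= mulrDr lerD//.
  rewrite (le_trans (ler_pM _ _ (hA1 x) (hC1 x)))// mulrACA -expRD subrr expR0 mulr1//.
rewrite (le_trans (ler_pM _ _ (hA2 x) (hC2 x)))// mulrACA -expRD subrr expR0 mulr1//.
Qed.

(** As [p < theta], any positive rate in the exponent [theta] beats the power [p], so the constant
    [1] is admissible in the weight. *)
Lemma decaying_weighted_sup f p : 0 < p < theta -> theta < 1 ->
  decaying theta (Re \o f) -> decaying theta (Im \o f) -> (weighted_sup 1 p f < +oo)%E.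
Proof.
move=> pt t1 /decaying_smooth[_ [K1 K10 h1]] /decaying_smooth[_ [K2 K20 h2]].
have [p0 pth] := andP pt.
have [C1 C10 hC1] := h1 [::]; have [C2 C20 hC2] := h2 [::].
have [A1 A10 hA1] := @wnorm_dominates R d 1 K1 p theta K10 pt.
have [A2 A20 hA2] := @wnorm_dominates R d 1 K2 p theta K20 pt.
have p01 : 0 < p <= 1 by rewrite p0 ltW// (lt_trans pth).
apply: (@le_lt_trans _ _ (C1 * expR A1 + C2 * expR A2)%:E); last exact: ltry.
apply: ge_ereal_sup => _ [x _ <-]; rewrite lee_fin.
have e1 : expR (1 * enorm x `^ p) <= expR (wnorm p x) by rewrite ler_expR mul1r enorm_powR.
have := ler_pM (cmod_ge0 _) (expR_ge0 _) (cmod_le_ReIm (f x)) e1.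
move=> /le_trans; apply; rewrite mulrDl lerD//.
  rewrite (le_trans (ler_wpM2r (expR_ge0 _) (hC1 x)))// -mulrA ler_wpM2l// -expRD ler_expR.
  by have := hA1 x; lra.
rewrite (le_trans (ler_wpM2r (expR_ge0 _) (hC2 x)))// -mulrA ler_wpM2l// -expRD ler_expR.
by have := hA2 x; lra.
Qed.

Lemma decaying_integrable (u : 'rV[R]_d -> R) : decaying theta u ->
  (lebesgue_tuple d).-integrable setT (EFin \o (fun t => u (rowt t))).
Proof.
move=> /decaying_smooth[su [K K0 h]]; have [C C0 hC] := h [::].
apply: (@dominated_integrable _ _ _ (lebesgue_tuple d) _
  (fun t => C * expR (- (K * wnorm theta (rowt t))))).
- by apply: measurable_rowt_continuous; exact: (su [::]).1.
- exact: (integrableZl measurableT C (integrable_expR_wnorm K0 theta0)).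
- by move=> t; exact: hC.
Qed.

(** Since [cos (t + pi / 2) = - sin t], the phases [0] and [pi / 2] give the real and the imaginary
    part. *)
Lemma fourier_real (F : 'rV[R]_d -> R) xi :
  fourier (fun x => (F x)%:C) xi =
  (\int[lebesgue_tuple d]_t (F (rowt t) * cos (2 * pi * dotv xi (rowt t) + 0))) +i*
  (\int[lebesgue_tuple d]_t (F (rowt t) * cos (2 * pi * dotv xi (rowt t) + pi / 2))).
Proof.
apply: complex_eq => /=; apply: eq_Rintegral => t _; rewrite ?ReM ?ImM /= mul0r.
  by rewrite subr0 addr0 cosN.
by rewrite addr0 sinN cosDpihalf.
Qed.

Lemma decaying_in_Sspq s p q (F G : 'rV[R]_d -> R) :
  0 < p < theta -> 0 < q < theta -> theta < 1 -> decaying theta F -> decaying theta G ->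
  (forall xi phi,
      \int[lebesgue_tuple d]_t (G (rowt t) * cos (2 * pi * dotv xi (rowt t) + phi)) =
      enorm xi `^ (2 * s) *
      \int[lebesgue_tuple d]_t (F (rowt t) * cos (2 * pi * dotv xi (rowt t) + phi))) ->
  in_Sspq s p q (fun x => (F x)%:C) (fun x => (G x)%:C).
Proof.
move=> pt qt t1 dF dG ft.
have sF : schwartz (fun x => (F x)%:C) by apply: decaying_schwartz => //; exact: decaying0.
have sG : schwartz (fun x => (G x)%:C) by apply: decaying_schwartz => //; exact: decaying0.
split => //.
  split; first exact: sG.1.
    split; first exact: decaying_integrable.
    exact: (decaying_integrable decaying0).
  move=> xi; rewrite !fourier_real !ft; apply: complex_eq; rewrite ?ReM ?ImM /=.
    by rewrite mul0r subr0.
  by rewrite mul0r addr0.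
exists 1 => //; apply: lte_add_pinfty; apply: decaying_weighted_sup => //; exact: decaying0.
Qed.

End decaying_functions.

(** * Linear combinations in the space of vanishing functions *)

Section linear_structure.
Context {R : realType} {d : nat}.
Implicit Types (x y z : 'rV[R]_d) (f g : 'rV[R]_d -> R[i]) (u v : 'rV[R]_d -> R).
Local Notation Re := (@complex.Re R).
Local Notation Im := (@complex.Im R).

Lemma smoothR_lin c u v : smoothR u -> smoothR v ->
  smoothR (fun x => c * u x + v x) /\
  forall l x, partials l (fun x => c * u x + v x) x = c * partials l u x + partials l v x.
Proof.
move=> su sv.
have pE l : partials l (fun x => c * u x + v x) = (fun x => c * partials l u x + partials l v x).
  elim: l => [//|i l IH] /=; rewrite IH; apply/funext => x.
  have h1 := derivableP ((su l).2 i x); have h2 := derivableP ((sv l).2 i x).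
  have h3 := is_deriveD (is_deriveZ c h1) h2.
  by rewrite (@derive_val _ _ _ _ _ _ _ h3).
split; last by move=> l x; rewrite pE.
move=> l; rewrite pE; split=> [x|i x].
  have h1 : partials l u y @[y --> x] --> partials l u x := (su l).1 x.
  have h2 : partials l v y @[y --> x] --> partials l v x := (sv l).1 x.
  exact: (cvgD (cvgM (cvg_cst c) h1) h2).
have h1 := derivableP ((su l).2 i x); have h2 := derivableP ((sv l).2 i x).
have h3 := is_deriveD (is_deriveZ c h1) h2.
exact: (@ex_derive _ _ _ _ _ _ _ h3).
Qed.

Lemma Re_lin (a z w : R[i]) : Re (a * z + w) = Re a * Re z + (- Im a * Im z + Re w).
Proof. by rewrite ReD ReM; ring. Qed.

Lemma Im_lin (a z w : R[i]) : Im (a * z + w) = Re a * Im z + (Im a * Re z + Im w).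
Proof. by rewrite ImD ImM; ring. Qed.

Lemma smooth_lin (a : R[i]) f g : smooth f -> smooth g ->
  smooth (fun x => a * f x + g x) /\
  forall l x, cpartials l (fun x => a * f x + g x) x = a * cpartials l f x + cpartials l g x.
Proof.
move=> [f1 f2] [g1 g2].
have [s1 p1] := smoothR_lin (- Im a) f2 g1; have [s2 p2] := smoothR_lin (Re a) f1 s1.
have [s3 p3] := smoothR_lin (Im a) f1 g2; have [s4 p4] := smoothR_lin (Re a) f2 s3.
have ER : Re \o (fun x => a * f x + g x) =
    (fun x => Re a * (Re \o f) x + (- Im a * (Im \o f) x + (Re \o g) x)).
  by apply/funext => x; rewrite /= Re_lin.
have EI : Im \o (fun x => a * f x + g x) =
    (fun x => Re a * (Im \o f) x + (Im a * (Re \o f) x + (Im \o g) x)).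
  by apply/funext => x; rewrite /= Im_lin.
split; first by split; [rewrite ER; exact: s2|rewrite EI; exact: s4].
move=> l x; rewrite /cpartials ER EI p2 p1 p4 p3.
by apply: complex_eq; rewrite ?Re_lin ?Im_lin.
Qed.

Lemma schwartz_lin (a : R[i]) f g : schwartz f -> schwartz g ->
  schwartz (fun x => a * f x + g x).
Proof.
move=> [sf bf] [sg bg]; have [s p] := smooth_lin a sf sg; split => // m l.
have [C1 h1] := bf m l; have [C2 h2] := bg m l.
exists (cmod a * C1 + C2) => x; rewrite p mulrDr mulrCA.
by rewrite (le_trans (ler_cmodD _ _))// lerD// cmodM ler_wpM2l ?cmod_ge0.
Qed.

Lemma integrableRd_lin (a : R[i]) f g : integrableRd f -> integrableRd g ->
  integrableRd (fun x => a * f x + g x).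
Proof.
move=> [f1 f2] [g1 g2].
have lin (c c' : R) (u v w : d.-tuple (measurableTypeR R) -> R) :
    (lebesgue_tuple d).-integrable setT (EFin \o u) ->
    (lebesgue_tuple d).-integrable setT (EFin \o v) ->
    (lebesgue_tuple d).-integrable setT (EFin \o w) ->
    (lebesgue_tuple d).-integrable setT (EFin \o (fun t => c * u t + (c' * v t + w t))).
  move=> iu iv iw.
  exact: (integrableD measurableT (integrableZl measurableT c iu)
     (integrableD measurableT (integrableZl measurableT c' iv) iw)).
split.
- under eq_fun do rewrite Re_lin; exact: (lin _ _ _ _ _ f1 f2 g1).
- under eq_fun do rewrite Im_lin; exact: (lin _ _ _ _ _ f2 f1 g2).
Qed.

Lemma integrableRd_wave f xi : integrableRd f ->
  cintegrable (lebesgue_tuple d)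
    (fun t : d.-tuple (measurableTypeR R) => f (rowt t) * expi (- (2 * pi * dotv xi (rowt t)))).
Proof.
move=> [f1 f2].
apply: (@dominated_cintegrable _ _ _ (lebesgue_tuple d) _
  (fun t => `|Re (f (rowt t))| + `|Im (f (rowt t))|)).
- apply: cmeasurableM.
    by split; apply/measurable_EFinP; [case/integrableP : f1|case/integrableP : f2].
  apply: cmeasurable_expi; apply: measurableT_comp => //; apply: measurable_funM => //.
  exact: measurable_dotv.
- exact: (integrableD measurableT (integrable_norm f1) (integrable_norm f2)).
- by move=> t; rewrite cmodM cmod_expi mulr1 cmod_le_ReIm.
Qed.

Lemma fourier_lin (a : R[i]) f g xi : integrableRd f -> integrableRd g ->
  fourier (fun x => a * f x + g x) xi = a * fourier f xi + fourier g xi.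
Proof.
move=> fi gi; have hf := integrableRd_wave xi fi; have hg := integrableRd_wave xi gi.
rewrite -[fourier f xi]/(cint (lebesgue_tuple d) _) -[fourier g xi]/(cint (lebesgue_tuple d) _).
rewrite -(cintZ a hf) -(cintD (cintegrableZ a hf) hg).
rewrite -[LHS]/(cint (lebesgue_tuple d) (fun t => (a * f (rowt t) + g (rowt t)) * _)).
by apply: eq_cint => t; rewrite mulrDl mulrA.
Qed.

Lemma is_fraclap_lin s (a : R[i]) f1 g1 f2 g2 : integrableRd f1 -> integrableRd f2 ->
  is_fraclap s f1 g1 -> is_fraclap s f2 g2 ->
  is_fraclap s (fun x => a * f1 x + f2 x) (fun x => a * g1 x + g2 x).
Proof.
move=> i1 i2 [s1 j1 h1] [s2 j2 h2]; split.
- exact: (smooth_lin a s1 s2).1.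
- exact: integrableRd_lin.
- by move=> xi; rewrite !fourier_lin// h1 h2 mulrDr mulrCA.
Qed.

Lemma weighted_supP c p f : (weighted_sup c p f < +oo)%E <->
  exists C, forall x, cmod (f x) * expR (c * enorm x `^ p) <= C.
Proof.
split=> [h|[C hC]]; last first.
  by rewrite (@le_lt_trans _ _ C%:E) ?ltry//; apply: ge_ereal_sup => _ [x _ <-]; rewrite lee_fin.
have b x : ((cmod (f x) * expR (c * enorm x `^ p))%:E <= weighted_sup c p f)%E.
  by apply: ereal_sup_ubound; exists x.
exists (fine (weighted_sup c p f)) => x; rewrite -lee_fin fineK// fin_numElt h andbT.
by rewrite (lt_le_trans _ (b x))// ltNyr.
Qed.

Lemma weighted_sup_ge0 c p f : (0 <= weighted_sup c p f)%E.
Proof.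
apply: (@le_trans _ _ (cmod (f 0) * expR (c * enorm (0 : 'rV[R]_d) `^ p))%:E).
  by rewrite lee_fin mulr_ge0 ?cmod_ge0 ?expR_ge0.
by apply: ereal_sup_ubound; exists 0.
Qed.

Lemma weighted_sup_lin c c1 c2 p (a : R[i]) f g : c <= c1 -> c <= c2 ->
  (weighted_sup c1 p f < +oo)%E -> (weighted_sup c2 p g < +oo)%E ->
  (weighted_sup c p (fun x => (a * f x + g x)%R) < +oo)%E.
Proof.
move=> cc1 cc2 /weighted_supP[C1 h1] /weighted_supP[C2 h2]; apply/weighted_supP.
exists (cmod a * C1 + C2) => x.
have e c' : c <= c' -> expR (c * enorm x `^ p) <= expR (c' * enorm x `^ p).
  by move=> cc; rewrite ler_expR ler_wpM2r ?powR_ge0.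
rewrite (le_trans (ler_wpM2r (expR_ge0 _) (ler_cmodD _ _)))// mulrDl cmodM -mulrA lerD//.
  by rewrite ler_wpM2l ?cmod_ge0// (le_trans _ (h1 x))// ler_wpM2l ?cmod_ge0// e.
by rewrite (le_trans _ (h2 x))// ler_wpM2l ?cmod_ge0// e.
Qed.

Hypothesis d0 : (0 < d)%N.

Lemma wnorm_le_enorm p x : 0 < p -> wnorm p x <= d%:R * enorm x `^ p.
Proof.
move=> p0; rewrite /wnorm -[X in X%:R * _]card_ord mulr_natl -sumr_const.
by apply: ler_sum => i _; rewrite ge0_ler_powR ?nnegrE ?sqrtr_ge0 ?coord_le_enorm// ltW.
Qed.

(** Provides the integrability that additivity of [fourier] requires: [wnorm p x] is at most [d]
    times the power [p] of [enorm x], so the weighted bound gives domination by a tensor product. *)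
Lemma integrableRd_weighted c p f : smooth f -> 0 < c -> 0 < p ->
  (weighted_sup c p f < +oo)%E -> integrableRd f.
Proof.
move=> [s1 s2] c0 p0 /weighted_supP[C hC].
have dR : 0 < d%:R :> R by rewrite ltr0n.
have cd : 0 < c / d%:R by rewrite divr_gt0.
have gi := integrableZl measurableT C (@integrable_expR_wnorm R d _ _ cd p0).
have b x : cmod (f x) <= C * expR (- (c / d%:R * wnorm p x)).
  rewrite expRN ler_pdivlMr ?expR_gt0// (le_trans _ (hC x))// ler_wpM2l ?cmod_ge0// ler_expR.
  by rewrite -mulrA ler_wpM2l ?(ltW c0)// mulrC ler_pdivrMr// mulrC wnorm_le_enorm.
split.
- apply: (@dominated_integrable _ _ _ (lebesgue_tuple d) _ _ _ gi) => [|t].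
    by apply: (@measurable_rowt_continuous _ _ (Re \o f)); exact: (s1 [::]).1.
  by rewrite (le_trans (Re_le_cmod _)).
- apply: (@dominated_integrable _ _ _ (lebesgue_tuple d) _ _ _ gi) => [|t].
    by apply: (@measurable_rowt_continuous _ _ (Im \o f)); exact: (s2 [::]).1.
  by rewrite (le_trans (Im_le_cmod _)).
Qed.

Lemma in_Sspq_bounds s p q f g : 0 < p -> in_Sspq s p q f g ->
  integrableRd f /\ exists c, [/\ 0 < c, (weighted_sup c p f < +oo)%E & (weighted_sup c q g < +oo)%E].
Proof.
move=> p0 [sf _ _ [c c0 h]].
have [h1 h2] : (weighted_sup c p f < +oo)%E /\ (weighted_sup c q g < +oo)%E.
  have := weighted_sup_ge0 c p f; have := weighted_sup_ge0 c q g; move: h.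
  by case: (weighted_sup c p f) => [?||]; case: (weighted_sup c q g) => [?||] //=; rewrite ?ltry.
split; last by exists c.
exact: (integrableRd_weighted sf.1 c0 p0 h1).
Qed.

Lemma in_Sspq_lin s p q (a : R[i]) f1 g1 f2 g2 : 0 < p ->
  in_Sspq s p q f1 g1 -> in_Sspq s p q f2 g2 ->
  in_Sspq s p q (fun x => a * f1 x + f2 x) (fun x => a * g1 x + g2 x).
Proof.
move=> p0 h1 h2.
have [i1 [c1 [c10 a1 b1]]] := in_Sspq_bounds p0 h1.
have [i2 [c2 [c20 a2 b2]]] := in_Sspq_bounds p0 h2.
have [sf1 l1 sg1 _] := h1; have [sf2 l2 sg2 _] := h2.
split.
- exact: schwartz_lin.
- exact: is_fraclap_lin.
- exact: schwartz_lin.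
exists (Num.min c1 c2); first by rewrite lt_min c10.
have m1 : Num.min c1 c2 <= c1 by rewrite ge_min lexx.
have m2 : Num.min c1 c2 <= c2 by rewrite ge_min lexx orbT.
by apply: lte_add_pinfty; [exact: (weighted_sup_lin a m1 m2 a1 a2)|exact: (weighted_sup_lin a m1 m2 b1 b2)].
Qed.

Lemma Sspq_vanishing_lin s p q L M (a : R[i]) f g : 0 < p ->
  Sspq_vanishing s p q L M f -> Sspq_vanishing s p q L M g ->
  Sspq_vanishing s p q L M (fun x => a * f x + g x).
Proof.
move=> p0 [[f' hf] [fL [f'' lf fM]]] [[g' hg] [gL [g'' lg gM]]].
split; first by exists (fun x => a * f' x + g' x); exact: in_Sspq_lin.
split; first by move=> x Lx; rewrite fL// gL// mulr0 addr0.
(* Membership and vanishing on [M] each carry their own witness of the fractional Laplacian; the two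
   pairs are combined separately. *)
exists (fun x => a * f'' x + g'' x).
  have [i1 _] := in_Sspq_bounds p0 hf; have [i2 _] := in_Sspq_bounds p0 hg.
  exact: is_fraclap_lin.
by move=> x Mx; rewrite fM// gM// mulr0 addr0.
Qed.

End linear_structure.

(** * Additional interpolation points and infinite dimension *)

Section conclusion.
Context {R : realType} {d : nat}.
Implicit Types (x y z : 'rV[R]_d) (L M : set 'rV[R]_d).
Hypothesis d0 : (0 < d)%N.

Lemma norm_le_enorm x : `|x| <= enorm x.
Proof.
rewrite [leLHS]/Num.norm /= mx_normrE; apply: bigmax_le => [|[i j] _ /=].
  by rewrite sqrtr_ge0.
by rewrite ord1; exact: coord_le_enorm.
Qed.

Lemma separatedW rho A A' B B' L : A' <= A -> B <= B' -> 0 <= A ->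
  separated rho A B L -> separated rho A' B' L.
Proof.
move=> AA BB A0 h x y Lx Ly yx; apply: le_trans (h x y Lx Ly yx).
rewrite (le_trans (ler_wpM2r (expR_ge0 _) AA))// ler_wpM2l// ler_expR lerN2.
by rewrite ler_wpM2r ?wnorm_ge0.
Qed.

Lemma rho_separatedE rho L : 0 < rho <= 1 -> rho_separated rho L ->
  exists A B, [/\ 0 < A, 0 < B & separated rho A B L].
Proof.
move=> r01 [_ [A [B [A0 B0 h]]]]; exists A, B; split => // x y Lx Ly yx.
have hx := h x Lx; rewrite -lee_fin; apply: le_trans (le_trans hx _).
  rewrite lee_fin ler_wpM2l ?(ltW A0)// ler_expR mulNr lerN2 ler_wpM2l ?(ltW B0)//.
  exact: enorm_powR.
by apply: ereal_inf_lbound; exists y.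
Qed.

Lemma discrete_gap L x : discrete_subset L ->
  exists2 r, 0 < r & forall y, L y -> y <> x -> r <= `|x - y|.
Proof.
move=> dL; have : ~ limit_point L x by rewrite dL.
rewrite /limit_point /= -existsNP => -[U].
rewrite not_implyE => -[nU hU].
have /nbhs_ballP[r /= r0 rU] : nbhs (x : 'rV[R]_d) U := nU.
exists r => // y Ly yx; rewrite leNgt; apply/negP => xy; apply: hU.
exists y; split => //; first exact/eqP.
by apply: rU; rewrite -ball_normE.
Qed.

(** The points lie on a coordinate axis, at nonzero distance at most [r / 2] from the origin, where
    [r] is the gap between [0] and the other points of [L]. They thus avoid the origin, should it
    belong to [L], and stay [r / 2] away from the rest of [L]. *)
Lemma extra_points rho A B L m : 0 < A -> 0 < B -> discrete_subset L -> separated rho A B L ->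
  exists y : 'I_m.+1 -> 'rV[R]_d, [/\ injective y, forall k, ~ L (y k) &
    exists2 A', 0 < A' & separated rho A' B (L `|` range y)].
Proof.
move=> A0 B0 dL sL; have [r r0 gap] := discrete_gap 0 dL.
pose j0 : 'I_d := Ordinal d0.
pose c (k : 'I_m.+1) := r * k.+1%:R / (2 * m.+1%:R).
pose y k := c k *: basisv j0.
pose dl := r / (2 * m.+1%:R).
have dl0 : 0 < dl by rewrite divr_gt0// mulr_gt0.
have cE k : c k = dl * k.+1%:R by rewrite /c /dl mulrAC.
have yE k : (y k) ord0 j0 = c k by rewrite !mxE !eqxx mulr1.
have cle k : c k <= r / 2.
  have -> : r / 2 = dl * m.+1%:R by rewrite /dl invfM mulrA mulfVK// pnatr_eq0.
  by rewrite cE ler_wpM2l ?(ltW dl0)// ler_nat.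
have c_ge k : dl <= c k by rewrite cE ler_peMr ?(ltW dl0)// ler1n.
have yy k l : k <> l -> dl <= enorm (y k - y l).
  move=> kl; apply: le_trans (coord_le_enorm _ j0).
  have -> : (y k - y l) ord0 j0 = c k - c l by rewrite -!yE !mxE.
  rewrite !cE -mulrBr normrM (gtr0_norm dl0) ler_peMr ?(ltW dl0)//.
  have /orP[h|h] : (k < l)%N || (l < k)%N by rewrite -neq_ltn; apply/eqP => /val_inj.
    have : k.+1%:R + 1 <= l.+1%:R :> R by rewrite natr1 ler_nat.
    by rewrite distrC; move: (ler_norm (l.+1%:R - k.+1%:R : R)); lra.
  have : l.+1%:R + 1 <= k.+1%:R :> R by rewrite natr1 ler_nat.
  by move: (ler_norm (k.+1%:R - l.+1%:R : R)); lra.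
have ny k : `|y k| <= c k.
  rewrite normrZ gtr0_norm ?(lt_le_trans dl0)// ler_piMr ?(le_trans (ltW dl0))//.
  rewrite [leLHS]/Num.norm /= mx_normrE; apply: bigmax_le => // -[i j] _ /=.
  by rewrite !mxE; case: (_ && _); rewrite ?normr1 ?normr0.
have xy x k : L x -> dl <= enorm (x - y k).
  move=> Lx; have [->|/eqP x0] := eqVneq x 0.
    rewrite sub0r enormN; apply: le_trans (coord_le_enorm _ j0).
    by rewrite yE (le_trans (c_ge k))// ler_norm.
  apply: le_trans (norm_le_enorm _).
  have := gap x Lx x0; rewrite sub0r normrN => rx.
  have := lerB_dist x (y k); have := ny k; have := cle k; have := c_ge k; lra.
exists y; split.
- move=> k l kl; apply: contrapT => /yy; rewrite kl subrr.
  by rewrite -[X in enorm X](scale0r (0 : 'rV[R]_d)) enormZ// mul0r leNgt dl0.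
- move=> k Lk; have := xy _ k Lk.
  by rewrite subrr -[X in enorm X](scale0r (0 : 'rV[R]_d)) enormZ// mul0r leNgt dl0.
exists (Num.min A dl); first by rewrite lt_min A0.
have mA : Num.min A dl <= A by rewrite ge_min lexx.
have mdl x : Num.min A dl * expR (- (B * wnorm rho x)) <= dl.
  apply: (@le_trans _ _ (dl * expR (- (B * wnorm rho x)))).
    by rewrite ler_wpM2r ?expR_ge0// ge_min lexx orbT.
  by rewrite ler_piMr ?(ltW dl0)// -[leRHS]expR0 ler_expR oppr_le0 mulr_ge0 ?wnorm_ge0 ?ltW.
move=> x z [Lx|[k _ <-]] [Lz|[l _ <-]] zx.
- by rewrite (le_trans (ler_wpM2r (expR_ge0 _) mA))// sL.
- by rewrite (le_trans (mdl x))// xy.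
- by rewrite (le_trans (mdl _))// -enormN opprB xy.
- by rewrite (le_trans (mdl _))// yy// => kl; apply: zx; rewrite kl.
Qed.

(** The interpolation data are the indicator of [y j] on [L] enlarged by the new points; it vanishes
    on [L] because these points are not in [L]. *)
Lemma vanishing_bumps (rho s p q : R) L M m :
  0 < rho < 1 -> 0 < s -> 0 < p < 1 -> 0 < q < 1 ->
  rho_separated rho L -> rho_separated rho M ->
  exists (y : 'I_m.+1 -> 'rV[R]_d) (f : 'I_m.+1 -> 'rV[R]_d -> R[i]),
    (forall j, Sspq_vanishing s p q L M (f j)) /\
    forall j k, f j (y k) = (j == k)%:R.
Proof.
move=> /andP[r0 r1] s0 /andP[p0 p1] /andP[q0 q1] sL sM.
(* [theta] has to exceed [rho] for the interpolation, and [p] and [q] for membership, while staying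
   below [1]. *)
pose theta := (1 + Num.max rho (Num.max p q)) / 2.
have m1 : Num.max rho (Num.max p q) < 1 by rewrite !gt_max r1 p1.
have [rm pm qm] : [/\ rho <= Num.max rho (Num.max p q), p <= Num.max rho (Num.max p q) &
    q <= Num.max rho (Num.max p q)] by rewrite !le_max !lexx !orbT.
have t1 : theta < 1 by rewrite /theta; lra.
have rt : 0 < rho < theta by rewrite r0 /theta; lra.
have pt : 0 < p < theta by rewrite p0 /theta; lra.
have qt : 0 < q < theta by rewrite q0 /theta; lra.
have th0 : 0 < theta by case/andP: rt => /lt_trans h /h.
have r01 : 0 < rho <= 1 by rewrite r0 ltW.
have [A1 [B1 [A10 B10 s1]]] := rho_separatedE r01 sL.
have [A2 [B2 [A20 B20 s2]]] := rho_separatedE r01 sM.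
have [y [yinj yL [A3 A30 s3]]] := extra_points m A10 B10 sL.1 s1.
exists y.
pose A := Num.min A3 A2; pose B := Num.max B1 B2.
have A0 : 0 < A by rewrite lt_min A30.
have B0 : 0 < B by rewrite lt_max B10.
have sL' : separated rho A B (L `|` range y).
  by apply: separatedW s3; rewrite ?(ltW A30)// /A /B ?ge_min ?le_max lexx ?orbT.
have sM' : separated rho A B M.
  by apply: separatedW s2; rewrite ?(ltW A20)// /A /B ?ge_min ?le_max lexx ?orbT.
have /choice[f hf] : forall j, exists f : 'rV[R]_d -> R[i],
    Sspq_vanishing s p q L M f /\ forall k, f (y k) = (j == k)%:R.
  move=> j; pose b x : R := (x == y j)%:R.
  have hb x : (L `|` range y) x -> `|b x| <= expR (wnorm theta (y j)) * expR (- wnorm theta x).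
    move=> _; rewrite /b; case: eqP => [->|_]; last by rewrite normr0 mulr_ge0 ?expR_ge0.
    by rewrite normr1 -expRD subrr expR0.
  have [F [G [dF dG FL GM ft]]] := interpolation d0 rt t1 s0 A0 B0 sL' sM' (expR_ge0 _) hb.
  have inS := decaying_in_Sspq th0 pt qt t1 dF dG ft.
  exists (fun x => (F x)%:C); split.
    split; first by exists (fun x => (G x)%:C).
    split; last by exists (fun x => (G x)%:C); [case: inS|move=> x Mx; rewrite GM].
    move=> x Lx; rewrite FL; last by left.
    by rewrite /b; case: eqP => // xy; case: (yL j); rewrite -xy.
  move=> k; rewrite FL; last by right; exists k.
  rewrite /b (inj_eq yinj) eq_sym; by case: (j == k).
by exists f; split => [j|j k]; [exact: (hf j).1|exact: (hf j).2].
Qed.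

End conclusion.

(** If [n] functions spanned, the identity matrix of size [n + 1] formed by the values [f j (y k)]
    would factor through dimension [n], against its rank. *)
Lemma not_finitely_spanned (K : fieldType) (X : Type) (V : set (X -> K)) :
  (forall m, exists (y : 'I_m.+1 -> X) (f : 'I_m.+1 -> X -> K),
    (forall j, V (f j)) /\ forall j k, f j (y k) = (j == k)%:R) ->
  ~ finitely_spanned V.
Proof.
move=> h [n [e [_ span]]]; have [y [f [Vf fy]]] := h n.
have /choice[a ha] : forall j, exists a : 'I_n -> K, forall x, f j x = \sum_(i < n) a i * e i x.
  by move=> j; exact: span.
have E : 1%:M = (\matrix_(j < n.+1, i < n) a j i) *m (\matrix_(i < n, k < n.+1) e i (y k)).
  by apply/matrixP => j k; rewrite !mxE -fy ha; apply: eq_bigr => i _; rewrite !mxE.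
have := mxrank1 K n.+1; rewrite E => r.
have := leq_trans (mxrankM_maxl _ (\matrix_(i < n, k < n.+1) e i (y k))) (rank_leq_col (\matrix_(j < n.+1, i < n) a j i)).
by rewrite r ltnn.
Qed.

Theorem theorem1p2 (R : realType) (d : nat) (rho s p q : R)
    (L M : set 'rV[R]_d) :
  (1 <= d)%N -> 0 < rho < 1 -> 0 < s -> 0 < p < 1 -> 0 < q < 1 ->
  rho_separated rho L -> rho_separated rho M ->
  infinite_dimensional_space (Sspq_vanishing s p q L M) /\
  nonuniqueness_pair s p q L M.
Proof.
move=> d1 r01 s0 p01 q01 sL sM.
have bumps m := vanishing_bumps d1 m r01 s0 p01 q01 sL sM.
split; last first.
  have [y [f [Vf fy]]] := bumps 0%N; have [Sf [fL fM]] := Vf ord0.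
  exists (f ord0); split => // f0.
  by have := fy ord0 ord0; rewrite f0 eqxx => /esym/eqP; rewrite oner_eq0.
split; last exact: not_finitely_spanned.
have p0 : 0 < p by case/andP: p01.
split; last by move=> a u v; exact: Sspq_vanishing_lin.
(* The zero function is obtained as [- f + f] for some bump [f]. *)
have [y [f [Vf _]]] := bumps 0%N.
have := Sspq_vanishing_lin d1 (-1) p0 (Vf ord0) (Vf ord0).
by congr (Sspq_vanishing _ _ _ _ _ _); apply/funext => x; rewrite mulN1r addNr.
Qed.
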